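(* Let $\sigma^2>0$, $\Pi_0\ge 0$, $0\le a\le 1$, and $Q=\Pi_0(1-a^2)$. Consider testing, from observations $y_1,\dots,y_n$, $$H_0:\ y_i=w_i,\quad i=1,\dots,n,\qquad\text{versus}\qquad H_1:\ y_i=s_i+w_i,\quad i=1,\dots,n,$$ where $\{w_i\}$ is i.i.d. $\mathcal N(0,\sigma^2)$ and $\{s_i\}$ is the stationary Gauss-Markov process $s_{i+1}=as_i+u_i$, $s_1\sim\mathcal N(0,\Pi_0)$, $u_i$ i.i.d. $\mathcal N(0,Q)$, with $s_1$, $\{u_i\}$, $\{w_i\}$ independent. Then, for every level $\alpha\in(0,1)$, the error exponent of the miss probability of the Neyman-Pearson detector with level $\alpha$ (i.e. $P_F\le\alpha$), $K=\lim_{n\to\infty}-\frac1n\log P_M$, exists, is independent of $\alpha$, and equals $$K=\frac12\log\frac{R_e}{\sigma^2}+\frac12\frac{\tilde R_e}{R_e}-\frac12,$$ where $R_e$ and $\tilde R_e$ are the steady-state variances of the innovations process of $\{y_i\}$ calculated under $H_1$ and $H_0$, respectively. Specifically, $$R_e=P+\sigma^2,\qquad \tilde R_e=\sigma^2\left(1+\frac{a^2P^2}{P^2+2\sigma^2P+(1-a^2)\sigma^4}\right),$$ $$P=\frac12\sqrt{[\sigma^2(1-a^2)-Q]^2+4\sigma^2Q}-\frac12\sigma^2(1-a^2)+\frac Q2,$$ where, for $a=1$ (so that $P=0$), the fraction in $\tilde R_e$ is read as $0$, i.e. $\tilde R_e=\sigma^2$. Here $P$ is the steady-state error variance of the minimum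 mean square error (one-step prediction) estimator of $s_i$ under $H_1$. Moreover, this $K$ is a closed form of the spectral expression: for $0\le a<1$, $$K=\frac1{2\pi}\int_0^{2\pi}\left(\frac12\log\frac{S_y^{(1)}(\omega)}{S_y^{(0)}(\omega)}+\frac{S_y^{(0)}(\omega)}{2S_y^{(1)}(\omega)}-\frac12\right)d\omega,$$ with $S_y^{(0)}(\omega)=\sigma^2$ and $S_y^{(1)}(\omega)=\sigma^2+\dfrac{\Pi_0(1-a^2)}{1-2a\cos\omega+a^2}$.
   Context: Logarithms are natural. For each sample size $n$, the Neyman-Pearson detector with level $\alpha$ is the (possibly randomized) test of $H_0$ versus $H_1$ based on $y_1,\dots,y_n$ that minimizes the miss probability $P_M$ (probability under $H_1$ of deciding $H_0$) among all tests whose false-alarm probability $P_F$ (probability under $H_0$ of deciding $H_1$) is at most $\alpha$; $\mathbb E_j$ denotes expectation under $H_j$. Let $\hat y_{i|i-1}$ be the function of $(y_1,\dots,y_{i-1})$ giving the conditional expectation $\mathbb E_1\{y_i\mid y_1,\dots,y_{i-1}\}$ computed under $H_1$ (a linear function), and let $e_i=y_i-\hat y_{i|i-1}$ be the innovation (always computed as if $H_1$ were true). The steady-state variances are $R_e=\lim_{i\to\infty}\mathbb E_1\{e_i^2\}$ and $\tilde R_e=\lim_{i\to\infty}\mathbb E_0\{e_i^2\}$. Similarly $P=\lim_{i\to\infty}\mathbb E_1\{(s_i-\hat s_{i|i-1})^2\}$ with $\hat s_{i|i-1}=\mathbb E_1\{s_i\mid y_1,\dots,y_{i-1}\}$. 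*)

(* Defs.v *)
From HB Require Import structures.
From mathcomp Require Import all_boot all_order all_algebra.
From mathcomp Require Import all_classical all_reals all_analysis.

Set Implicit Arguments.
Unset Strict Implicit.
Unset Printing Implicit Defensive.

Import Order.TTheory GRing.Theory Num.Theory numFieldNormedType.Exports.

Local Open Scope classical_set_scope.
Local Open Scope ring_scope.

(* N(m, v), parametrized by the variance [v]. The case [v = 0] is needed
   ([Pi0 = 0], or [a = 1]) and is the point mass at [m]; [normal_prob m 0] is
   instead the uniform law on [0, 1]. *)
Definition gaussian_law {R : realType} (m v : R) : set R -> \bar R :=
  if v == 0 then \d_m else normal_prob m (Num.sqrt v).

Definition has_law {R : realType} {d : measure_display} {T : measurableType d}
    (P : probability T R) (X : {RV P >-> R}) (mu : set R -> \bar R) : Prop :=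
  forall A : set R, measurable A -> distribution P X A = mu A.

Definition mutually_independent {R : realType} {d : measure_display}
    {T : measurableType d} (P : probability T R) (I : eqType)
    (X : I -> {RV P >-> R}) : Prop :=
  forall (J : seq I) (A : I -> set R), uniq J ->
    (forall j, measurable (A j)) ->
    (P (\bigcap_(j in [set` J]) (X j @^-1` A j))
     = \prod_(j <- J) P (X j @^-1` A j))%E.

(* All indices start at 0: position [i] below is time [i + 1] in the usual
   numbering, so that [past y i] gathers every observation preceding [y i]. *)

Definition sources {R : realType} {d : measure_display} {T : measurableType d}
    (P : probability T R) (s1 : {RV P >-> R}) (u w : nat -> {RV P >-> R})
    (j : option (nat + nat)) : {RV P >-> R} :=
  match j with
  | None => s1
  | Some (inl i) => u i
  | Some (inr i) => w i
  end.

Fixpoint gauss_markov {R : realType} {T : Type} (a : R) (s1 : T -> R)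
    (u : nat -> T -> R) (i : nat) : T -> R :=
  match i with
  | 0%N => s1
  | k.+1 => fun t => a * gauss_markov a s1 u k t + u k t
  end.

Definition past {R : realType} {T : Type} (y : nat -> T -> R) (n : nat)
    (t : T) : n.-tuple R := [tuple y i t | i < n].

(* A randomized test based on n observations: [phi v] is the conditional
   probability of deciding H1 when [v] is observed. *)
Definition is_test {R : realType} (n : nat) (phi : n.-tuple R -> R) : Prop :=
  measurable_fun [set: n.-tuple R] phi /\ (forall v, 0 <= phi v <= 1).

Section detection.
Context {R : realType} {d : measure_display} {T : measurableType d}.
Variable P : probability T R.

(* [y0] and [y1] are the observation processes under H0 and H1. *)
Definition false_alarm (y0 : nat -> T -> R) (n : nat)
    (phi : n.-tuple R -> R) : \bar R :=
  ('E_P[fun t => phi (past y0 n t)])%E.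

Definition miss (y1 : nat -> T -> R) (n : nat)
    (phi : n.-tuple R -> R) : \bar R :=
  ('E_P[fun t => (1 - phi (past y1 n t))%R])%E.

Definition neyman_pearson (y0 y1 : nat -> T -> R) (alpha : R) (n : nat)
    (phi : n.-tuple R -> R) : Prop :=
  [/\ is_test phi,
      (false_alarm y0 phi <= alpha%:E)%E
    & forall psi : n.-tuple R -> R, is_test psi ->
        (false_alarm y0 psi <= alpha%:E)%E -> (miss y1 phi <= miss y1 psi)%E].

(* [g] is a version of the regression function v |-> E[X | Y = v], that is,
   [g \o Y] is a version of the conditional expectation of [X] given the
   sigma-algebra generated by [Y]. *)
Definition is_cond_exp (n : nat) (X : T -> R) (Y : T -> n.-tuple R)
    (g : n.-tuple R -> R) : Prop :=
  [/\ measurable_fun [set: n.-tuple R] g,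
      P.-integrable [set: T] (EFin \o X),
      P.-integrable [set: T] (EFin \o (g \o Y))
    & forall B : set (n.-tuple R), measurable B ->
        (\int[P]_(t in Y @^-1` B) (X t)%:E
         = \int[P]_(t in Y @^-1` B) (g (Y t))%:E)%E].

End detection.

(* Main.v *)
(* The Kalman recursion computes, for every [n], the density [L_n] of the law of
   the first [n] observations under H1 with respect to their law under H0, as a
   product of Gaussian innovation factors; it also identifies the one-step
   predictors and their error variances, whose limits come from the Riccati
   recursion. Under H0, [ln L_n] plus [n * K] is, up to a bounded multiple of the
   squared predictor and a drift that vanishes in the mean, a martingale with
   second moment O(n); hence [ln L_n / n] tends to [- K] in probability. A
   most powerful test of level alpha is no worse than the test [L_n > c] when
   the latter has size at most alpha, and misses with probability at least
   [c * (1 - alpha - e)] when [L_n < c] has null probability at most [e]; taking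
   [c = exp (- n (K -+ eta))] squeezes the exponent.
   For the spectral formula, [S1] factors as
   [Re * |1 - f e^(i w)|^2 / |1 - a e^(i w)|^2] with [f = a * sigma2 / Re], and the
   integrals of [ln |1 - r e^(i w)|^2] and of the Poisson kernel follow from their
   behaviour under [r -> r^2]. *)

Require Import Defs.
From HB Require Import structures.
From mathcomp Require Import all_boot all_order all_algebra.
From mathcomp Require Import all_classical all_reals all_analysis.
From mathcomp Require Import measurable_realfun ring lra.
Set Implicit Arguments.
Unset Strict Implicit.
Unset Printing Implicit Defensive.
Import Order.TTheory GRing.Theory Num.Theory numFieldNormedType.Exports.
Local Open Scope classical_set_scope.
Local Open Scope ring_scope.

(** * Lebesgue integrals and densities *)

(** Both hypotheses live on one probability space, where [y0] is the very noise that enters [y1];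
    the change of measure is thus an identity between two [P]-integrals. The state may be degenerate
    ([Pi0 = 0], or [a = 1], where the state noise vanishes), so every Gaussian is written as a
    scaled standard variable, and only the observation, whose noise has positive variance, is
    reweighted. The identities are stated for nonnegative measurable functions, so that integrals
    can be exchanged without integrability conditions.

    The obstacle in the limits is [a = 1]. For a < 1 the Riccati map and the second moment of the
    predictor contract geometrically. For [a = 1] this contraction is lost, but the error variance
    has a closed form, at most sigma2 / n, which also dominates the second moment of the predictor
    under H0. The multiple p of the squared predictor solves p (1 - f^2) = 1 / Re, with f the limit
    of [pole], and cancels the squared predictor in the limiting drift. At [a = 1] one has f = 1 and
    no such p exists; p = 0 serves there because the second moment itself tends to 0. *)

Section lebesgue_affine.
Context {R : realType}.
Local Notation mu := (@lebesgue_measure R).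

Lemma lebesgue_measure_affine (c b : R) (A : set R) : 0 < c -> measurable A ->
  (c%:E * mu ((fun x : R => (c * x + b)%R : measurableTypeR R) @^-1` A) = mu A)%E.
Proof.
move=> c0 mA.
pose h := (fun x : R => (c * x + b)%R : measurableTypeR R).
have mh : measurable_fun [set: R] h.
  by apply: measurable_funD => //; exact: measurable_funM.
pose c1 : {nonneg R} := NngNum (ltW c0).
apply/esym/(@lebesgue_measure_unique R (mscale c1 (pushforward mu h))) => // _ [[u v]] _ <-.
rewrite [RHS](_ : _ = (c%:E * mu (h @^-1` `]u, v]))%E)//.
rewrite (_ : h @^-1` _ = `](u - b) / c, (v - b) / c]%classic); last first.
  by rewrite /h; apply/seteqP; split => x /=; rewrite !in_itv/= ltr_pdivrMr// ler_pdivlMr// mulrC ltrBlDr lerBrDr.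
rewrite !lebesgue_measure_itv/= !lte_fin ltr_pM2r ?invr_gt0// ltrD2r.
case: ifPn => _; last by rewrite mule0.
by rewrite -EFinD -EFinM -mulrBl opprB addrA subrK mulrCA divff ?gt_eqF// mulr1.
Qed.

Lemma ge0_integral_lebesgueN (f : R -> \bar R) :
  measurable_fun [set: R] f -> (forall x, 0 <= f x)%E ->
  (\int[mu]_x f x = \int[mu]_x f (- x)%R)%E.
Proof.
move=> mf f0.
transitivity (\int[pushforward mu (-%R : _ -> measurableTypeR R)]_x f x)%E.
  apply: eq_measure_integral => /= A mA _.
  exact/esym/lebesgue_measureN.
by rewrite ge0_integral_pushforward.
Qed.

Lemma ge0_integral_affine (c b : R) (f : R -> \bar R) : c != 0 ->
  measurable_fun [set: R] f -> (forall x, 0 <= f x)%E ->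
  (\int[mu]_x f x = `|c|%:E * \int[mu]_x f (c * x + b)%R)%E.
Proof.
wlog: c b f / 0 < c => [hw c0 mf f0|].
  have [c1|c1|c1] := ltrgt0P c; last by rewrite c1 eqxx in c0.
  - by rewrite (hw c b)// gtr0_norm.
  - have mfN : measurable_fun [set: R] (f \o -%R).
      exact: (measurableT_comp mf (@oppr_measurable R setT)).
    have f0N x : (0 <= (f \o -%R) x)%E by exact: f0.
    rewrite ge0_integral_lebesgueN// (hw (- c) (- b) (f \o -%R)) ?oppr_gt0 ?oppr_eq0//.
    rewrite normrN (ltr0_norm c1); congr (_ * _)%E; apply: eq_integral => x _ /=.
    by rewrite mulNr -opprD opprK.
move=> c0 _ mf f0.
pose h := (fun x : R => (c * x + b)%R) : R -> measurableTypeR R.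
have mh : measurable_fun [set: R] h.
  by apply: measurable_funD => //; exact: measurable_funM.
pose c1 : {nonneg R} := NngNum (ltW c0).
rewrite gtr0_norm// (@eq_measure_integral _ _ _ _ (mscale c1 (pushforward mu h)) mu)//=; last first.
  move=> A mA _.
  by rewrite /mscale/= /pushforward lebesgue_measure_affine.
by rewrite ge0_integral_mscale//= ge0_integral_pushforward.
Qed.
End lebesgue_affine.

Import HBNNSimple.

(** Linearity gives the identity for simple functions; monotone convergence along [nnsfun_approx]
    extends it. *)
Lemma ge0_integral_density d (T : measurableType d) (R : realType)
    (mu nu : {measure set T -> \bar R}) (g : T -> R) (f : T -> \bar R) :
  measurable_fun [set: T] g -> (forall x, 0 <= g x) ->
  (forall A, measurable A -> nu A = \int[mu]_(x in A) (g x)%:E)%E ->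
  measurable_fun [set: T] f -> (forall x, 0 <= f x)%E ->
  (\int[nu]_x f x = \int[mu]_x (f x * (g x)%:E))%E.
Proof.
move=> mg g0 nuE mf f0.
pose f_ := nnsfun_approx measurableT mf.
have cf x : ((f_ n x)%:E @[n --> \oo] --> f x)%E by apply: cvg_nnsfun_approx.
have ndf x a b : (a <= b)%N -> f_ a x <= f_ b x.
  by move=> ab; exact/lefP/nd_nnsfun_approx.
have mEg : measurable_fun [set: T] (EFin \o g) by exact/measurable_EFinP.
have sfE (h : {nnsfun T >-> R}) :
    (\int[nu]_x (h x)%:E = \int[mu]_x ((h x)%:E * (g x)%:E))%E.
  have hE x : ((h x)%:E = \sum_(k \in range h) (k * \1_(h @^-1` [set k]) x)%:E)%E.
    by rewrite fsumEFin //= fimfunE.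
  under eq_integral do rewrite hE.
  rewrite ge0_integral_fsum//; last 2 first.
    - by move=> r; exact/measurable_EFinP/measurable_funM.
    - by move=> r x _; rewrite EFinM; exact: nnfun_muleindic_ge0.
  under [RHS]eq_integral.
    move=> x _; rewrite hE ge0_mule_fsuml; last first.
      by move=> r; rewrite EFinM; exact: nnfun_muleindic_ge0.
    over.
  rewrite [RHS]ge0_integral_fsum//; last 2 first.
    - move=> r; apply: emeasurable_funM => //.
      exact/measurable_EFinP/measurable_funM.
    - move=> r x _; apply: mule_ge0; last by rewrite lee_fin.
      by rewrite EFinM; exact: nnfun_muleindic_ge0.
  apply: eq_fsbigr => k; rewrite inE => -[z _ <-].
  have z0 : 0 <= h z by [].
  have mB : measurable (h @^-1` [set h z]) by [].
  transitivity ((h z)%:E * nu (h @^-1` [set h z]))%E.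
    under eq_integral do rewrite EFinM.
    by rewrite ge0_integralZl// ?lee_fin// ?integral_indic ?setIT//; exact/measurable_EFinP.
  rewrite nuE// integral_mkcond -ge0_integralZl ?lee_fin//; last 2 first.
    - by apply/(measurable_restrictT _ _).1 => //; exact: measurable_funTS.
    - by move=> x _; rewrite patchE; case: ifP => //; rewrite lee_fin.
  apply: eq_integral => x _; rewrite EFinM -muleA; congr (_ * _)%E.
  by rewrite patchE indicE; case: ifP; rewrite ?mul1e ?mul0e.
transitivity (limn (fun n => \int[nu]_x (f_ n x)%:E))%E.
  rewrite -monotone_convergence//.
  - by apply: eq_integral => x _; exact/esym/cvg_lim.
  - by move=> n; exact/measurable_EFinP.
  - by move=> n x _; rewrite lee_fin.
  - by move=> x _ a b ab; rewrite lee_fin; exact: ndf.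
rewrite (_ : (fun n => _) = (fun n => \int[mu]_x ((f_ n x)%:E * (g x)%:E))%E); last first.
  by apply/funext => n; exact: sfE.
rewrite -monotone_convergence//.
- apply: eq_integral => x _; apply/cvg_lim => //.
  apply: cvgeZr => //; exact: cf.
- by move=> n; apply: emeasurable_funM => //; exact/measurable_EFinP.
- by move=> n x _; rewrite -EFinM lee_fin mulr_ge0.
- by move=> x _ a b ab; rewrite lee_wpmul2r ?lee_fin//; exact: ndf.
Qed.

(** * The standard Gaussian law *)

(* The composition with the identity only moves [normal_prob] from
   [measurableTypeR R] to the canonical measurable structure of [R]. *)
Definition std_gauss {R : realType} : set R -> \bar R :=
  pushforward (normal_prob (0 : R) 1) (idfun : measurableTypeR R -> R).

Section std_gauss_measure.
Context {R : realType}.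
Local Notation gam := (@std_gauss R).

Let gam0 : gam set0 = 0%E. Proof. exact: (@measure0 _ _ _ (normal_prob (0 : R) 1)). Qed.
Let gam_ge0 A : (0 <= gam A)%E. Proof. exact: (@measure_ge0 _ _ _ (normal_prob (0 : R) 1)). Qed.
Let gam_sigma_additive : semi_sigma_additive gam.
Proof. exact: (@measure_semi_sigma_additive _ _ _ (normal_prob (0 : R) 1)). Qed.
HB.instance Definition _ := isMeasure.Build _ R R gam gam0 gam_ge0 gam_sigma_additive.
Let gam_setT : gam setT = 1%E.
Proof. exact: (@probability_setT _ _ _ (normal_prob (0 : R) 1)). Qed.
HB.instance Definition _ := @Measure_isProbability.Build _ R R gam gam_setT.
End std_gauss_measure.

Lemma measurableT_comp2 d d1 d2 d3 (S : measurableType d) (S1 : measurableType d1)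
    (S2 : measurableType d2) (S3 : measurableType d3) (F : S1 * S2 -> S3)
    (g : S -> S1) (h : S -> S2) :
  measurable_fun [set: S1 * S2] F -> measurable_fun [set: S] g ->
  measurable_fun [set: S] h -> measurable_fun [set: S] (fun x => F (g x, h x)).
Proof.
by move=> mF mg mh; exact: (measurableT_comp mF (measurable_fun_pair mg mh)).
Qed.

(* The default value of [nth] supplies the last entry. *)
Definition snoc {T : Type} n (v : n.-tuple T) (x : T) : n.+1.-tuple T :=
  [tuple nth x v i | i < n.+1].

Lemma past_snoc (R : realType) (T : Type) (y : nat -> T -> R) n t :
  past y n.+1 t = snoc (past y n t) (y n t).
Proof.
apply: eq_from_tnth => i; rewrite !tnth_mktuple.
have [ni|ni] := ltnP i n; last first.
  rewrite nth_default ?size_tuple//; congr y; apply/eqP.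
  by rewrite eqn_leq ni -ltnS ltn_ord.
by rewrite (nth_mktuple _ _ (Ordinal ni)).
Qed.

Lemma measurable_snoc d (S : measurableType d) (R : realType) n
    (g : S -> n.-tuple R) (h : S -> R) :
  measurable_fun [set: S] g -> measurable_fun [set: S] h ->
  measurable_fun [set: S] (fun x => snoc (g x) (h x)).
Proof.
move=> mg mh; apply/measurable_fun_tnthP => i.
have [ni|ni] := ltnP i n; last first.
  apply: eq_measurable_fun mh => x _ /=.
  by rewrite tnth_mktuple nth_default// size_tuple.
apply: (eq_measurable_fun (fun x => tnth (g x) (Ordinal ni))).
  by move=> x _ /=; rewrite tnth_mktuple (tnth_nth (h x)).
by apply: (measurableT_comp (@measurable_tnth _ _ _ _) mg).
Qed.

Ltac mfun := lazymatch goal with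
  | |- measurable_fun _ (fun _ => ?c) => exact: measurable_cst
  (* A summand [c + x] can show up eta-reduced, a form that the rule for sums does not match. *)
  | |- measurable_fun ?D (+%R ?c) =>
      change (measurable_fun D (fun x => c + x)); mfun
  | |- measurable_fun _ (fun x => @?f x - @?g x) =>
      apply: measurable_funB; mfun
  | |- measurable_fun _ (fun x => @?f x + @?g x) =>
      apply: measurable_funD; mfun
  | |- measurable_fun _ (fun x => @?f x * @?g x) =>
      apply: measurable_funM; mfun
  | |- measurable_fun _ (fun x => - @?f x) =>
      apply: measurable_funN; mfun
  | |- measurable_fun _ (fun x => @?f x ^+ _) =>
      apply: measurable_funX; mfun
  | |- measurable_fun _ (fun x => expR (@?f x)) =>
      apply: (measurableT_comp (@measurable_expR _)); mfun
  | |- measurable_fun _ (fun x => (@?f x)%:E) =>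
      apply/measurable_EFinP; mfun
  | |- measurable_fun _ (fun x => (@?f x, @?g x)) =>
      apply: measurable_fun_pair; mfun
  | |- measurable_fun _ (fun x => snoc (@?f x) (@?g x)) =>
      apply: measurable_snoc; mfun
  | |- _ => first
      [ done | exact: measurable_fst | exact: measurable_snd
      | match goal with
        | H : measurable_fun setT ?h |- measurable_fun _ (fun x => ?h (@?f x)) =>
            apply: (measurableT_comp H); mfun
        end
      | lazymatch goal with
        | |- measurable_fun _ (fun x => (@?f x).1) =>
            apply: (measurableT_comp measurable_fst); mfun
        | |- measurable_fun _ (fun x => (@?f x).2) =>
            apply: (measurableT_comp measurable_snd); mfun
        end
      | idtac ]
  end.

(** * Changes of variables for the standard Gaussian law *)

Section std_gauss_integral.
Context {R : realType}.
Local Notation gam := (@std_gauss R).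
Local Notation mu := (@lebesgue_measure R).
Implicit Types (f : R -> \bar R).

Lemma ge0_integral_std_gauss f : measurable_fun [set: R] f ->
  (forall x, 0 <= f x)%E ->
  (\int[gam]_x f x = \int[mu]_x (f x * (normal_pdf 0 1 x)%:E))%E.
Proof.
move=> mf f0.
have mid : measurable_fun [set: measurableTypeR R] (idfun : measurableTypeR R -> R).
  exact: measurable_id.
have f0' : {in [set: R], forall y, 0 <= f y}%E by move=> x _; exact: f0.
rewrite -(@ge0_integral_density _ _ _ mu (normal_prob 0 1))//.
- exact: (@ge0_integral_pushforward _ _ (measurableTypeR R) R R idfun mid
    (normal_prob 0 1) setT f measurableT mf f0').
- exact: measurable_normal_pdf.
- exact: normal_pdf_ge0.
Qed.

(** The weight is |c| times the ratio of the standard density at c x + b to that at x. Keeping the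
    standard law on both sides lets such substitutions be chained, and makes the weight of the
    filter step a likelihood ratio. *)
Lemma std_gauss_affine (c b : R) f : c != 0 -> measurable_fun [set: R] f ->
  (forall x, 0 <= f x)%E ->
  (\int[gam]_x f x = \int[gam]_x (f (c * x + b)%R *
     (`|c| * expR (x ^+ 2 / 2 - (c * x + b) ^+ 2 / 2))%:E))%E.
Proof.
move=> c0 mf f0.
have mcb : measurable_fun [set: R] (fun x => c * x + b).
  by apply: measurable_funD => //; exact: measurable_funM.
have mfc : measurable_fun [set: R] (fun x => f (c * x + b)).
  exact: (measurableT_comp mf mcb).
have mw : measurable_fun [set: R]
    (fun x => `|c| * expR (x ^+ 2 / 2 - (c * x + b) ^+ 2 / 2)).
  apply: measurable_funM => //; apply: measurableT_comp => //.
  by apply: measurable_funB; apply: measurable_funM => //; exact: measurable_funX.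
rewrite !ge0_integral_std_gauss//; last 2 first.
- by apply: emeasurable_funM => //; exact/measurable_EFinP.
- by move=> x; rewrite mule_ge0// lee_fin mulr_ge0// expR_ge0.
rewrite (@ge0_integral_affine R c b)//; last 2 first.
- by apply: emeasurable_funM => //; apply/measurable_EFinP; exact: measurable_normal_pdf.
- by move=> x; rewrite mule_ge0// lee_fin normal_pdf_ge0.
rewrite -ge0_integralZl//; last 2 first.
- apply: emeasurable_funM => //; apply/measurable_EFinP.
  by apply: measurableT_comp => //; exact: measurable_normal_pdf.
- by move=> x _; rewrite mule_ge0// lee_fin normal_pdf_ge0.
apply: eq_integral => x _; rewrite muleCA -muleA -!EFinM; congr (_ * _%:E)%E.
rewrite normal_pdfE ?oner_neq0// /normal_fun -!mulrA; congr (_ * _).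
rewrite mulrCA -expRD; congr (_ * expR _).
by rewrite !subr0 expr1n; field.
Qed.

Lemma std_gauss_sym f : measurable_fun [set: R] f -> (forall x, 0 <= f x)%E ->
  (\int[gam]_x f x = \int[gam]_x f (- x)%R)%E.
Proof.
move=> mf f0; rewrite (@std_gauss_affine (-1) 0)// ?oppr_eq0 ?oner_neq0//.
apply: eq_integral => x _; rewrite normrN1 mul1r addr0 mulN1r sqrrN subrr expR0.
by rewrite mule1.
Qed.

(** This is the scaling x -> c x applied to the constant function 1, whose integral is 1. *)
Lemma std_gauss_exp_sqr (c : R) : 0 < c ->
  (\int[gam]_x (expR ((1 - c ^+ 2) * x ^+ 2 / 2))%:E = c^-1%:E)%E.
Proof.
move=> c0.
have me : measurable_fun [set: R] (fun x => expR ((1 - c ^+ 2) * x ^+ 2 / 2)).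
  apply: measurableT_comp => //; apply: measurable_funM => //.
  by apply: measurable_funM => //; exact: measurable_funX.
have := @std_gauss_affine c 0 (cst 1%E) (lt0r_neq0 c0) (measurable_cst _) (fun=> lee01).
rewrite integral_cst// mul1e [X in X = _]probability_setT => /esym.
under eq_integral => x _.
  rewrite mul1e addr0 gtr0_norm// (_ : _ - _ = (1 - c ^+ 2) * x ^+ 2 / 2); last by field.
  rewrite EFinM; over.
rewrite ge0_integralZl//=; last 2 first.
- exact/measurable_EFinP.
- by rewrite lee_fin ltW.
move=> H.
have /(congr1 (fun x => (c^-1%:E * x)%E)) := H.
by rewrite muleA -EFinM mulVf ?gt_eqF// mul1e mule1.
Qed.

Lemma measurable_std_gauss_integral d (S : measurableType d) (F : S * R -> \bar R) :
  measurable_fun [set: S * R] F -> (forall x, 0 <= F x)%E ->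
  measurable_fun [set: S] (fun x => \int[gam]_z F (x, z))%E.
Proof. by move=> mF F0; exact: (measurable_fun_fubini_tonelli_F F). Qed.

Lemma std_gauss_rotation (c s : R) (F : R * R -> \bar R) : c != 0 ->
  c ^+ 2 + s ^+ 2 = 1 -> measurable_fun [set: R * R] F ->
  (forall x, 0 <= F x)%E ->
  (\int[gam]_x \int[gam]_z F (x, z) =
   \int[gam]_x \int[gam]_z F (c * x + s * z, - s * x + c * z)%R)%E.
Proof.
move=> c0 cs mF F0.
(* The intermediate stage: [p.1] is already the rotated first coordinate, [p.2] still the old second
   variable. *)
pose G1 (p : R * R) := (F (p.1, c^-1 * (p.2 - s * p.1))%R *
  (`|c^-1| * expR (p.1 ^+ 2 / 2 - (c^-1 * p.1 + - (s * p.2 / c)) ^+ 2 / 2))%:E)%E.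
have mG1 : measurable_fun [set: R * R] G1.
  by apply: emeasurable_funM; [apply: (measurableT_comp2 mF); mfun | mfun].
have G10 p : (0 <= G1 p)%E.
  by rewrite mule_ge0// lee_fin mulr_ge0// expR_ge0.
have mF1 : measurable_fun [set: R * R]
    (fun p => F (c * p.1 + s * p.2, - s * p.1 + c * p.2)%R) by apply: (measurableT_comp2 mF); mfun.
have E1 := fubini_tonelli (m1 := gam) (m2 := gam) _ mF1 (fun=> F0 _).
have E2 := fubini_tonelli (m1 := gam) (m2 := gam) _ mG1 G10.
apply: (etrans _ (esym E1)); apply: (@etrans _ _ (\int[gam]_z \int[gam]_x G1 (x, z))%E); last first.
  apply: eq_integral => z _.
  have mz : measurable_fun [set: R] (fun x => F (c * x + s * z, - s * x + c * z)).
    by apply: (measurableT_comp2 mF); mfun.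
  have cV0 : c^-1 != 0 by rewrite invr_eq0.
  apply: (etrans _ (esym (std_gauss_affine (- (s * z / c)) cV0 mz (fun=> F0 _)))).
  apply: eq_integral => x _; rewrite /G1 /=.
  have {1}-> : x = c * (c^-1 * x + - (s * z / c)) + s * z by field.
  congr (F (_, _) * _)%E.
  have -> : - s * (c^-1 * x + - (s * z / c)) + c * z = c^-1 * (- s * x + (c ^+ 2 + s ^+ 2) * z) by field.
  by rewrite cs mul1r mulNr addrC.
apply: (etrans _ E2); apply: eq_integral => x _.
have mx : measurable_fun [set: R] (fun z => G1 (x, z)).
  by apply: (measurableT_comp2 mG1); mfun.
apply: (etrans _ (esym (std_gauss_affine (s * x) c0 mx (fun=> G10 _)))).
apply: eq_integral => z _; rewrite /G1/=.
have -> : c^-1 * (c * z + s * x - s * x) = z by field.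
have -> : c^-1 * x + - (s * (c * z + s * x) / c) = c^-1 * ((1 - s ^+ 2) * x - s * c * z) by field.
have -> : 1 - s ^+ 2 = c ^+ 2 by rewrite -cs addrK.
have -> : c^-1 * (c ^+ 2 * x - s * c * z) = c * x - s * z by field.
have Hc : `|c^-1| * `|c| = 1 by rewrite normfV mulVf ?normr_eq0.
set t1 := x ^+ 2 / 2 - _; set t2 := z ^+ 2 / 2 - _.
(* The two weights are inverse to each other because a rotation preserves x^2 + z^2. *)
suff H : `|c^-1| * expR t1 * (`|c| * expR t2) = 1 by rewrite -muleA -EFinM H mule1.
rewrite mulrACA Hc mul1r -expRD.
rewrite -[RHS](@expR0 R).
congr expR.
rewrite /t1 /t2.
transitivity (((1 - (c ^+ 2 + s ^+ 2)) * (x ^+ 2 + z ^+ 2)) / 2); first by field.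
by rewrite cs subrr !mul0r.
Qed.

Lemma std_gauss_add (c q : R) (h : R -> \bar R) : 0 <= c ->
  measurable_fun [set: R] h -> (forall x, 0 <= h x)%E ->
  (\int[gam]_x \int[gam]_z h (c * x + q * z)%R =
   \int[gam]_x h (Num.sqrt (c ^+ 2 + q ^+ 2) * x)%R)%E.
Proof.
move=> c0 mh h0.
have mhr (r : R) : measurable_fun [set: R] (fun x => h (r * x)).
  by apply: (@measurableT_comp _ _ _ _ _ _ h _ (fun x => r * x)) => //; mfun.
have [->|cn0] := eqVneq c 0.
  under eq_integral => x _ do under eq_integral do rewrite mul0r add0r.
  rewrite integral_cst// expr0n/= add0r sqrtr_sqr [X in (_ * X)%E]probability_setT mule1.
  have [q0|q0] := leP 0 q; first by rewrite ger0_norm.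
  rewrite ltr0_norm//; apply: (etrans (std_gauss_sym (mhr q) (fun=> h0 _))).
  by apply: eq_integral => x _ /=; rewrite mulrN mulNr.
set r := Num.sqrt _.
have r2 : r ^+ 2 = c ^+ 2 + q ^+ 2 by rewrite sqr_sqrtr// addr_ge0// sqr_ge0.
have cp : 0 < c by rewrite lt_def cn0.
have r0 : r != 0 by rewrite -sqrf_eq0 r2 gt_eqF// ltr_wpDr ?sqr_ge0// exprn_gt0.
transitivity (\int[gam]_x \int[gam]_z (fun p : R * R => h (r * p.1)%R) (x, z))%E; last first.
  by apply: eq_integral => x _ /=; rewrite (integral_cst _ measurableT) [X in (_ * X)%E]probability_setT mule1.
have cr0 : c / r != 0 by rewrite mulf_neq0// invr_eq0.
have crqr : (c / r) ^+ 2 + (q / r) ^+ 2 = 1.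
  by rewrite !expr_div_n -mulrDl -r2 divff// sqrf_eq0.
have mF : measurable_fun [set: R * R] (fun p : R * R => h (r * p.1)).
  by apply: (@measurableT_comp _ _ _ _ _ _ h _ (fun p : R * R => r * p.1)) => //; mfun.
apply: (etrans _ (esym (std_gauss_rotation cr0 crqr mF (fun=> h0 _)))).
apply: eq_integral => x _; apply: eq_integral => z _; congr h => /=.
by field.
Qed.

End std_gauss_integral.

Lemma probability_integral_cst d (T : measurableType d) (R : realType)
    (P : probability T R) (c : \bar R) : (\int[P]_x c = c)%E.
Proof. by rewrite integral_cst// [X in (_ * X)%E]probability_setT mule1. Qed.

(** * Moments of the standard Gaussian law *)

Section std_gauss_moments.
Context {R : realType}.
Local Notation gam := (@std_gauss R).

Let integrable_dom (f : R -> R) (M : R) : measurable_fun [set: R] f ->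
  (forall x, `|f x| <= M * expR (x ^+ 2 / 4)) ->
  gam.-integrable [set: R] (EFin \o f).
Proof.
move=> mf fM.
have me : measurable_fun [set: R] (fun x : R => expR (x ^+ 2 / 4)) by mfun.
pose g (x : R) := (M%:E * (expR (x ^+ 2 / 4))%:E)%E.
have gint : gam.-integrable [set: R] g.
  apply: (integrableZl measurableT); apply/integrableP; split.
    exact/measurable_EFinP.
  under eq_integral => x _ do rewrite /= ger0_norm ?expR_ge0//.
  (* The choice c^2 = 1/2 in [std_gauss_exp_sqr] makes exp (x^2 / 4) integrable. *)
  have s2 : 0 < Num.sqrt (2^-1 : R) by rewrite sqrtr_gt0 invr_gt0.
  rewrite (eq_integral (fun x : R => (expR ((1 - Num.sqrt 2^-1 ^+ 2) * x ^+ 2 / 2))%:E)).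
    by rewrite std_gauss_exp_sqr// ltry.
  by move=> x _; congr (expR _)%:E; rewrite sqr_sqrtr ?invr_ge0//; field.
apply: (le_integrable measurableT _ _ gint); first exact/measurable_EFinP.
by move=> x _ /=; rewrite lee_fin (le_trans (fM x))// ler_norm.
Qed.

Lemma sqr_le_expR (x : R) : x ^+ 2 / 4 <= expR (x ^+ 2 / 4).
Proof. by have := @expR_ge1Dx R (x ^+ 2 / 4); lra. Qed.

Lemma exp4_le_expR (x : R) : x ^+ 4 <= 64 * expR (x ^+ 2 / 4).
Proof.
have -> : x ^+ 2 / 4 = x ^+ 2 / 8 + x ^+ 2 / 8 by field.
rewrite expRD; have := @expR_ge1Dx R (x ^+ 2 / 8); set e := expR _ => he.
have x2 : 0 <= x ^+ 2 by exact: sqr_ge0.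
have {}he : x ^+ 2 / 8 <= e by lra.
have -> : x ^+ 4 = 64 * ((x ^+ 2 / 8) * (x ^+ 2 / 8)) by field.
by rewrite ler_pM2l// ler_pM// divr_ge0.
Qed.

Lemma integrable_std_gauss_sqr :
  gam.-integrable [set: R] (EFin \o (fun x => x ^+ 2)).
Proof.
apply: (@integrable_dom _ 4); first by mfun.
by move=> x; rewrite ger0_norm ?sqr_ge0//; have := sqr_le_expR x; lra.
Qed.

Lemma integrable_std_gauss_exp4 :
  gam.-integrable [set: R] (EFin \o (fun x => x ^+ 4)).
Proof.
apply: (@integrable_dom _ 64); first by mfun.
by move=> x; rewrite ger0_norm ?exprn_even_ge0//; exact: exp4_le_expR.
Qed.

Lemma integrable_std_gauss_id : gam.-integrable [set: R] (EFin \o id).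
Proof.
apply: (@integrable_dom _ 4); first exact: measurable_id.
move=> x; have := sqr_le_expR x; have := @expR_ge1Dx R (x ^+ 2 / 4).
have := sqr_ge0 (`|x| - 2); rewrite -(real_normK (num_real x)).
by set y := `|x|; rewrite /=; nra.
Qed.

Lemma integrable_std_gauss_cst (c : R) : gam.-integrable [set: R] (EFin \o cst c).
Proof. exact: finite_measure_integrable_cst. Qed.

Lemma std_gauss_mean : (\int[gam]_x x = 0)%R.
Proof.
rewrite /Rintegral integralE.
have -> : (\int[gam]_x ((fun x : R => x%:E)^\- x) = \int[gam]_x ((fun x : R => x%:E)^\+ x))%E.
  have mp : measurable_fun [set: R] ((fun x : R => x%:E)^\+)%E.
    by apply: measurable_funepos; exact/measurable_EFinP.
  rewrite [RHS](std_gauss_sym mp)//.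
  by apply: eq_integral => x _; rewrite funeposE funenegE EFinN.
rewrite subee//.
have /integrable_funepos := integrable_std_gauss_id.
by move=> /(_ measurableT) /integrable_fin_num; apply.
Qed.

(* Comparing [E exp ((1 - c^2) X^2 / 2) = 1 / c] with the tangent line of
   the exponential at the origin pins the second moment from both sides as c -> 1. *)
Lemma std_gauss_variance : (\int[gam]_x x ^+ 2 = 1)%R.
Proof.
set m := (\int[gam]_x _)%R.
have mE : (\int[gam]_x (x ^+ 2)%:E = m%:E)%E.
  by rewrite /m /Rintegral fineK//; exact: integrable_fin_num integrable_std_gauss_sqr.
have key (c : R) : 0 < c -> 1 + (1 - c ^+ 2) / 2 * m <= c^-1.
  move=> c0; rewrite -lee_fin -std_gauss_exp_sqr//.
  have int1 : gam.-integrable [set: R] (EFin \o (fun x => 1 + (1 - c ^+ 2) / 2 * x ^+ 2)).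
    exact: (integrableD measurableT (integrable_std_gauss_cst 1)
      (integrableZl measurableT ((1 - c ^+ 2) / 2) integrable_std_gauss_sqr)).
  have -> : (1 + (1 - c ^+ 2) / 2 * m)%:E =
      (\int[gam]_x (1 + (1 - c ^+ 2) / 2 * x ^+ 2)%:E)%E.
    under eq_integral do rewrite EFinD.
    rewrite (integralD measurableT (integrable_std_gauss_cst 1)
      (integrableZl measurableT ((1 - c ^+ 2) / 2) integrable_std_gauss_sqr)).
    rewrite [X in (X + _)%E](probability_integral_cst gam 1).
    by rewrite (integralZl measurableT integrable_std_gauss_sqr) mE.
  apply: le_integral => //.
    apply/integrableP; split.
      by apply/measurable_EFinP; mfun.
    under eq_integral => x _ do rewrite /= ger0_norm ?expR_ge0//.
    by rewrite std_gauss_exp_sqr// ltry.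
  move=> x _; rewrite lee_fin (_ : _ * _ / 2 = (1 - c ^+ 2) / 2 * x ^+ 2); last by field.
  exact: expR_ge1Dx.
apply/eqP; rewrite eq_le; apply/andP; split; rewrite leNgt; apply/negP => hm.
(* At c = 1 - e the inequality amounts to m (1 - 3e/2 + e^2/2) <= 1. This e keeps the loss 3em/2
   below m - 1, a contradiction. *)
- pose e := Num.min (2^-1) ((m - 1) / (4 * m)).
  have e0 : 0 < e by rewrite lt_min; apply/andP; split; [lra | apply: divr_gt0; lra].
  have e2 : e <= 2^-1 by rewrite ge_min lexx.
  have em : e * (4 * m) <= m - 1.
    by rewrite -ler_pdivlMr; [rewrite ge_min lexx orbT | lra].
  have c0 : 0 < 1 - e by lra.
  have := key _ c0; rewrite -(ler_pM2r c0) (mulVf (lt0r_neq0 c0)).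
  have -> : (1 + (1 - (1 - e) ^+ 2) / 2 * m) * (1 - e) =
    1 + e * (m * (1 - (3 * e) / 2 + e ^+ 2 / 2) - 1) by field.
  rewrite gerDl pmulr_rle0//.
  have : 0 <= m * e ^+ 2 by rewrite mulr_ge0 ?sqr_ge0//; lra.
  lra.
(* With m = 1 - 4e and c = 1 + e the first-order terms cancel and the remaining excess is e^2 times
   a positive factor. *)
- pose e := (1 - m) / 4.
  have e0 : 0 < e by rewrite /e; lra.
  have c0 : 0 < 1 + e by lra.
  have := key _ c0; rewrite -(ler_pM2r c0) (mulVf (lt0r_neq0 c0)).
  have -> : m = 1 - 4 * e by rewrite /e; field.
  have -> : (1 + (1 - (1 + e) ^+ 2) / 2 * (1 - 4 * e)) * (1 + e) =
    1 + (e ^+ 2 * (5 / 2 + (11 / 2) * e + 2 * e ^+ 2)) by field.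
  rewrite gerDl leNgt mulr_gt0// ?exprn_gt0//.
  have := sqr_ge0 e; lra.
Qed.

Lemma std_gauss_quadratic (a b c : R) :
  (\int[gam]_x (a + b * x + c * x ^+ 2)%:E = (a + c)%:E)%E.
Proof.
have ib := integrableZl measurableT b integrable_std_gauss_id.
have ic := integrableZl measurableT c integrable_std_gauss_sqr.
have iab := integrableD measurableT (integrable_std_gauss_cst a) ib.
apply: etrans (integralD measurableT iab ic) _.
rewrite (integralD measurableT (integrable_std_gauss_cst a) ib).
rewrite (integralZl measurableT integrable_std_gauss_id).
rewrite (integralZl measurableT integrable_std_gauss_sqr).
rewrite [X in (X + _ + _)%E](probability_integral_cst gam a%:E).
have -> : (\int[gam]_x (EFin \o id) x = 0%:E)%E.
  rewrite -std_gauss_mean /Rintegral fineK//.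
  exact: integrable_fin_num integrable_std_gauss_id.
have -> : (\int[gam]_x (EFin \o (fun x : R => x ^+ 2)%R) x = 1%:E)%E.
  rewrite -std_gauss_variance /Rintegral fineK//.
  exact: integrable_fin_num integrable_std_gauss_sqr.
by rewrite mule0 mule1 adde0.
Qed.

Lemma std_gauss_sqr_affine (a b : R) :
  (\int[gam]_x ((a + b * x) ^+ 2)%:E = (a ^+ 2 + b ^+ 2)%:E)%E.
Proof.
rewrite -(std_gauss_quadratic (a ^+ 2) (2 * a * b) (b ^+ 2)).
by apply: eq_integral => x _; congr EFin; ring.
Qed.

(** Adding the square of b x - c (x^2 - 1) to the integrand removes the cubic cross term; this is
    where the factor 2 on b^2 comes from, and only finiteness of the fourth moment is then needed.
    The coefficient of a^2 has to be exactly 1: a will be the martingale so far, whose second moment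
    must grow linearly. *)
Lemma std_gauss_quartic_le : exists M : R, 0 <= M /\ forall a b c : R,
  (\int[gam]_x ((a + b * x + c * (x ^+ 2 - 1)) ^+ 2)%:E <=
   (a ^+ 2 + 2 * b ^+ 2 + M * c ^+ 2)%:E)%E.
Proof.
pose m4 := (\int[gam]_x x ^+ 4)%R.
have m4E : (\int[gam]_x (x ^+ 4)%:E = m4%:E)%E.
  by rewrite /m4 /Rintegral fineK//; exact: integrable_fin_num integrable_std_gauss_exp4.
have m40 : 0 <= m4 by apply: Rintegral_ge0 => x _; exact: exprn_even_ge0.
exists (2 * (1 + m4)); split; first by lra.
move=> a b c.
have ib := integrableZl measurableT (2 * a * b) integrable_std_gauss_id.
have ic := integrableZl measurableT (2 * a * c + 2 * b ^+ 2) integrable_std_gauss_sqr.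
have ia := integrable_std_gauss_cst (a ^+ 2 - 2 * a * c + 2 * c ^+ 2).
have i4 := integrableZl measurableT (2 * c ^+ 2) integrable_std_gauss_exp4.
have i123 := integrableD measurableT (integrableD measurableT ia ib) ic.
pose q x := (a ^+ 2 - 2 * a * c + 2 * c ^+ 2) + (2 * a * b) * x + (2 * a * c + 2 * b ^+ 2) * x ^+ 2.
apply: (@le_trans _ _ (\int[gam]_x (q x + (2 * c ^+ 2) * x ^+ 4)%:E)%E).
  apply: ge0_le_integral => //.
  - by move=> x _; rewrite lee_fin sqr_ge0.
  - by apply/measurable_EFinP; mfun.
  - by apply/measurable_EFinP; rewrite /q; mfun.
  - move=> x _; rewrite lee_fin /q -subr_ge0.
    rewrite (_ : _ - _ = (b * x - c * (x ^+ 2 - 1)) ^+ 2 + 4 * c ^+ 2 * x ^+ 2); last by ring.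
    by rewrite addr_ge0 ?sqr_ge0// mulr_ge0 ?sqr_ge0// mulr_ge0 ?sqr_ge0.
rewrite [leLHS](integralD measurableT i123 i4) (integralZl measurableT integrable_std_gauss_exp4) m4E.
rewrite [X in (X + _)%E](std_gauss_quadratic (a ^+ 2 - 2 * a * c + 2 * c ^+ 2) (2 * a * b) (2 * a * c + 2 * b ^+ 2)).
by rewrite -EFinM -EFinD lee_fin; lra.
Qed.
End std_gauss_moments.

Lemma ge0_integral_same_law d1 d2 d3 (T1 : measurableType d1) (T2 : measurableType d2)
    (S : measurableType d3) (R : realType) (m1 : {measure set T1 -> \bar R})
    (m2 : {measure set T2 -> \bar R}) (X : T1 -> S) (Y : T2 -> S) (f : S -> \bar R) :
  measurable_fun [set: T1] X -> measurable_fun [set: T2] Y ->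
  (forall A, measurable A -> m1 (X @^-1` A) = m2 (Y @^-1` A)) ->
  measurable_fun [set: S] f -> (forall x, 0 <= f x)%E ->
  (\int[m1]_x f (X x) = \int[m2]_x f (Y x))%E.
Proof.
move=> mX mY XY mf f0.
have f0' : {in [set: S], forall y, 0 <= f y}%E by move=> x _; exact: f0.
have E1 := ge0_integral_pushforward mX m1 measurableT mf f0'.
have E2 := ge0_integral_pushforward mY m2 measurableT mf f0'.
apply: (etrans (esym E1)); apply: (etrans _ E2).
by apply: eq_measure_integral => A mA _; exact: XY.
Qed.

(** * Independent Gaussian sources *)

Section gaussian_law.
Context {R : realType}.
Local Notation gam := (@std_gauss R).
Local Notation mu := (@lebesgue_measure R).

(** The point mass at v = 0 and the normal law at v > 0 receive the same description, so that later
    arguments need no case distinction on the variance. *)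
Lemma gaussian_lawE (v : R) (A : set R) : 0 <= v -> measurable A ->
  gaussian_law 0 v A = gam ((fun z => Num.sqrt v * z) @^-1` A).
Proof.
move=> v0 mA; rewrite /gaussian_law; case: eqVneq => [->|vn0].
  have [A0|A0] := pselect (A 0).
    rewrite diracE mem_set// (_ : _ @^-1` _ = setT) ?probability_setT//.
    by apply/seteqP; split => // x _ /=; rewrite sqrtr0 mul0r.
  rewrite diracE memNset// (_ : _ @^-1` _ = set0) ?measure0//.
  by apply/seteqP; split => // x /=; rewrite sqrtr0 mul0r.
have s0 : Num.sqrt v != 0 by rewrite sqrtr_eq0 -ltNge lt_def vn0.
have sp : 0 < Num.sqrt v by rewrite lt_def s0 sqrtr_ge0.
have mB : measurable ((fun z => Num.sqrt v * z) @^-1` A).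
  rewrite -[X in measurable X]setTI; apply: (_ : measurable_fun setT _) => //.
  by mfun.
rewrite /std_gauss /pushforward /normal_prob.
rewrite integral_mkcond (@ge0_integral_affine R (Num.sqrt v) 0)//; last 2 first.
- apply/(measurable_restrictT _ _).1 => //; apply/measurable_EFinP/measurable_funTS.
  exact: measurable_normal_pdf.
- by move=> x; rewrite patchE; case: ifP => //; rewrite lee_fin normal_pdf_ge0.
rewrite [RHS]integral_mkcond -ge0_integralZl//; last 2 first.
- apply: (@measurableT_comp _ _ _ _ _ _ _ _ (fun x => Num.sqrt v * x + 0)); last by mfun.
  apply/(measurable_restrictT _ _).1 => //; apply/measurable_EFinP/measurable_funTS.
  exact: measurable_normal_pdf.
- by move=> x _; rewrite patchE; case: ifP => //; rewrite lee_fin normal_pdf_ge0.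
apply: eq_integral => x _; rewrite !patchE addr0.
have -> : (x \in idfun @^-1` ((fun z => Num.sqrt v * z) @^-1` A)) = (Num.sqrt v * x \in A).
  by apply/idP/idP; rewrite !inE.
case: ifP => _; last by rewrite mule0.
rewrite -EFinM; congr EFin; rewrite !normal_pdfE ?oner_neq0// /normal_peak /normal_fun.
rewrite gtr0_norm// mulrA; congr (_ * expR _); last first.
  by rewrite !subr0 expr1n; field.
rewrite expr1n -!mulrnAr mul1r sqrtrM ?sqr_ge0// sqrtr_sqr gtr0_norm// invfM mulrA divff//.
by rewrite mul1r.
Qed.

Lemma has_law_gaussian_integral d (T : measurableType d) (P : probability T R)
    (X : {RV P >-> R}) (v : R) (f : R -> \bar R) : 0 <= v ->
  has_law X (gaussian_law 0 v) -> measurable_fun [set: R] f ->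
  (forall x, 0 <= f x)%E ->
  (\int[P]_t f (X t) = \int[gam]_z f (Num.sqrt v * z)%R)%E.
Proof.
move=> v0 lX mf f0; apply: (ge0_integral_same_law (Y := fun z => Num.sqrt v * z)) => //.
  by mfun.
move=> A mA; have := lX A mA; by rewrite gaussian_lawE// => <-.
Qed.
End gaussian_law.

Section independence.
Context {R : realType} {d : measure_display} {T : measurableType d}.
Variables (P : probability T R) (I : eqType) (X : I -> {RV P >-> R}).

(** The finite boxes over [J] form a family closed under intersection that generates the
    sigma-algebra of the variables indexed by [J]. *)
Definition cylinders (J : seq I) : set (set T) :=
  [set E | exists A : I -> set R, (forall j, measurable (A j)) /\
     E = \bigcap_(j in [set` J]) (X j @^-1` A j)].

Lemma cylinder_preimage J j (A : set R) : j \in J -> measurable A ->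
  cylinders J (X j @^-1` A).
Proof.
move=> jJ mA; exists (fun i => if i == j then A else setT); split.
  by move=> i; case: ifP.
apply/seteqP; split => [t At i _ /=|t /(_ j jJ)]; last by rewrite /= eqxx.
by case: eqVneq => [->|].
Qed.

Lemma cylinders_setI J : setI_closed (cylinders J).
Proof.
move=> _ _ [A [mA ->]] [B [mB ->]]; exists (fun j => A j `&` B j); split.
  by move=> j; exact: measurableI.
by rewrite -bigcapI; apply: eq_bigcapr => j _; rewrite preimage_setI.
Qed.

Lemma cylinders_measurable J : cylinders J `<=` measurable.
Proof.
move=> _ [A [mA ->]]; elim: J => [|j J IH].
  by rewrite (_ : \bigcap_(_ in _) _ = setT)//; apply/seteqP; split.
rewrite (_ : \bigcap_(_ in _) _ =
    X j @^-1` A j `&` \bigcap_(i in [set` J]) (X i @^-1` A i)).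
  by apply: measurableI => //; exact: measurable_funPTI.
apply/seteqP; split => [t h|t [hj hJ] i /=].
  by split=> [|i iJ]; apply: h; rewrite /= inE ?eqxx// [i \in J]iJ orbT.
by rewrite inE => /orP[/eqP->//|]; exact: hJ.
Qed.

Lemma cylinders_setT J : cylinders J setT.
Proof.
by exists (fun=> setT); split => //; apply/seteqP; split => // t _ j _.
Qed.

Lemma sigma_cylinders_measurable J : <<s cylinders J >> `<=` measurable.
Proof.
apply: smallest_sub; first exact: sigma_algebra_measurable.
exact: cylinders_measurable.
Qed.

Hypothesis indX : mutually_independent X.

(** As functions of E, both sides are finite measures. They agree on the cylinders by mutual
    independence, hence on the sigma-algebra generated by them. *)
Lemma independent_cylinders J k B E : k \notin J -> measurable B ->
  <<s cylinders J >> E -> (P (E `&` X k @^-1` B) = P E * P (X k @^-1` B))%E.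
Proof.
move=> kJ mB; have mXB : measurable (X k @^-1` B) by exact: measurable_funPTI.
have c0 : 0 <= fine (P (X k @^-1` B)) by rewrite fine_ge0.
have cE : ((fine (P (X k @^-1` B)))%:E = P (X k @^-1` B))%E.
  by rewrite fineK// fin_num_measure.
rewrite muleC -cE => sE.
pose m1 := mrestr P mXB.
pose m2 := mscale (NngNum c0) P.
apply: (@g_sigma_algebra_measure_unique _ _ _ (cylinders J) (@cylinders_measurable J)
  (fun=> setT) (fun=> cylinders_setT J) _ m1 m2 (@cylinders_setI J)) => //.
- by apply/seteqP; split => // t _; exists 0%N.
- move=> _ [A [mA ->]]; 
  rewrite [RHS](_ : _ = P (X k @^-1` B) *
    P (\bigcap_(j in [set` J]) (X j @^-1` A j)))%E; last first.
    by rewrite -[in RHS]cE.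
  rewrite /m1 /mrestr.
  (* The box over [J] and the event on [X k] merge into one box over [k :: undup J]; duplicates are
     removed because independence is stated for duplicate-free lists. *)
  pose A' j := if j == k then B else A j.
  have mA' j : measurable (A' j) by rewrite /A'; case: ifP.
  have uJ := undup_uniq J.
  have E1 : forall A : I -> set R, \bigcap_(j in [set` J]) (X j @^-1` A j) =
      \bigcap_(j in [set` undup J]) (X j @^-1` A j).
    move=> C; apply/seteqP; split => t h j /= jJ; apply: h => /=; move: jJ;
    by rewrite mem_undup.
  have kJ' : k \notin undup J by rewrite mem_undup.
  have JA' j : j \in undup J -> A' j = A j.
    by rewrite /A'; case: eqVneq => // -> /(negP kJ').
  have E2 : \bigcap_(j in [set` J]) (X j @^-1` A j) `&` X k @^-1` B =
      \bigcap_(j in [set` k :: undup J]) (X j @^-1` A' j).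
    rewrite E1; apply/seteqP; split => [t [hA hB] j /=|t h].
      rewrite inE /A' => /orP[/eqP->|jJ]; first by rewrite eqxx.
      by rewrite -/(A' j) JA'//; exact: hA.
    split; last by have := h k; rewrite /= mem_head /A' eqxx; exact.
    move=> j /= jJ; rewrite -(JA' _ jJ); apply: h => /=.
    by rewrite inE jJ orbT.
  transitivity (P (\bigcap_(j in [set` k :: undup J]) (X j @^-1` A' j))); first by rewrite -E2.
  rewrite indX//= ?kJ'// big_cons {1}/A' eqxx E1 indX//; congr (_ * _)%E.
  by apply: eq_big_seq => j jJ; rewrite JA'.
- move=> _; apply: (@le_lt_trans _ _ 1%E); last exact: ltry.
  by apply: probability_le1; exact: measurableI.
Qed.

(* The law of the past together with a fresh variable is a product; the past is
   the whole sample space, but equipped with the sigma-algebra of [J] only. *)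
Lemma integral_independent J k v (f : g_sigma_algebraType (cylinders J) * R -> \bar R) :
  0 <= v -> k \notin J -> has_law (X k) (gaussian_law 0 v) ->
  measurable_fun [set: g_sigma_algebraType (cylinders J) * R] f ->
  (forall p, 0 <= f p)%E ->
  (\int[P]_t f (t, X k t) = \int[P]_t \int[@std_gauss R]_z f (t, Num.sqrt v * z)%R)%E.
Proof.
move=> v0 kJ lX mf f0.
pose TJ := g_sigma_algebraType (cylinders J).
have mid : measurable_fun [set: T] (idfun : T -> TJ).
  by move=> _ A sA; rewrite setTI; exact: sigma_cylinders_measurable sA.
pose idJ : {mfun T >-> TJ} := HB.pack (idfun : T -> TJ) (isMeasurableFun.Build _ _ _ _ _ mid).
pose PJ : probability TJ R := distribution P idJ.
pose h (t : T) : TJ * R := (t, X k t).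
have mh : measurable_fun [set: T] h by exact: measurable_fun_pair.
pose hJ : {mfun T >-> (TJ * R)%type} := HB.pack h (isMeasurableFun.Build _ _ _ _ _ mh).
pose Ph : probability (TJ * R)%type R := distribution P hJ.
pose Pk : probability R R := distribution P (X k).
transitivity (\int[Ph]_p f p)%E.
  exact: (esym (ge0_integral_pushforward mh P measurableT mf (fun x _ => f0 x))).
(* The joint law of the past and of [X k] agrees with the product law on rectangles. *)
transitivity (\int[PJ \x Pk]_p f p)%E.
  apply: eq_measure_integral => A mA _; apply/esym.
  apply: (@product_measure_unique _ _ _ _ _ PJ Pk Ph) => //.
  by move=> A1 A2 mA1 mA2; exact: (@independent_cylinders J k A2 A1).
rewrite fubini_tonelli1//.
have mF := measurable_fun_fubini_tonelli_F (m2 := Pk) f mf f0.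
apply: (etrans (ge0_integral_pushforward mid P measurableT mF (fun x _ => integral_ge0 _ (fun y _ => f0 (x, y))))).
apply: eq_integral => t _ /=; rewrite /fubini_F.
have mft : measurable_fun [set: R] (fun x => f (t, x)).
  by apply: (measurableT_comp2 mf); mfun.
apply: (etrans (ge0_integral_pushforward (measurable_funPT (X k)) P measurableT mft (fun x _ => f0 _))).
exact: (has_law_gaussian_integral v0 lX mft (fun x => f0 _)).
Qed.

End independence.

(** * The Kalman filter and the likelihood ratio *)

Section filter_step.
Context {R : realType}.
Local Notation gam := (@std_gauss R).

(* Rotating the pair (state error, observation noise) makes the innovation and
   the posterior error independent; the law of the observation is then
   reweighted into that of pure noise. *)
Lemma std_gauss_filter_step (a m p q sg r : R) (g : R * R -> \bar R) :
  0 <= a -> 0 <= p -> 0 < sg -> 0 < r -> r ^+ 2 = p ^+ 2 + sg ^+ 2 ->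
  measurable_fun [set: R * R] g -> (forall x, 0 <= g x)%E ->
  (\int[gam]_x \int[gam]_z \int[gam]_z'
     g (a * (m + p * x) + q * z', (m + p * x) + sg * z)%R =
   \int[gam]_z ((sg / r * expR (z ^+ 2 / 2 - (sg * z - m) ^+ 2 / (2 * r ^+ 2)))%:E *
     \int[gam]_x g (a * (m + p ^+ 2 / r ^+ 2 * (sg * z - m)) +
        Num.sqrt ((a * p * sg / r) ^+ 2 + q ^+ 2) * x, sg * z)%R))%E.
Proof.
move=> a0 p0 sg0 r0 r2 mg g0.
have rn0 : r != 0 by rewrite gt_eqF.
pose H (v : R * R) := (\int[gam]_z' g (a * (m + p * v.1) + q * z', (m + p * v.1) + sg * v.2)%R)%E.
have mH : measurable_fun [set: R * R] H.
  apply: (@measurable_std_gauss_integral R _ (R * R)%type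
    (fun w => g (a * (m + p * w.1.1) + q * w.2, (m + p * w.1.1) + sg * w.1.2)%R)) => //.
  by apply: (measurableT_comp2 mg); mfun.
have H0 v : (0 <= H v)%E by apply: integral_ge0.
have csr0 : sg / r != 0 by rewrite mulf_neq0 ?invr_eq0// gt_eqF.
have cs : (sg / r) ^+ 2 + (p / r) ^+ 2 = 1.
  by rewrite !expr_div_n -mulrDl addrC -r2 divff// sqrf_eq0.
apply: (etrans (std_gauss_rotation csr0 cs mH H0)).
(* After the rotation the observation is m + r * v.2, so [v.2] is the normalized innovation; [v.1]
   is the independent posterior error, of scale p * sg / r. Exchanging the integrals then amounts to
   conditioning on the observation. *)
pose G (v : R * R) := H (sg / r * v.1 + p / r * v.2, - (p / r) * v.1 + sg / r * v.2).
have mG : measurable_fun [set: R * R] G by apply: (measurableT_comp2 mH); mfun.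
have G0 v : (0 <= G v)%E by exact: H0.
apply: (etrans (fubini_tonelli (m1 := gam) (m2 := gam) _ mG G0)).
pose rho := Num.sqrt ((a * p * sg / r) ^+ 2 + q ^+ 2).
pose Phi (y : R) := (\int[gam]_x g (a * (m + p ^+ 2 / r ^+ 2 * (y - m)) + rho * x, y)%R)%E.
have mPhi : measurable_fun [set: R] Phi.
  apply: (@measurable_std_gauss_integral R _ R
    (fun w => g (a * (m + p ^+ 2 / r ^+ 2 * (w.1 - m)) + rho * w.2, w.1)%R)) => //.
  by apply: (measurableT_comp2 mg); mfun.
have Phi0 y : (0 <= Phi y)%E by apply: integral_ge0.
transitivity (\int[gam]_y Phi (m + r * y)%R)%E.
  apply: eq_integral => y _.
  pose k (w : R) := g (a * (m + p ^+ 2 / r ^+ 2 * (r * y)) + w, m + r * y).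
  have mk : measurable_fun [set: R] k by apply: (measurableT_comp2 mg); mfun.
  have al0 : 0 <= a * p * sg / r.
    by rewrite divr_ge0 ?(ltW r0)// !mulr_ge0// ltW.
  have E := std_gauss_add q al0 mk (fun w => g0 _).
  rewrite /Phi /= addrAC subrr add0r; apply: (etrans _ E).
  apply: eq_integral => x _; apply: eq_integral => z' _.
  rewrite /k; congr (g (_, _)) => /=.
    by field.
  transitivity (m + ((p ^+ 2 + sg ^+ 2) / r) * y); first by field.
  by rewrite -r2; congr (_ + _ * _); field.
have mPr : measurable_fun [set: R] (fun y => Phi (m + r * y)).
  by apply: (measurableT_comp mPhi); mfun.
(* Slope sg / r and shift - m / r turn the observation m + r * y into the pure noise sg * z. *)
apply: (etrans (std_gauss_affine (- m / r) csr0 mPr (fun y => Phi0 _))).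
apply: eq_integral => z _; rewrite muleC gtr0_norm ?divr_gt0//.
have -> : m + r * (sg / r * z + - m / r) = sg * z by field.
congr (((sg / r * expR _)%:E) * _)%E.
congr (_ - _).
by field.
Qed.
End filter_step.

Section kalman.
Context {R : realType}.
Variables (sigma2 Pi0 a : R).

(** Error variance in predicting the state at position i from the i observations before it; at index
    0 it is the prior variance. *)
Fixpoint err_var (i : nat) : R :=
  match i with
  | 0%N => Pi0
  | k.+1 => a ^+ 2 * err_var k * sigma2 / (err_var k + sigma2) + Pi0 * (1 - a ^+ 2)
  end.
Definition innov_var i := err_var i + sigma2.
Definition gain i := a * err_var i / innov_var i.
(** Equal to a - [gain i]: it is the coefficient left on the old prediction once a * m + gain * (y -
    m) is expanded. *)
Definition pole i := a * sigma2 / innov_var i.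

Fixpoint predictor (y : nat -> R) (i : nat) : R :=
  match i with
  | 0%N => 0
  | k.+1 => pole k * predictor y k + gain k * y k
  end.

(** Density of N(m, innov_var i) relative to N(0, sigma2) at y. *)
Definition lr_factor i (m y : R) :=
  Num.sqrt sigma2 / Num.sqrt (innov_var i) *
  expR (y ^+ 2 / (2 * sigma2) - (y - m) ^+ 2 / (2 * innov_var i)).

Fixpoint lik_ratio (y : nat -> R) (i : nat) : R :=
  match i with
  | 0%N => 1
  | k.+1 => lik_ratio y k * lr_factor k (predictor y k) (y k)
  end.

Hypotheses (s20 : 0 < sigma2) (Pi00 : 0 <= Pi0) (a01 : 0 <= a <= 1).

Lemma state_noise_ge0 : 0 <= Pi0 * (1 - a ^+ 2).
Proof. by case/andP: a01 => a0 a1; rewrite mulr_ge0// subr_ge0 exprn_ile1. Qed.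

Lemma err_var_ge0 i : 0 <= err_var i.
Proof.
elim: i => //= i IH; apply: addr_ge0; last exact: state_noise_ge0.
have s2 := ltW s20; apply: divr_ge0; last exact: addr_ge0.
by apply: mulr_ge0 => //; apply: mulr_ge0 => //; exact: sqr_ge0.
Qed.

Lemma innov_var_gt0 i : 0 < innov_var i.
Proof. by rewrite ltr_wpDl// err_var_ge0. Qed.

Lemma lr_factor_gt0 i m y : 0 < lr_factor i m y.
Proof. by rewrite mulr_gt0 ?expR_gt0// divr_gt0// sqrtr_gt0// innov_var_gt0. Qed.

Lemma lik_ratio_gt0 y i : 0 < lik_ratio y i.
Proof. by elim: i => //= i IH; rewrite mulr_gt0// lr_factor_gt0. Qed.

Lemma eq_predictor y y' i : (forall j, (j < i)%N -> y j = y' j) ->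
  predictor y i = predictor y' i.
Proof.
elim: i => //= i IH yy'; rewrite IH ?yy'// => j ji.
by apply: yy'; exact: ltnW.
Qed.

Lemma eq_lik_ratio y y' i : (forall j, (j < i)%N -> y j = y' j) ->
  lik_ratio y i = lik_ratio y' i.
Proof.
elim: i => //= i IH yy'; rewrite IH ?yy'//; last by move=> j ji; apply: yy'; exact: ltnW.
by rewrite (@eq_predictor _ y')// => j ji; apply: yy'; exact: ltnW.
Qed.

Section measurability.
Context d (S : measurableType d) (y : nat -> S -> R).

Lemma measurable_predictor i : (forall j, (j < i)%N -> measurable_fun [set: S] (y j)) ->
  measurable_fun [set: S] (fun t => predictor (y^~ t) i).
Proof.
elim: i => [|i IH] my /=; first exact: measurable_cst.
have {}IH := IH (fun j ji => my j (ltnW ji)).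
by have := my i (ltnSn i) => myi; mfun.
Qed.

Lemma measurable_lik_ratio i : (forall j, (j < i)%N -> measurable_fun [set: S] (y j)) ->
  measurable_fun [set: S] (fun t => lik_ratio (y^~ t) i).
Proof.
elim: i => [|i IH] my /=; first exact: measurable_cst.
have my' j (ji : (j < i)%N) := my j (ltnW ji).
have {}IH := IH my'; have mp := measurable_predictor my'.
by have := my i (ltnSn i) => myi; rewrite /lr_factor; mfun.
Qed.

Lemma measurable_past n : (forall j, (j < n)%N -> measurable_fun [set: S] (y j)) ->
  measurable_fun [set: S] (past y n).
Proof.
move=> my; apply/measurable_fun_tnthP => i.
apply: (eq_measurable_fun (y i)); last exact: my.
by move=> t _ /=; rewrite tnth_mktuple.
Qed.
End measurability.

Lemma measurable_nth_tuple n j : (j < n)%N ->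
  measurable_fun [set: n.-tuple R] (fun v : n.-tuple R => nth 0 v j).
Proof.
move=> jn; apply: (eq_measurable_fun (fun v : n.-tuple R => tnth v (Ordinal jn))).
  by move=> v _; rewrite (tnth_nth 0).
exact: measurable_tnth.
Qed.

Lemma nth_past (T : Type) (y : nat -> T -> R) n t j : (j < n)%N ->
  nth 0 (past y n t) j = y j t.
Proof. by move=> jn; rewrite (nth_mktuple _ _ (Ordinal jn)). Qed.

Lemma predictor_past (T : Type) (y : nat -> T -> R) n t :
  predictor (nth 0 (past y n t)) n = predictor (y^~ t) n.
Proof. by apply: eq_predictor => j jn; rewrite nth_past. Qed.

Lemma lik_ratio_past (T : Type) (y : nat -> T -> R) n t :
  lik_ratio (nth 0 (past y n t)) n = lik_ratio (y^~ t) n.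
Proof. by apply: eq_lik_ratio => j jn; rewrite nth_past. Qed.

Context {d : measure_display} {T : measurableType d}.
Variable P : probability T R.
Variables (s1 : {RV P >-> R}) (u w : nat -> {RV P >-> R}).
Let Q := Pi0 * (1 - a ^+ 2).
Hypotheses (ls1 : has_law s1 (gaussian_law 0 Pi0))
  (lu : forall i, has_law (u i) (gaussian_law 0 Q))
  (lw : forall i, has_law (w i) (gaussian_law 0 sigma2))
  (ind : mutually_independent (sources s1 u w)).
Let s : nat -> T -> R := gauss_markov a s1 u.
Let y0 : nat -> T -> R := fun i t => w i t.
Let y1 : nat -> T -> R := fun i t => s i t + w i t.
Local Notation gam := (@std_gauss R).

(** The two counts are separate because a filter step freezes its fresh variables one at a time:
    [u n] is independent of [past_space n n.+1], then [w n] of [past_space n n]. *)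
Definition source_ids (n m : nat) : seq (option (nat + nat)) :=
  None :: [seq Some (inl j) | j <- iota 0 n] ++ [seq Some (inr j) | j <- iota 0 m].

Lemma mem_source_inl n m j : (Some (inl j) \in source_ids n m) = (j < n)%N.
Proof.
rewrite inE /= mem_cat mem_map ?mem_iota ?add0n//; last by move=> x y [].
by apply/orP/idP => [[//|/mapP[]//]|->]; left.
Qed.

Lemma mem_source_inr n m j : (Some (inr j) \in source_ids n m) = (j < m)%N.
Proof.
rewrite inE /= mem_cat [X in _ || X]mem_map ?mem_iota ?add0n//; last by move=> x y [].
by apply/orP/idP => [[/mapP[]//|//]|->]; right.
Qed.

(* The sample space, equipped with the sigma-algebra of [s1], the first [n]
   state noises and the first [m] observation noises only. *)
Definition past_space n m := g_sigma_algebraType (cylinders (sources s1 u w) (source_ids n m)).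

Section past_space_measurability.
Variables n m : nat.
Local Notation TJ := (past_space n m).

Lemma measurable_source j : j \in source_ids n m ->
  measurable_fun [set: TJ] (sources s1 u w j : TJ -> R).
Proof.
move=> jJ _ A mA; rewrite setTI; apply: sub_sigma_algebra.
exact: (@cylinder_preimage R d T P _ (sources s1 u w) _ _ _ jJ mA).
Qed.

Lemma measurable_past_noise j : (j < m)%N -> measurable_fun [set: TJ] (w j : TJ -> R).
Proof. by rewrite -(mem_source_inr n m) => /measurable_source. Qed.

Lemma measurable_past_state j : (j <= n)%N -> measurable_fun [set: TJ] (s j : TJ -> R).
Proof.
elim: j => [_|j IH jn] /=; first by apply: (@measurable_source None); rewrite inE.
have ms : measurable_fun [set: TJ] (s j : TJ -> R) by apply: IH; exact: ltnW.
have mu : measurable_fun [set: TJ] (u j : TJ -> R).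
  by apply: (@measurable_source (Some (inl j))); rewrite mem_source_inl.
by rewrite /s /=; mfun.
Qed.

Lemma measurable_past_obs j : (j <= n)%N -> (j < m)%N ->
  measurable_fun [set: TJ] (y1 j : TJ -> R).
Proof.
move=> jn jm; have ms := measurable_past_state jn; have mw := measurable_past_noise jm.
by rewrite /y1; mfun.
Qed.
End past_space_measurability.

(** The test function sees the current state as well as the past, which is what makes the induction
    close: one step of the dynamics turns a test function at n.+1 into one at n. The right-hand side
    involves the noise path only, reweighted, with the state Gaussian around the predictor. Both the
    density of the observations and the conditional laws are read off it. *)
Lemma filter_law n (f : R * n.-tuple R -> \bar R) :
  measurable_fun [set: R * n.-tuple R] f -> (forall x, 0 <= f x)%E ->
  (\int[P]_t f (s n t, past y1 n t) =
   \int[P]_t ((lik_ratio (y0^~ t) n)%:E *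
     \int[gam]_z f (predictor (y0^~ t) n + Num.sqrt (err_var n) * z, past y0 n t)%R))%E.
Proof.
elim: n f => [|n IH] f mf f0.
  have v0 : 0%N.-tuple R := [tuple].
  have mf0 : measurable_fun [set: R] (fun x => f (x, v0)) by apply: (measurableT_comp2 mf); mfun.
  transitivity (\int[P]_t (fun x => f (x, v0)) (s1 t))%E.
    by apply: eq_integral => t _; rewrite [past _ _ _]tuple0 [v0]tuple0.
  rewrite (has_law_gaussian_integral Pi00 ls1 mf0 (fun x => f0 _)).
  transitivity (\int[P]_t (\int[gam]_z f (Num.sqrt Pi0 * z, v0)%R))%E.
    by rewrite probability_integral_cst.
  apply: eq_integral => t _ /=; rewrite mul1e; apply: eq_integral => z _.
  by rewrite add0r [past _ _ _]tuple0 [v0]tuple0.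
have sQ0 := state_noise_ge0; have sig0 := ltW s20.
(* Replace the state noise, then the observation noise, by fresh Gaussians. *)
pose F1 (p : past_space n n.+1 * R) :=
  f (a * s n p.1 + p.2, snoc (past y1 n p.1) (s n p.1 + w n p.1)).
have mF1 : measurable_fun [set: past_space n n.+1 * R] F1.
  have ms := @measurable_past_state n n.+1 n (leqnn n).
  have mw := @measurable_past_noise n n.+1 n (ltnSn n).
  have mp : measurable_fun [set: past_space n n.+1] (past y1 n : past_space n n.+1 -> _).
    apply: measurable_past => j jn.
    by apply: measurable_past_obs; [exact: ltnW|exact: ltnW].
  by apply: (measurableT_comp2 mf); mfun.
have n1 : Some (inl n) \notin source_ids n n.+1 by rewrite mem_source_inl ltnn.
have E1 := integral_independent ind sQ0 n1 (lu n) mF1 (fun p => f0 _).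
transitivity (\int[P]_t F1 (t, u n t))%E.
  by apply: eq_integral => t _; rewrite past_snoc.
apply: (etrans E1) => {E1}.
pose F2 (p : past_space n n * R) := (\int[gam]_z
  f (a * s n p.1 + Num.sqrt Q * z, snoc (past y1 n p.1) (s n p.1 + p.2))%R)%E.
have mF2 : measurable_fun [set: past_space n n * R] F2.
  have ms := @measurable_past_state n n n (leqnn n).
  have mp : measurable_fun [set: past_space n n] (past y1 n : past_space n n -> _).
    by apply: measurable_past => j jn; apply: measurable_past_obs => //; exact: ltnW.
  apply: (@measurable_std_gauss_integral R _ (past_space n n * R)%type
    (fun w => f (a * s n w.1.1 + Num.sqrt Q * w.2, snoc (past y1 n w.1.1) (s n w.1.1 + w.1.2)))) => //.
  by apply: (measurableT_comp2 mf); mfun.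
have F20 p : (0 <= F2 p)%E by apply: integral_ge0.
have n2 : Some (inr n) \notin source_ids n n by rewrite mem_source_inr ltnn.
have E2 := integral_independent ind sig0 n2 (lw n) mF2 F20.
apply: (etrans E2) => {E2}.
(* With both fresh Gaussians integrated out, this is the test function for the induction
   hypothesis. *)
pose f' (v : R * n.-tuple R) := (\int[gam]_z \int[gam]_z'
  f (a * v.1 + Num.sqrt Q * z', snoc v.2 (v.1 + Num.sqrt sigma2 * z))%R)%E.
have mf' : measurable_fun [set: R * n.-tuple R] f'.
  apply: (@measurable_std_gauss_integral R _ (R * n.-tuple R)%type
    (fun w => \int[gam]_z' f (a * w.1.1 + Num.sqrt Q * z', snoc w.1.2 (w.1.1 + Num.sqrt sigma2 * w.2))%R)%E).
    apply: (@measurable_std_gauss_integral R _ ((R * n.-tuple R) * R)%type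
      (fun w => f (a * w.1.1.1 + Num.sqrt Q * w.2, snoc w.1.1.2 (w.1.1.1 + Num.sqrt sigma2 * w.1.2))%R)) => //.
    by apply: (measurableT_comp2 mf); mfun.
  by move=> x; apply: integral_ge0.
have f'0 v : (0 <= f' v)%E by apply: integral_ge0 => z _; apply: integral_ge0.
apply: (etrans (IH f' mf' f'0)) => {IH}.
pose LR (t : T) := lik_ratio (y0^~ t) n.
pose M (t : T) := predictor (y0^~ t) n.
(* The right-hand side at n.+1, as a function of the past and of a fresh noise value; what then
   remains is a single filter step with the past fixed. *)
pose F3 (p : past_space n n * R) := ((LR p.1 * lr_factor n (M p.1) p.2)%:E *
   \int[gam]_z f (pole n * M p.1 + gain n * p.2 +
     Num.sqrt (err_var n.+1) * z, snoc (past y0 n p.1) p.2)%R)%E.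
have mF3 : measurable_fun [set: past_space n n * R] F3.
  have mw j (jn : (j < n)%N) := @measurable_past_noise n n j jn.
  have mp := measurable_past mw.
  have mpr : measurable_fun [set: past_space n n] M := measurable_predictor mw.
  have mlr : measurable_fun [set: past_space n n] LR := measurable_lik_ratio mw.
  apply: emeasurable_funM; first by rewrite /lr_factor; mfun.
  apply: (@measurable_std_gauss_integral R _ (past_space n n * R)%type
    (fun v => f (pole n * M v.1.1 + gain n * v.1.2 +
     Num.sqrt (err_var n.+1) * v.2, snoc (past y0 n v.1.1) v.1.2)%R)) => //.
  by apply: (measurableT_comp2 mf); mfun.
have F30 p : (0 <= F3 p)%E.
  apply: mule_ge0; last by apply: integral_ge0 => x _; exact: f0.
  by rewrite lee_fin ltW// mulr_gt0 ?lik_ratio_gt0 ?lr_factor_gt0.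
have E3 := integral_independent ind sig0 n2 (lw n) mF3 F30.
transitivity (\int[P]_t F3 (t, w n t))%E; last first.
  by apply: eq_integral => t _; rewrite /F3 /= past_snoc.
apply: (etrans _ (esym E3)) => {E3}.
apply: eq_integral => t _.
set m := predictor (y0^~ t) n.
rewrite /F3 /LR /M /= -/m.
pose g (v : R * R) := f (v.1, snoc (past y0 n t) v.2).
have mg : measurable_fun [set: R * R] g by apply: (measurableT_comp2 mf); mfun.
have sg0 : 0 < Num.sqrt sigma2 by rewrite sqrtr_gt0.
have r0 : 0 < Num.sqrt (innov_var n) by rewrite sqrtr_gt0 innov_var_gt0.
have r2 : Num.sqrt (innov_var n) ^+ 2 = Num.sqrt (err_var n) ^+ 2 + Num.sqrt sigma2 ^+ 2.
  by rewrite !sqr_sqrtr ?err_var_ge0// ltW// innov_var_gt0.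
have a0 : 0 <= a by case/andP: a01.
have E := @std_gauss_filter_step R a m _ (Num.sqrt Q) _ _ g a0 (sqrtr_ge0 (err_var n)) sg0 r0 r2 mg (fun v => f0 _).
pose G (z x : R) := g (a * (m + Num.sqrt (err_var n) ^+ 2 / Num.sqrt (innov_var n) ^+ 2 *
    (Num.sqrt sigma2 * z - m)) + Num.sqrt
    ((a * Num.sqrt (err_var n) * Num.sqrt sigma2 / Num.sqrt (innov_var n)) ^+ 2 +
     Num.sqrt Q ^+ 2) * x, Num.sqrt sigma2 * z).
pose h (z : R) := ((Num.sqrt sigma2 / Num.sqrt (innov_var n) *
    expR (z ^+ 2 / 2 - (Num.sqrt sigma2 * z - m) ^+ 2 /
      (2 * Num.sqrt (innov_var n) ^+ 2)))%:E * \int[gam]_x G z x)%E.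
have mh : measurable_fun [set: R] h.
  apply: emeasurable_funM; first by mfun.
  apply: (@measurable_std_gauss_integral R _ R (fun v => G v.1 v.2)) => //.
    by apply: (measurableT_comp2 mg); mfun.
  by move=> v; exact: f0.
have h0 z : (0 <= h z)%E.
  apply: mule_ge0; last by apply: integral_ge0 => x _; exact: f0.
  by rewrite lee_fin mulr_ge0 ?expR_ge0// divr_ge0// ltW.
have L0 : (0 <= (lik_ratio (y0^~ t) n)%:E)%E by rewrite lee_fin ltW// lik_ratio_gt0.
have E4 : (\int[gam]_z ((lik_ratio (y0^~ t) n)%:E * h z) =
    (lik_ratio (y0^~ t) n)%:E * \int[gam]_z h z)%E.
  exact: (ge0_integralZl _ measurableT mh (fun z _ => h0 z) L0).
apply: (etrans (congr1 (fun x => (lik_ratio (y0^~ t) n)%:E * x)%E E)).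
apply: (etrans (esym E4)).
have R0 := innov_var_gt0 n; have R0' := R0; rewrite /innov_var in R0'.
have Er : Num.sqrt (innov_var n) ^+ 2 = innov_var n by rewrite sqr_sqrtr// ltW.
have Ep : Num.sqrt (err_var n) ^+ 2 = err_var n by rewrite sqr_sqrtr// err_var_ge0.
have Es : Num.sqrt sigma2 ^+ 2 = sigma2 by rewrite sqr_sqrtr.
have Eq : Num.sqrt Q ^+ 2 = Q by rewrite sqr_sqrtr.
(* The variance produced by the filter step is the Riccati update. *)
have Ev : (a * Num.sqrt (err_var n) * Num.sqrt sigma2 / Num.sqrt (innov_var n)) ^+ 2 +
    Num.sqrt Q ^+ 2 = err_var n.+1.
  by rewrite expr_div_n !exprMn Er Ep Es Eq.
apply: eq_integral => z _.
have H1 : Num.sqrt sigma2 / Num.sqrt (innov_var n) *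
    expR (z ^+ 2 / 2 - (Num.sqrt sigma2 * z - m) ^+ 2 / (2 * Num.sqrt (innov_var n) ^+ 2)) =
    lr_factor n m (Num.sqrt sigma2 * z).
  have E5 : (Num.sqrt sigma2 * z) ^+ 2 / (2 * sigma2) = z ^+ 2 / 2.
    by rewrite exprMn Es; field; rewrite gt_eqF.
  by rewrite /lr_factor Er E5.
rewrite /h /G Ev H1 muleA -EFinM; congr (_ * _)%E.
apply: eq_integral => x _; rewrite /g [(_, _).1]/= [(_, _).2]/=.
have -> : a * (m + Num.sqrt (err_var n) ^+ 2 / Num.sqrt (innov_var n) ^+ 2 *
   (Num.sqrt sigma2 * z - m)) = pole n * m + gain n * (Num.sqrt sigma2 * z).
  by rewrite Er Ep /pole /gain /innov_var; field; rewrite gt_eqF.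
by [].
Qed.

End kalman.

(** * Regression and prediction errors *)

Section conditional_expectation.
Context {R : realType} {d : measure_display} {T : measurableType d}.
Variable P : probability T R.
Local Notation gam := (@std_gauss R).

Lemma ge0_integral_add_mul (h : T -> R) (b c : R) : 0 <= b -> 0 <= c ->
  measurable_fun [set: T] h -> (forall t, 0 <= h t) ->
  (\int[P]_t (b + c * h t)%:E = b%:E + c%:E * \int[P]_t (h t)%:E)%E.
Proof.
move=> b0 c0 mh h0.
have mEh : measurable_fun [set: T] (EFin \o h) by exact/measurable_EFinP.
have mch : measurable_fun [set: T] (fun t => c%:E * (h t)%:E)%E.
  by apply: emeasurable_funM.
have ch0 t : [set: T] t -> (0 <= c%:E * (h t)%:E)%E.
  by move=> _; rewrite mule_ge0 ?lee_fin.
have b0' t : [set: T] t -> (0 <= cst b%:E t)%E by rewrite lee_fin.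
have E := ge0_integralD P measurableT b0' (measurable_cst _) ch0 mch.
apply: (etrans E); rewrite probability_integral_cst; congr (_ + _)%E.
by apply: ge0_integralZl => // t _; rewrite lee_fin.
Qed.

Lemma integrable_gaussian (X : {RV P >-> R}) (v : R) : 0 <= v ->
  has_law X (gaussian_law 0 v) -> P.-integrable [set: T] (EFin \o X).
Proof.
move=> v0 lX; apply/integrableP; split; first exact/measurable_EFinP.
have mn : measurable_fun [set: R] (fun x : R => `|x|%:E).
  by apply/measurable_EFinP; exact: normr_measurable.
have /= E := has_law_gaussian_integral v0 lX mn (fun x => normr_ge0 x).
apply: (le_lt_trans _ (_ : \int[gam]_z `|Num.sqrt v * z|%:E < +oo)%E); first by rewrite -E.
have /integrableP[_] := integrableZl measurableT (Num.sqrt v) (@integrable_std_gauss_id R).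
by [].
Qed.

(** Pushed forward to the law of Y, the two versions have equal integrals over every measurable set,
    hence agree almost everywhere. *)
Lemma cond_exp_unique n (X : T -> R) (Y : T -> n.-tuple R) (g m : n.-tuple R -> R) :
  measurable_fun [set: T] Y -> is_cond_exp P X Y g -> is_cond_exp P X Y m ->
  P (Y @^-1` [set v | g v != m v]) = 0%E.
Proof.
move=> mY [mg iX ig Eg] [mm _ im Em].
have mYB E : measurable E -> measurable (Y @^-1` E).
  by move=> mE; rewrite -[X in measurable X]setTI; exact: mY.
pose YY : {mfun T >-> n.-tuple R} := HB.pack Y (isMeasurableFun.Build _ _ _ _ Y mY).
pose PY : probability (n.-tuple R) R := distribution P YY.
have mEg : measurable_fun [set: n.-tuple R] (EFin \o g) by exact/measurable_EFinP.
have mEm : measurable_fun [set: n.-tuple R] (EFin \o m) by exact/measurable_EFinP.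
have PYg : PY.-integrable setT (EFin \o g).
  exact: (integrable_pushforward mY mEg ig measurableT).
have : ae_eq PY setT (EFin \o g) (EFin \o m).
  apply: (integral_ae_eq measurableT PYg mEm) => E _ mE.
  have sub (h : n.-tuple R -> R) : measurable_fun setT h ->
      P.-integrable setT (EFin \o (h \o Y)) ->
      (\int[PY]_(x in E) (EFin \o h) x = \int[P]_(t in Y @^-1` E) (h (Y t))%:E)%E.
    move=> mh ih; apply: (integral_pushforward mY) => //.
    - exact/measurable_EFinP.
    - apply: (integrableS measurableT _ _ ih) => //.
      exact: mYB.
  by rewrite !sub// -Eg// -Em.
move=> [N [mN PN sN]].
have mD : measurable [set v | g v != m v].
  rewrite (_ : [set _ | _] = (g \- m) @^-1` (~` [set 0])).
    rewrite -[X in measurable X]setTI; apply: (measurable_funB mg mm) => //.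
    exact: measurableC.
  by apply/seteqP; split => v /=; rewrite -subr_eq0 => /eqP.
apply/eqP; rewrite eq_le measure_ge0 andbT -PN.
apply: le_measure; rewrite ?inE//.
- exact: mYB.
- exact: mYB.
- move=> t /= /eqP gm; apply: sN => /= h.
  by apply: gm; have /= [] := h I.
Qed.

Section gaussian_regression.
Variables (n : nat) (X : T -> R) (Y : T -> n.-tuple R) (m : n.-tuple R -> R) (c : R).
Hypotheses (mX : measurable_fun [set: T] X) (mY : measurable_fun [set: T] Y)
  (mm : measurable_fun [set: n.-tuple R] m)
  (iX : P.-integrable [set: T] (EFin \o X))
  (im : P.-integrable [set: T] (EFin \o (m \o Y)))
  (XY : forall f : R * n.-tuple R -> \bar R,
    measurable_fun [set: R * n.-tuple R] f -> (forall x, 0 <= f x)%E ->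
    (\int[P]_t f (X t, Y t) = \int[P]_t \int[gam]_z f (m (Y t) + c * z, Y t)%R)%E).

(** [XY] says that (X, Y) has the law of (m(Y) + c z, Y) with z standard and independent of Y. It
    speaks of nonnegative functions, so x * 1_B(y) is split into positive and negative parts; once
    these are recombined, the integral over z leaves m(Y) * 1_B(Y). *)
Lemma gaussian_regression_cond_exp : is_cond_exp P X Y m.
Proof.
split=> // B mB.
have mYB : measurable (Y @^-1` B) by rewrite -[X in measurable X]setTI; exact: mY.
pose phi (p : R * n.-tuple R) := (p.1 * \1_B p.2)%:E.
have mphi : measurable_fun [set: R * n.-tuple R] phi.
  have m1 : measurable_fun [set: n.-tuple R] (\1_B : n.-tuple R -> R) by exact: measurable_indic.
  by apply/measurable_EFinP; mfun.
have mpos : measurable_fun [set: R * n.-tuple R] phi^\+%E by exact: measurable_funepos.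
have mneg : measurable_fun [set: R * n.-tuple R] phi^\-%E by exact: measurable_funeneg.
have iphi : P.-integrable setT (fun t => phi (X t, Y t)).
  apply: (le_integrable measurableT _ _ iX).
    by apply: (measurableT_comp2 mphi).
  move=> t _ /=; rewrite lee_fin normrM ler_piMr// indicE.
  by case: (_ \in _); rewrite ?normr1 ?normr0.
have E (h : T -> R) : (\int[P]_(t in Y @^-1` B) (h t)%:E =
    \int[P]_t (h t * \1_B (Y t))%:E)%E.
  rewrite integral_mkcond; apply: eq_integral => t _; rewrite patchE indicE.
  rewrite (_ : (t \in Y @^-1` B) = (Y t \in B)); last by apply/idP/idP; rewrite !inE.
  by case: (_ \in _); rewrite ?mulr1 ?mulr0.
rewrite !E.
pose Fp t := (\int[gam]_z phi^\+ (m (Y t) + c * z, Y t)%R)%E.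
pose Fn t := (\int[gam]_z phi^\- (m (Y t) + c * z, Y t)%R)%E.
pose M t := m (Y t).
have mM : measurable_fun setT M by exact: (measurableT_comp mm mY).
have mFp : measurable_fun [set: T] Fp.
  apply: (@measurable_std_gauss_integral R _ T (fun w => phi^\+%E (M w.1 + c * w.2, Y w.1))) => //.
  by apply: (measurableT_comp2 mpos); mfun.
have mFn : measurable_fun [set: T] Fn.
  apply: (@measurable_std_gauss_integral R _ T (fun w => phi^\-%E (M w.1 + c * w.2, Y w.1))) => //.
  by apply: (measurableT_comp2 mneg); mfun.
have Ep : (\int[P]_t phi^\+ (X t, Y t) = \int[P]_t Fp t)%E by apply: XY.
have En : (\int[P]_t phi^\- (X t, Y t) = \int[P]_t Fn t)%E by apply: XY.
have ip : P.-integrable setT Fp.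
  apply/integrableP; split=> //.
  under eq_integral do rewrite gee0_abs ?integral_ge0//.
  rewrite -Ep; have /integrableP[_] := integrable_funepos measurableT iphi.
  congr (_ < _)%E; apply: eq_integral => t _.
  by rewrite gee0_abs ?funepos_ge0// !funeposE.
have in_ : P.-integrable setT Fn.
  apply/integrableP; split=> //.
  under eq_integral do rewrite gee0_abs ?integral_ge0//.
  rewrite -En; have /integrableP[_] := integrable_funeneg measurableT iphi.
  congr (_ < _)%E; apply: eq_integral => t _.
  by rewrite gee0_abs ?funeneg_ge0// !funenegE.
transitivity (\int[P]_t (Fp t - Fn t))%E.
  rewrite (integralB measurableT ip in_) -Ep -En.
  rewrite [LHS](_ : _ = \int[P]_t phi (X t, Y t))%E// integralE.
  by congr (_ - _)%E; apply: eq_integral => t _; rewrite ?funeposE ?funenegE.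
apply: eq_integral => t _.
have := std_gauss_quadratic (m (Y t) * \1_B (Y t)) (c * \1_B (Y t)) 0.
rewrite addr0 => <-.
transitivity (\int[gam]_z phi (m (Y t) + c * z, Y t)%R)%E.
  rewrite [RHS]integralE.
  by congr (_ - _)%E; apply: eq_integral => z _; rewrite ?funeposE ?funenegE.
by apply: eq_integral => z _; rewrite /phi /=; congr EFin; ring.
Qed.

Lemma gaussian_regression_mse : (\int[P]_t ((X t - m (Y t)) ^+ 2)%:E = (c ^+ 2)%:E)%E.
Proof.
pose f (p : R * n.-tuple R) := ((p.1 - m p.2) ^+ 2)%:E.
have mf : measurable_fun [set: R * n.-tuple R] f by rewrite /f; mfun.
rewrite (XY mf); last by move=> p; rewrite lee_fin sqr_ge0.
rewrite -[RHS](probability_integral_cst P); apply: eq_integral => t _.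
have := std_gauss_sqr_affine 0 c; rewrite expr0n/= add0r => <-.
by apply: eq_integral => z _; rewrite /f /=; congr EFin; ring.
Qed.
End gaussian_regression.

End conditional_expectation.

Section kalman_prediction.
Context {R : realType} {d : measure_display} {T : measurableType d}.
Variable P : probability T R.
Variables (sigma2 Pi0 a : R).
Hypotheses (s20 : 0 < sigma2) (Pi00 : 0 <= Pi0) (a01 : 0 <= a <= 1).
Variables (s1 : {RV P >-> R}) (u w : nat -> {RV P >-> R}).
Let Q := Pi0 * (1 - a ^+ 2).
Hypotheses (ls1 : has_law s1 (gaussian_law 0 Pi0))
  (lu : forall i, has_law (u i) (gaussian_law 0 Q))
  (lw : forall i, has_law (w i) (gaussian_law 0 sigma2))
  (ind : mutually_independent (sources s1 u w)).
Let s : nat -> T -> R := gauss_markov a s1 u.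
Let y0 : nat -> T -> R := fun i t => w i t.
Let y1 : nat -> T -> R := fun i t => s i t + w i t.
Local Notation gam := (@std_gauss R).
Local Notation pred := (predictor sigma2 Pi0 a).
Local Notation lr := (lik_ratio sigma2 Pi0 a).
Local Notation err := (err_var sigma2 Pi0 a).
Local Notation inn := (innov_var sigma2 Pi0 a).

Definition tuple_predictor n (v : n.-tuple R) : R := pred (nth 0 v) n.

Lemma measurable_tuple_predictor n :
  measurable_fun [set: n.-tuple R] (@tuple_predictor n).
Proof.
exact: (measurable_predictor sigma2 Pi0 a
  (y := fun j (v : n.-tuple R) => nth 0 v j) (fun j jn => measurable_nth_tuple jn)).
Qed.

Lemma tuple_predictor_linear n : exists c : 'I_n -> R,
  forall v : n.-tuple R, tuple_predictor v = \sum_(j < n) c j * tnth v j.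
Proof.
suff [c cE] : exists c : nat -> R, forall y : nat -> R,
    pred y n = \sum_(j < n) c j * y j.
  exists (fun j => c j) => v; rewrite /tuple_predictor cE.
  by apply: eq_bigr => j _; rewrite (tnth_nth 0).
elim: n => [|n [c cE]]; first by exists (fun=> 0) => y; rewrite big_ord0.
exists (fun j => if j == n then gain sigma2 Pi0 a n else pole sigma2 Pi0 a n * c j) => y.
rewrite big_ord_recr /= eqxx cE mulr_sumr; congr (_ + _).
by apply: eq_bigr => j _; rewrite ltn_eqF// mulrA.
Qed.

Lemma measurable_state n : measurable_fun [set: T] (s n).
Proof.
elim: n => [|n IH] /=; first exact: (measurable_funPT s1).
have mu := measurable_funPT (u n).
by rewrite /s /=; mfun.
Qed.

Lemma measurable_obs n : measurable_fun [set: T] (y1 n).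
Proof.
have ms := @measurable_state n; have mw := measurable_funPT (w n).
by rewrite /y1; mfun.
Qed.

Lemma measurable_past1 n : measurable_fun [set: T] (past y1 n).
Proof. by apply: measurable_past => j _; exact: measurable_obs. Qed.

Lemma measurable_past0 n : measurable_fun [set: T] (past y0 n).
Proof. by apply: measurable_past => j _; exact: (measurable_funPT (w j)). Qed.

Lemma integrable_state n : P.-integrable [set: T] (EFin \o s n).
Proof.
elim: n => [|n IH]; first exact: (integrable_gaussian Pi00 ls1).
have iu := integrable_gaussian (state_noise_ge0 Pi00 a01) (lu n).
exact: (integrableD measurableT (integrableZl measurableT a IH) iu).
Qed.

Lemma integrable_obs n : P.-integrable [set: T] (EFin \o y1 n).
Proof.
exact: (integrableD measurableT (integrable_state n) (integrable_gaussian (ltW s20) (lw n))).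
Qed.

Lemma integrable_predictor n :
  P.-integrable [set: T] (EFin \o (@tuple_predictor n \o past y1 n)).
Proof.
apply: (eq_integrable measurableT (EFin \o (fun t => pred (y1^~ t) n))).
  by move=> t _ /=; rewrite /tuple_predictor predictor_past.
elim: n => [|n IH]; first exact: (@finite_measure_integrable_cst _ _ _ P _ 0 measurableT).
exact: (integrableD measurableT (integrableZl measurableT (pole sigma2 Pi0 a n) IH)
  (integrableZl measurableT (gain sigma2 Pi0 a n) (integrable_obs n))).
Qed.

Lemma obs_density n (h : n.-tuple R -> \bar R) :
  measurable_fun [set: n.-tuple R] h -> (forall v, 0 <= h v)%E ->
  (\int[P]_t h (past y1 n t) = \int[P]_t ((lr (y0^~ t) n)%:E * h (past y0 n t)))%E.
Proof.
move=> mh h0.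
have mf : measurable_fun [set: R * n.-tuple R] (h \o snd).
  exact: (measurableT_comp mh measurable_snd).
apply: (etrans (filter_law s20 Pi00 a01 ls1 lu lw ind mf (fun v => h0 _))).
by apply: eq_integral => t _ /=; rewrite probability_integral_cst.
Qed.

(** [filter_law] produces an integral over the reweighted noise; [obs_density], read backwards,
    turns it into one over the actual observations. *)
Lemma state_given_past n (f : R * n.-tuple R -> \bar R) :
  measurable_fun [set: R * n.-tuple R] f -> (forall x, 0 <= f x)%E ->
  (\int[P]_t f (s n t, past y1 n t) = \int[P]_t \int[gam]_z
     f (tuple_predictor (past y1 n t) + Num.sqrt (err n) * z, past y1 n t)%R)%E.
Proof.
move=> mf f0.
pose h (v : n.-tuple R) := (\int[gam]_z f (tuple_predictor v + Num.sqrt (err n) * z, v)%R)%E.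
have mh : measurable_fun [set: n.-tuple R] h.
  have mp := @measurable_tuple_predictor n.
  apply: (@measurable_std_gauss_integral R _ (n.-tuple R)
    (fun w => f (tuple_predictor w.1 + Num.sqrt (err n) * w.2, w.1)%R)) => //.
  by apply: (measurableT_comp2 mf); mfun.
have h0 v : (0 <= h v)%E by apply: integral_ge0.
apply: (etrans (filter_law s20 Pi00 a01 ls1 lu lw ind mf f0)).
apply: (etrans _ (esym (obs_density mh h0))).
by apply: eq_integral => t _; rewrite /h /tuple_predictor predictor_past.
Qed.

(** The fresh observation noise adds to the state error, so the variances [err n] and sigma2 add up
    to [inn n]. *)
Lemma obs_given_past n (f : R * n.-tuple R -> \bar R) :
  measurable_fun [set: R * n.-tuple R] f -> (forall x, 0 <= f x)%E ->
  (\int[P]_t f (y1 n t, past y1 n t) = \int[P]_t \int[gam]_z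
     f (tuple_predictor (past y1 n t) + Num.sqrt (inn n) * z, past y1 n t)%R)%E.
Proof.
move=> mf f0; have sig0 := ltW s20.
pose F (p : past_space s1 u w n n * R) := f (s n p.1 + p.2, past y1 n p.1).
have mF : measurable_fun [set: past_space s1 u w n n * R] F.
  have ms := @measurable_past_state _ a _ _ P s1 u w n n n (leqnn n).
  have mp : measurable_fun [set: past_space s1 u w n n] (past y1 n : past_space s1 u w n n -> _).
    by apply: measurable_past => j jn; apply: measurable_past_obs => //; exact: ltnW.
  by apply: (measurableT_comp2 mf); mfun.
have n2 : Some (inr n) \notin source_ids n n by rewrite mem_source_inr ltnn.
have E2 := integral_independent ind sig0 n2 (lw n) mF (fun p => f0 _).
apply: (etrans E2) => {E2}.
pose f' (v : R * n.-tuple R) := (\int[gam]_z f (v.1 + Num.sqrt sigma2 * z, v.2)%R)%E.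
have mf' : measurable_fun [set: R * n.-tuple R] f'.
  apply: (@measurable_std_gauss_integral R _ (R * n.-tuple R)%type
    (fun w => f (w.1.1 + Num.sqrt sigma2 * w.2, w.1.2)%R)) => //.
  by apply: (measurableT_comp2 mf); mfun.
have f'0 v : (0 <= f' v)%E by apply: integral_ge0.
apply: (etrans (state_given_past mf' f'0)).
apply: eq_integral => t _.
set m := tuple_predictor _; set Y := past y1 n t.
pose k x := f (m + x, Y).
have mk : measurable_fun [set: R] k by apply: (measurableT_comp2 mf); mfun.
have := std_gauss_add (Num.sqrt sigma2) (sqrtr_ge0 (err n)) mk (fun x => f0 _).
rewrite (sqr_sqrtr (err_var_ge0 s20 Pi00 a01 n)) (sqr_sqrtr sig0) => E.
apply: (etrans _ E); apply: eq_integral => x _; apply: eq_integral => z _.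
by rewrite /k /= addrA.
Qed.

Lemma state_cond_exp n : is_cond_exp P (s n) (past y1 n) (@tuple_predictor n).
Proof.
apply: (gaussian_regression_cond_exp (c := Num.sqrt (err n))).
- exact: measurable_state.
- exact: measurable_past1.
- exact: measurable_tuple_predictor.
- exact: integrable_state.
- exact: integrable_predictor.
- exact: state_given_past.
Qed.

Lemma obs_cond_exp n : is_cond_exp P (y1 n) (past y1 n) (@tuple_predictor n).
Proof.
apply: (gaussian_regression_cond_exp (c := Num.sqrt (inn n))).
- exact: measurable_obs.
- exact: measurable_past1.
- exact: measurable_tuple_predictor.
- exact: integrable_obs.
- exact: integrable_predictor.
- exact: obs_given_past.
Qed.

(** The likelihood ratio is strictly positive, so the null law is absolutely continuous with respect
    to the law under H1. This is needed because a version of the predictor is determined only up to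
    H1-null sets, while its innovations are also evaluated on [y0]. *)
Lemma null_transfer n (A : set (n.-tuple R)) : measurable A ->
  P (past y1 n @^-1` A) = 0%E -> P (past y0 n @^-1` A) = 0%E.
Proof.
move=> mA PA.
have mA0 : measurable (past y0 n @^-1` A).
  by rewrite -[X in measurable X]setTI; exact: measurable_past0.
have mA1 : measurable (past y1 n @^-1` A).
  by rewrite -[X in measurable X]setTI; exact: measurable_past1.
have mi : measurable_fun [set: n.-tuple R] (fun v => (\1_A v : R)%:E).
  by apply/measurable_EFinP; exact: measurable_indic.
have i0 v : (0 <= (\1_A v : R)%:E)%E by rewrite lee_fin.
have E := obs_density mi i0.
have E0 : (\int[P]_t (\1_A (past y1 n t) : R)%:E = 0)%E.
  rewrite -PA -[in RHS](setIT (_ @^-1` _)) -integral_indic//.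
have mlr : measurable_fun [set: T] (fun t => lr (y0^~ t) n).
  by apply: measurable_lik_ratio => j _; exact: (measurable_funPT (w j)).
pose F t := ((lr (y0^~ t) n)%:E * (\1_A (past y0 n t) : R)%:E)%E.
have mF : measurable_fun [set: T] F.
  apply: emeasurable_funM; first exact/measurable_EFinP.
  exact: (measurableT_comp mi (@measurable_past0 n)).
have : (\int[P]_t `|F t| = 0)%E.
  rewrite -[RHS]E0 E; apply: eq_integral => t _; rewrite gee0_abs//.
  by rewrite mule_ge0// lee_fin ltW// (lik_ratio_gt0 s20 Pi00 a01).
move/(ae_eq_integral_abs P measurableT mF) => [N [mN PN sN]].
apply/eqP; rewrite eq_le measure_ge0 andbT -PN.
apply: le_measure; rewrite ?inE// => t At; apply: sN => /= /(_ I) /eqP.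
rewrite /F indicE mem_set// mule1 eqe gt_eqF//.
exact: (lik_ratio_gt0 s20 Pi00 a01).
Qed.

Lemma version_ae n (X : T -> R) (g : n.-tuple R -> R) :
  is_cond_exp P X (past y1 n) g -> is_cond_exp P X (past y1 n) (@tuple_predictor n) ->
  P (past y1 n @^-1` [set v | g v != tuple_predictor v]) = 0%E /\
  P (past y0 n @^-1` [set v | g v != tuple_predictor v]) = 0%E.
Proof.
move=> gX mX; have H := cond_exp_unique (@measurable_past1 n) gX mX; split=> //.
apply: null_transfer => //.
rewrite (_ : [set v | _] = (g \- @tuple_predictor n) @^-1` (~` [set 0])).
  rewrite -[X in measurable X]setTI; case: gX => mg _ _ _.
  apply: (measurable_funB mg (@measurable_tuple_predictor n)) => //.
  exact: measurableC.
by apply/seteqP; split => v /=; rewrite -subr_eq0 => /eqP.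
Qed.

Lemma eq_mse n (X : T -> R) (Y : T -> n.-tuple R) (g m : n.-tuple R -> R) :
  measurable_fun [set: T] X -> measurable_fun [set: T] Y ->
  measurable_fun [set: n.-tuple R] g -> measurable_fun [set: n.-tuple R] m ->
  P (Y @^-1` [set v | g v != m v]) = 0%E ->
  (\int[P]_t ((X t - g (Y t)) ^+ 2)%:E = \int[P]_t ((X t - m (Y t)) ^+ 2)%:E)%E.
Proof.
move=> mX mY mg mm P0.
have mE (h : n.-tuple R -> R) : measurable_fun setT h ->
    measurable_fun [set: T] (fun t => ((X t - h (Y t)) ^+ 2)%:E).
  by move=> mh; mfun.
apply: ge0_ae_eq_integral => //; [exact: mE|exact: mE|..].
- by move=> t _; rewrite lee_fin sqr_ge0.
- by move=> t _; rewrite lee_fin sqr_ge0.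
exists (Y @^-1` [set v | g v != m v]); split=> //.
  rewrite -[X in measurable X]setTI; apply: mY => //.
  rewrite (_ : [set v | _] = (g \- m) @^-1` (~` [set 0])).
    rewrite -[X in measurable X]setTI.
    by apply: (measurable_funB mg mm) => //; exact: measurableC.
  by apply/seteqP; split => v /=; rewrite -subr_eq0 => /eqP.
by move=> t /= H; apply/eqP => E; apply: H => _; rewrite E.
Qed.

Lemma state_mse n (g : n.-tuple R -> R) : is_cond_exp P (s n) (past y1 n) g ->
  ('E_P[fun t => ((s n t - g (past y1 n t)) ^+ 2)%R] = (err n)%:E)%E.
Proof.
move=> gs; have [P1 _] := version_ae gs (state_cond_exp n).
rewrite unlock (eq_mse (@measurable_state n) (@measurable_past1 n) _ (@measurable_tuple_predictor n) P1).
  rewrite (gaussian_regression_mse (c := Num.sqrt (err n)) (@measurable_tuple_predictor n) (@state_given_past n)).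
  by rewrite (sqr_sqrtr (err_var_ge0 s20 Pi00 a01 n)).
by case: gs.
Qed.

Lemma obs_mse n (g : n.-tuple R -> R) : is_cond_exp P (y1 n) (past y1 n) g ->
  ('E_P[fun t => ((y1 n t - g (past y1 n t)) ^+ 2)%R] = (inn n)%:E)%E.
Proof.
move=> gs; have [P1 _] := version_ae gs (obs_cond_exp n).
rewrite unlock (eq_mse (@measurable_obs n) (@measurable_past1 n) _ (@measurable_tuple_predictor n) P1).
  rewrite (gaussian_regression_mse (c := Num.sqrt (inn n)) (@measurable_tuple_predictor n) (@obs_given_past n)).
  by rewrite (sqr_sqrtr (ltW (innov_var_gt0 s20 Pi00 a01 n))).
by case: gs.
Qed.

(** Under H0 the predictor is a linear filter driven by white noise; this is its second moment. The
    cross term is absent because [w k] is independent of the prediction at k. *)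
Fixpoint null_pred_var (i : nat) : R :=
  match i with
  | 0%N => 0
  | k.+1 => pole sigma2 Pi0 a k ^+ 2 * null_pred_var k + gain sigma2 Pi0 a k ^+ 2 * sigma2
  end.

Lemma null_pred_var_ge0 i : 0 <= null_pred_var i.
Proof.
elim: i => //= i IH; apply: addr_ge0; apply: mulr_ge0 => //; try exact: sqr_ge0.
exact: ltW.
Qed.

Lemma integral_next_noise n (F : past_space s1 u w n n * R -> \bar R) :
  measurable_fun [set: past_space s1 u w n n * R] F ->
  (forall p, 0 <= F p)%E ->
  (\int[P]_t F (t, w n t) = \int[P]_t \int[gam]_z F (t, Num.sqrt sigma2 * z)%R)%E.
Proof.
move=> mF F0; have n2 : Some (inr n) \notin source_ids n n by rewrite mem_source_inr ltnn.
exact: (integral_independent ind (ltW s20) n2 (lw n) mF F0).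
Qed.

Lemma measurable_past_predictor n :
  measurable_fun [set: past_space s1 u w n n]
    ((fun t => pred (y0^~ t) n) : past_space s1 u w n n -> R).
Proof.
apply: (measurable_predictor sigma2 Pi0 a (S := past_space s1 u w n n) (y := y0)) => j jn.
exact: measurable_past_noise.
Qed.

Lemma null_second_moment n :
  (\int[P]_t ((pred (y0^~ t) n) ^+ 2)%:E = (null_pred_var n)%:E)%E.
Proof.
elim: n => [|n IH] /=; first by rewrite expr0n/= probability_integral_cst.
pose M (t : T) := pred (y0^~ t) n.
pose F (p : past_space s1 u w n n * R) := ((pole sigma2 Pi0 a n * M p.1 + gain sigma2 Pi0 a n * p.2) ^+ 2)%:E.
have mM : measurable_fun [set: past_space s1 u w n n] (M : past_space s1 u w n n -> R).
  exact: measurable_past_predictor.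
have mF : measurable_fun [set: past_space s1 u w n n * R] F.
  by rewrite /F; mfun.
have F0 p : (0 <= F p)%E by rewrite lee_fin sqr_ge0.
apply: (etrans (integral_next_noise mF F0)).
transitivity (\int[P]_t (gain sigma2 Pi0 a n ^+ 2 * sigma2 + pole sigma2 Pi0 a n ^+ 2 * M t ^+ 2)%:E)%E.
  apply: eq_integral => t _.
  have := std_gauss_sqr_affine (pole sigma2 Pi0 a n * M t) (gain sigma2 Pi0 a n * Num.sqrt sigma2).
  rewrite !exprMn (sqr_sqrtr (ltW s20)) addrC => <-; apply: eq_integral => z _.
  by rewrite /F /= mulrA.
have mM2 : measurable_fun [set: T] (fun t => M t ^+ 2).
  apply: measurable_funX; apply: measurable_predictor => j _.
  exact: (measurable_funPT (w j)).
rewrite (ge0_integral_add_mul _ _ _ mM2) ?sqr_ge0//; last 2 first.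
- by rewrite mulr_ge0 ?sqr_ge0// ltW.
- by move=> t; exact: sqr_ge0.
by rewrite [X in (_ * X)%E]IH -EFinM -EFinD addrC.
Qed.

(** The prediction at n uses earlier noises only, so under H0 it is uncorrelated with [w n] and the
    variances add. *)
Lemma null_mse n (g : n.-tuple R -> R) : is_cond_exp P (y1 n) (past y1 n) g ->
  ('E_P[fun t => ((y0 n t - g (past y0 n t)) ^+ 2)%R] =
   (sigma2 + null_pred_var n)%:E)%E.
Proof.
move=> gs; have [_ P0] := version_ae gs (obs_cond_exp n).
rewrite unlock (eq_mse (measurable_funPT (w n)) (@measurable_past0 n) _ (@measurable_tuple_predictor n) P0); last by case: gs.
pose M (t : T) := pred (y0^~ t) n.
pose F (p : past_space s1 u w n n * R) := ((p.2 - M p.1) ^+ 2)%:E.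
have mM : measurable_fun [set: past_space s1 u w n n] (M : past_space s1 u w n n -> R).
  exact: measurable_past_predictor.
have mF : measurable_fun [set: past_space s1 u w n n * R] F.
  by rewrite /F; mfun.
have F0 p : (0 <= F p)%E by rewrite lee_fin sqr_ge0.
transitivity (\int[P]_t F (t, w n t))%E.
  by apply: eq_integral => t _; rewrite /tuple_predictor predictor_past.
apply: (etrans (integral_next_noise mF F0)).
transitivity (\int[P]_t (sigma2 + 1 * M t ^+ 2)%:E)%E.
  apply: eq_integral => t _.
  have := std_gauss_sqr_affine (- M t) (Num.sqrt sigma2).
  rewrite sqrrN (sqr_sqrtr (ltW s20)) addrC mul1r => <-.
  by apply: eq_integral => z _; rewrite /F /= addrC.
have mM2 : measurable_fun [set: T] (fun t => M t ^+ 2).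
  apply: measurable_funX; apply: measurable_predictor => j _.
  exact: (measurable_funPT (w j)).
rewrite (ge0_integral_add_mul _ _ _ mM2) ?(ltW s20)//; last first.
  by move=> t; exact: sqr_ge0.
by rewrite [X in (_ * X)%E]null_second_moment mul1e -EFinD.
Qed.

End kalman_prediction.

Lemma cvg_eq_lim (R : realType) (f : nat -> R) (l l' : R) : l = l' ->
  f n @[n --> \oo] --> l -> f n @[n --> \oo] --> l'.
Proof. by move=> ->. Qed.

(** * Steady state of the Riccati recursion *)

Section contraction.
Context {R : realType}.
Implicit Types u g x al be : nat -> R.

Lemma contraction_cvg0 u g (rho : R) : 0 <= rho < 1 -> (forall n, 0 <= u n) ->
  (forall n, u n.+1 <= rho * u n + g n) -> g n @[n --> \oo] --> 0 ->
  u n @[n --> \oo] --> 0.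
Proof.
move=> /andP[r0 r1] u0 ug g0; apply/cvgrPdist_le => e e0.
have r1' : 0 < 1 - rho by lra.
(* Perturbations of this size accumulate along the geometric series to at most e / 2. *)
have he : 0 < e / 2 * (1 - rho) by rewrite mulr_gt0// divr_gt0.
have /cvgrPdist_le/(_ _ he)[N _ gN] := g0.
have step k : u (N + k)%N <= e / 2 + rho ^+ k * u N.
  elim: k => [|k IH]; first by rewrite addn0 expr0 mul1r lerDr ltW// divr_gt0.
  rewrite addnS (le_trans (ug _))//.
  have := gN (N + k)%N (leq_addr _ _); rewrite sub0r normrN => /ler_normlW gk.
  have := ler_wpM2l r0 IH; rewrite exprS mulrDr mulrA => h.
  lra.
have e2 : 0 < e / 2 by rewrite divr_gt0.
have cr : (fun k => rho ^+ k * u N) k @[k --> \oo] --> 0.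
  rewrite -(mul0r (u N)); apply: cvgM; last exact: cvg_cst.
  by apply: cvg_expr; rewrite ger0_norm.
have /cvgrPdist_le/(_ _ e2)[M _ gM] := cr.
exists (N + M)%N => // n /= NMn.
have Nn : (N <= n)%N by rewrite (leq_trans _ NMn)// leq_addr.
have := step (n - N)%N; rewrite subnKC//.
have /gM /= : (M <= n - N)%N by rewrite leq_subRL.
rewrite !sub0r !normrN => /ler_normlW h1 h2.
by rewrite ger0_norm//; lra.
Qed.

(** The distance to the fixed point l = a l + b contracts by rho, up to the perturbation (al n - a)
    l + (be n - b), which tends to 0. *)
Lemma affine_recursion_cvg x al be (rho a b : R) : 0 <= rho < 1 ->
  (forall n, 0 <= al n <= rho) -> (forall n, x n.+1 = al n * x n + be n) ->
  al n @[n --> \oo] --> a -> be n @[n --> \oo] --> b ->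
  x n @[n --> \oo] --> b / (1 - a).
Proof.
move=> r01 al01 xE ca cb; have /andP[r0 r1] := r01.
have a1 : a <= rho by apply: (cvgr_to_le ca); apply: nearW => n; case/andP: (al01 n).
set l := b / (1 - a).
have lE : l = a * l + b by rewrite /l; field; lra.
pose u n := `|x n - l|.
suff : u n @[n --> \oo] --> 0.
  by move=> /norm_cvg0 h; apply/subr_cvg0.
pose g n := `|(al n - a) * l + (be n - b)|.
apply: (@contraction_cvg0 u g rho r01) => [n|n|].
- exact: normr_ge0.
- rewrite /u /g xE {1}lE.
  have -> : al n * x n + be n - (a * l + b) =
    al n * (x n - l) + ((al n - a) * l + (be n - b)) by ring.
  rewrite (le_trans (ler_normD _ _))// lerD2r normrM ler_wpM2r//.
  by have /andP[? ?] := al01 n; rewrite ger0_norm.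
- rewrite /g -(normr0 R); apply: cvg_norm.
  have -> : (0 : R) = (a - a) * l + (b - b) by rewrite !subrr mul0r add0r.
  by apply: cvgD; [apply: cvgM; [apply: cvgB => //; exact: cvg_cst|exact: cvg_cst]|
    apply: cvgB => //; exact: cvg_cst].
Qed.
End contraction.

Section steady_state.
Context {R : realType}.
Variables (sigma2 Pi0 a : R).
Hypotheses (s20 : 0 < sigma2) (Pi00 : 0 <= Pi0) (a01 : 0 <= a <= 1).
Let Q := Pi0 * (1 - a ^+ 2).
Local Notation err := (err_var sigma2 Pi0 a).
Local Notation inn := (innov_var sigma2 Pi0 a).
Local Notation gn := (gain sigma2 Pi0 a).
Local Notation pl := (pole sigma2 Pi0 a).
Local Notation nv := (null_pred_var sigma2 Pi0 a).

(** The nonnegative root of [steady_errE], which is the fixed-point equation of the Riccati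
    recursion cleared of its denominator. *)
Definition steady_err : R := 2^-1 * Num.sqrt ((sigma2 * (1 - a ^+ 2) - Q) ^+ 2
  + 4 * sigma2 * Q) - 2^-1 * sigma2 * (1 - a ^+ 2) + Q / 2.
Local Notation Pe := steady_err.
Definition steady_null_var : R := sigma2 *
  (1 + (if a == 1 then 0 else a ^+ 2 * Pe ^+ 2 /
     (Pe ^+ 2 + 2 * sigma2 * Pe + (1 - a ^+ 2) * sigma2 ^+ 2))).

Let Q0 : 0 <= Q. Proof. exact: state_noise_ge0. Qed.

Lemma steady_err_ge0 : 0 <= Pe.
Proof.
rewrite /steady_err; set b := sigma2 * (1 - a ^+ 2) - Q.
have : `|b| <= Num.sqrt (b ^+ 2 + 4 * sigma2 * Q).
  rewrite -sqrtr_sqr ler_wsqrtr// lerDl; apply: mulr_ge0 => //.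
  by apply: mulr_ge0 => //; exact: ltW.
move=> /ler_normlW; set D := Num.sqrt _; rewrite /b; lra.
Qed.

Lemma steady_errE : Pe ^+ 2 + Pe * (sigma2 * (1 - a ^+ 2) - Q) = Q * sigma2.
Proof.
rewrite /steady_err; set b := sigma2 * (1 - a ^+ 2) - Q.
have D0 : 0 <= b ^+ 2 + 4 * sigma2 * Q.
  apply: addr_ge0; first exact: sqr_ge0.
  by apply: mulr_ge0 => //; apply: mulr_ge0 => //; exact: ltW.
have := sqr_sqrtr D0; set D := Num.sqrt _ => DE.
have -> : 2^-1 * D - 2^-1 * sigma2 * (1 - a ^+ 2) + Q / 2 = (D - b) / 2.
  by rewrite /b; field.
have -> : ((D - b) / 2) ^+ 2 + (D - b) / 2 * b = (D ^+ 2 - b ^+ 2) / 4 by field.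
by rewrite DE; field.
Qed.

Lemma steady_inn_gt0 : 0 < Pe + sigma2.
Proof. by rewrite ltr_wpDl// steady_err_ge0. Qed.

Lemma riccati_fixpoint : Pe = a ^+ 2 * Pe * sigma2 / (Pe + sigma2) + Q.
Proof.
have R0 := steady_inn_gt0.
transitivity (Pe - (Pe ^+ 2 + Pe * (sigma2 * (1 - a ^+ 2) - Q) - Q * sigma2) / (Pe + sigma2)).
  by rewrite steady_errE subrr mul0r subr0.
by field; rewrite gt_eqF.
Qed.

(** The Riccati map sends a difference e - p to a^2 times the difference times sigma2 / (e + sigma2)
    and sigma2 / (p + sigma2), both at most 1: a contraction of ratio a^2. *)
Lemma err_var_cvg_stable : a < 1 -> err n @[n --> \oo] --> Pe.
Proof.
move=> a1; have a0 : 0 <= a by case/andP: a01.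
suff : `|err n - Pe| @[n --> \oo] --> 0.
  by move=> /norm_cvg0 h; apply/subr_cvg0.
apply: (@contraction_cvg0 _ _ (fun=> 0) (a ^+ 2)) => [|n|n|].
- by rewrite sqr_ge0/= expr_lt1.
- exact: normr_ge0.
- rewrite addr0 /= {1}riccati_fixpoint.
  have e0 := err_var_ge0 s20 Pi00 a01 n; have p0 := steady_err_ge0.
  have R1 : 0 < err n + sigma2 by rewrite ltr_wpDl.
  have R2 := steady_inn_gt0.
  have -> : a ^+ 2 * err n * sigma2 / (err n + sigma2) + Q -
      (a ^+ 2 * Pe * sigma2 / (Pe + sigma2) + Q) =
      a ^+ 2 * (sigma2 / (err n + sigma2) * (sigma2 / (Pe + sigma2))) * (err n - Pe).
    by field; rewrite !gt_eqF.
  rewrite normrM ler_wpM2r// ger0_norm; last first.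
    by rewrite mulr_ge0 ?sqr_ge0// mulr_ge0// divr_ge0// ltW.
  rewrite ler_piMr ?sqr_ge0// mulr_ile1 ?divr_ge0 ?(ltW R1) ?(ltW R2) ?(ltW s20)//.
    by rewrite ler_pdivrMr// mul1r lerDr.
  by rewrite ler_pdivrMr// mul1r lerDr.
- exact: cvg_cst.
Qed.

(** With a = 1 the state noise vanishes and the recursion is additive in the inverse: 1 / err n = 1
    / Pi0 + n / sigma2. The form without denominators covers Pi0 = 0 too. *)
Lemma err_var_unit_root n : a = 1 -> err n * (sigma2 + n%:R * Pi0) = Pi0 * sigma2.
Proof.
move=> a1; elim: n => [|n IH] /=; first by rewrite mul0r addr0.
have e0 := err_var_ge0 s20 Pi00 a01 n.
have R1 : 0 < err n + sigma2 by rewrite ltr_wpDl.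
move: IH e0 R1; set e := err n => IH e0 R1.
rewrite a1 expr1n subrr mulr0 addr0 mul1r -natr1.
transitivity (sigma2 * (e * (sigma2 + n%:R * Pi0) + e * Pi0) / (e + sigma2)).
  by field; rewrite gt_eqF.
by rewrite IH; field; rewrite gt_eqF.
Qed.

Lemma steady_err_unit_root : a = 1 -> Pe = 0.
Proof.
move=> a1; rewrite /steady_err /Q a1 expr1n subrr !mulr0 subrr expr0n/= addr0.
by rewrite sqrtr0 mulr0 mul0r subrr addr0.
Qed.

Lemma err_var_cvg : err n @[n --> \oo] --> Pe.
Proof.
have [a1|a1] := ltP a 1; first exact: err_var_cvg_stable.
have {}a1 : a = 1 by apply/eqP; rewrite eq_le a1 andbT; case/andP: a01.
(* The closed form bounds the error variance by sigma2 / n; the shift skips n = 0, where this bound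
   has no meaning. *)
rewrite (steady_err_unit_root a1) -cvg_shiftS.
apply: (@squeeze_cvgr _ _ _ _ (cst 0) (fun n => sigma2 * harmonic n)).
- apply: nearW => n; apply/andP; split; first exact: (err_var_ge0 s20 Pi00 a01 n.+1).
  have := err_var_unit_root n.+1 a1; have e0 := err_var_ge0 s20 Pi00 a01 n.+1.
  change (err n.+1 * (sigma2 + n.+1%:R * Pi0) = Pi0 * sigma2 ->
    err n.+1 <= sigma2 / n.+1%:R).
  move: e0; set e := err n.+1 => e0 E; rewrite ler_pdivlMr//.
  have [p0|p0] := eqVneq Pi0 0.
    move: E; rewrite p0 mulr0 addr0 mul0r => /eqP; rewrite mulf_eq0 (gt_eqF s20) orbF => /eqP ->.
    by rewrite mul0r ltW.
  have pp : 0 < Pi0 by rewrite lt_def p0.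
  rewrite -(ler_pM2r pp).
  have : 0 <= e * sigma2 by rewrite mulr_ge0// ltW.
  lra.
- exact: cvg_cst.
- rewrite -(mulr0 sigma2); apply: cvgM; [exact: cvg_cst|exact: cvg_harmonic].
Qed.

Lemma innov_var_cvg : inn n @[n --> \oo] --> Pe + sigma2.
Proof. by apply: cvgD; [exact: err_var_cvg|exact: cvg_cst]. Qed.

Lemma innov_varV_cvg : (inn n)^-1 @[n --> \oo] --> (Pe + sigma2)^-1.
Proof. by apply: cvgV; [rewrite gt_eqF// steady_inn_gt0|exact: innov_var_cvg]. Qed.

Lemma gain_cvg : gn n @[n --> \oo] --> a * Pe / (Pe + sigma2).
Proof.
apply: cvgM; last exact: innov_varV_cvg.
by apply: cvgM; [exact: cvg_cst|exact: err_var_cvg].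
Qed.

Lemma pole_cvg : pl n @[n --> \oo] --> a * sigma2 / (Pe + sigma2).
Proof. by apply: cvgM; [exact: cvg_cst|exact: innov_varV_cvg]. Qed.

Lemma pole_bound n : 0 <= pl n <= a.
Proof.
have a0 : 0 <= a by case/andP: a01.
have R0 := innov_var_gt0 s20 Pi00 a01 n; have e0 := err_var_ge0 s20 Pi00 a01 n.
rewrite /pole divr_ge0 ?mulr_ge0 ?(ltW s20) ?(ltW R0)//=.
by rewrite ler_pdivrMr// ler_wpM2l// lerDr.
Qed.

Lemma gain_bound n : 0 <= gn n <= a.
Proof.
have a0 : 0 <= a by case/andP: a01.
have R0 := innov_var_gt0 s20 Pi00 a01 n; have e0 := err_var_ge0 s20 Pi00 a01 n.
rewrite /gain divr_ge0 ?mulr_ge0 ?(ltW R0)//=.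
by rewrite ler_pdivrMr// ler_wpM2l// lerDl ltW.
Qed.

Lemma null_pred_var_cvg_stable : a < 1 -> nv n @[n --> \oo] -->
  (a * Pe / (Pe + sigma2)) ^+ 2 * sigma2 / (1 - (a * sigma2 / (Pe + sigma2)) ^+ 2).
Proof.
move=> a1; have a0 : 0 <= a by case/andP: a01.
apply: (@affine_recursion_cvg _ nv (fun n => pl n ^+ 2) (fun n => gn n ^+ 2 * sigma2) (a ^+ 2)) => //.
- by rewrite sqr_ge0/= expr_lt1.
- by move=> n; rewrite sqr_ge0/=; have /andP[? ?] := pole_bound n; rewrite lerXn2r ?nnegrE.
- by rewrite expr2; under eq_fun do rewrite expr2; apply: cvgM; exact: pole_cvg.
- apply: cvgM; last exact: cvg_cst.
  by rewrite expr2; under eq_fun do rewrite expr2; apply: cvgM; exact: gain_cvg.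
Qed.

(** For a = 1 the error variance satisfies the same recursion, err' = pole^2 err + gain^2 sigma2,
    and starts from Pi0 >= 0 instead of 0. *)
Lemma null_pred_var_le_err n : a = 1 -> nv n <= err n.
Proof.
move=> a1; elim: n => [|n IH] //=.
have e0 := err_var_ge0 s20 Pi00 a01 n.
have R1 : 0 < err n + sigma2 by rewrite ltr_wpDl.
rewrite /pole /gain /innov_var; move: IH e0 R1; set e := err n; set v := nv n => IH e0 R1.
rewrite a1 expr1n subrr mulr0 addr0 !mul1r.
apply: (@le_trans _ _ ((sigma2 / (e + sigma2)) ^+ 2 * e + (e / (e + sigma2)) ^+ 2 * sigma2)).
  by rewrite lerD2r ler_wpM2l ?sqr_ge0.
by rewrite le_eqVlt; apply/orP; left; apply/eqP; field; rewrite gt_eqF.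
Qed.

Lemma null_pred_var_cvg_unit_root : a = 1 -> nv n @[n --> \oo] --> 0.
Proof.
move=> a1; apply: (@squeeze_cvgr _ _ _ _ (cst 0) err).
- by apply: nearW => n; rewrite null_pred_var_ge0// null_pred_var_le_err.
- exact: cvg_cst.
- by have := err_var_cvg; rewrite steady_err_unit_root.
Qed.

Lemma stable_null_var : a < 1 -> steady_null_var = sigma2 +
  (a * Pe / (Pe + sigma2)) ^+ 2 * sigma2 / (1 - (a * sigma2 / (Pe + sigma2)) ^+ 2).
Proof.
move=> a1; have a0 : 0 <= a by case/andP: a01.
have R0 := steady_inn_gt0; have p0 := steady_err_ge0.
have a2 : a ^+ 2 < 1 by rewrite expr_lt1.
have d0 : 0 < Pe ^+ 2 + 2 * sigma2 * Pe + (1 - a ^+ 2) * sigma2 ^+ 2.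
  rewrite ltr_wpDl//; last by rewrite mulr_gt0 ?exprn_gt0// subr_gt0.
  by rewrite addr_ge0 ?sqr_ge0// !mulr_ge0// ltW.
rewrite /steady_null_var lt_eqF//.
have -> : 1 - (a * sigma2 / (Pe + sigma2)) ^+ 2 =
  (Pe ^+ 2 + 2 * sigma2 * Pe + (1 - a ^+ 2) * sigma2 ^+ 2) / (Pe + sigma2) ^+ 2.
  by field; rewrite gt_eqF.
by field; rewrite !gt_eqF.
Qed.

Lemma null_mse_cvg : (sigma2 + nv n) @[n --> \oo] --> steady_null_var.
Proof.
have [a1|a1] := ltP a 1.
  rewrite stable_null_var//; apply: cvgD; first exact: cvg_cst.
  exact: null_pred_var_cvg_stable.
have {}a1 : a = 1 by apply/eqP; rewrite eq_le a1 andbT; case/andP: a01.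
rewrite /steady_null_var a1 eqxx addr0 mulr1 -[X in _ --> X]addr0.
by apply: cvgD; [exact: cvg_cst|have := null_pred_var_cvg_unit_root a1; rewrite a1].
Qed.

(* [p] is the coefficient of the squared predictor that turns the centred
   log-likelihood into a martingale up to vanishing drift. *)
Lemma corrector_exists : exists2 p, 0 <= p &
  ((inn n)^-1 + p * pl n ^+ 2 - p) * nv n @[n --> \oo] --> 0 /\
  ln (inn n / (Pe + sigma2)) + ((inn n)^-1 - sigma2^-1 + p * gn n ^+ 2) * sigma2
    - (steady_null_var / (Pe + sigma2) - 1) @[n --> \oo] --> 0.
Proof.
have a0 : 0 <= a by case/andP: a01.
have R0 := steady_inn_gt0; have p0 := steady_err_ge0.
have cpl2 : pl n ^+ 2 @[n --> \oo] --> (a * sigma2 / (Pe + sigma2)) ^+ 2.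
  by rewrite expr2; under eq_fun do rewrite expr2; apply: cvgM; exact: pole_cvg.
have cgn2 : gn n ^+ 2 @[n --> \oo] --> (a * Pe / (Pe + sigma2)) ^+ 2.
  by rewrite expr2; under eq_fun do rewrite expr2; apply: cvgM; exact: gain_cvg.
have cln : ln (inn n / (Pe + sigma2)) @[n --> \oo] --> 0.
  rewrite -(@ln1 R); apply: (@cvg_comp _ _ _ (fun n => inn n / (Pe + sigma2)) (@ln R) _ (nbhs (1:R))).
    rewrite -(divff (lt0r_neq0 R0)); apply: cvgM; [exact: innov_var_cvg|exact: cvg_cst].
  exact: continuous_ln.
have [a1|a1] := ltP a 1; last first.
  have {}a1 : a = 1 by apply/eqP; rewrite eq_le a1 andbT; case/andP: a01.
  have P0 := steady_err_unit_root a1.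
  exists 0 => //; split.
    apply: (@cvg_eq_lim _ _ (((Pe + sigma2)^-1 + 0 - 0) * 0)); first by rewrite mulr0.
    apply: cvgM; last exact: null_pred_var_cvg_unit_root.
    apply: cvgB; last exact: cvg_cst.
    apply: cvgD; first exact: innov_varV_cvg.
    by under eq_fun do rewrite mul0r; exact: cvg_cst.
  apply: (@cvg_eq_lim _ _ (0 + ((Pe + sigma2)^-1 - sigma2^-1 + 0) * sigma2 -
     (steady_null_var / (Pe + sigma2) - 1))).
    rewrite /steady_null_var a1 eqxx P0 add0r; field.
    by rewrite gt_eqF.
  apply: cvgB; last exact: cvg_cst.
  apply: cvgD => //; apply: cvgM; last exact: cvg_cst.
  apply: cvgD; last by under eq_fun do rewrite mul0r; exact: cvg_cst.
  by apply: cvgB; [exact: innov_varV_cvg|exact: cvg_cst].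
set f := a * sigma2 / (Pe + sigma2) in cpl2 *.
have f1 : f ^+ 2 < 1.
  have /andP[f0 fa] : 0 <= f <= a.
    rewrite /f divr_ge0 ?mulr_ge0 ?(ltW s20) ?(ltW R0)//=.
    by rewrite ler_pdivrMr// ler_wpM2l// lerDr.
  by rewrite expr_lt1// (le_lt_trans fa).
have f1' : 1 - f ^+ 2 != 0 by rewrite gt_eqF// subr_gt0.
(* The solution of 1 / Re + p f^2 - p = 0, so that the limiting coefficient of the squared predictor
   vanishes; f^2 < 1 makes it well defined. *)
pose p := (Pe + sigma2)^-1 / (1 - f ^+ 2).
exists p; first by rewrite divr_ge0 ?invr_ge0 ?(ltW R0)// subr_ge0 ltW.
split.
  apply: (@cvg_eq_lim _ _ (((Pe + sigma2)^-1 + p * f ^+ 2 - p) *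
     ((a * Pe / (Pe + sigma2)) ^+ 2 * sigma2 / (1 - f ^+ 2)))).
    by rewrite [X in X * _](_ : _ = 0) ?mul0r// /p; field; rewrite f1' gt_eqF.
  apply: cvgM; last exact: null_pred_var_cvg_stable.
  apply: cvgB; last exact: cvg_cst.
  apply: cvgD; first exact: innov_varV_cvg.
  by apply: cvgM => //; exact: cvg_cst.
apply: (@cvg_eq_lim _ _ (0 + ((Pe + sigma2)^-1 - sigma2^-1 +
     p * (a * Pe / (Pe + sigma2)) ^+ 2) * sigma2 - (steady_null_var / (Pe + sigma2) - 1))).
  rewrite stable_null_var// -/f /p; set K := a * Pe / (Pe + sigma2).
  by field; rewrite f1' !gt_eqF.
apply: cvgB; last exact: cvg_cst.
apply: cvgD => //; apply: cvgM; last exact: cvg_cst.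
apply: cvgD; last by apply: cvgM => //; exact: cvg_cst.
by apply: cvgB; [exact: innov_varV_cvg|exact: cvg_cst].
Qed.
End steady_state.

(** * Law of large numbers for the log-likelihood ratio *)

Section loglikelihood.
Context {R : realType}.
Variables (sigma2 Pi0 a p : R).
Hypotheses (s20 : 0 < sigma2) (Pi00 : 0 <= Pi0) (a01 : 0 <= a <= 1) (p0 : 0 <= p).
Local Notation pred := (predictor sigma2 Pi0 a).
Local Notation lr := (lik_ratio sigma2 Pi0 a).
Local Notation inn := (innov_var sigma2 Pi0 a).
Local Notation gn := (gain sigma2 Pi0 a).
Local Notation pl := (pole sigma2 Pi0 a).
Local Notation Re := (steady_err sigma2 Pi0 a + sigma2).
Local Notation Rte := (steady_null_var sigma2 Pi0 a).

(** With X the predictor, the increment of p X^2 - 2 (ln lr + n * exponent) is a combination of X y,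
    y^2 - sigma2, X^2 and 1; this definition and the three after it are its coefficients, in that
    order. *)
Definition mart_cross i := 2 * p * pl i * gn i - 2 * (inn i)^-1.
Definition mart_sqr i := (inn i)^-1 - sigma2^-1 + p * gn i ^+ 2.
Definition drift_pred i := (inn i)^-1 + p * pl i ^+ 2 - p.
Definition drift_cst i := ln (inn i / Re) + mart_sqr i * sigma2 - (Rte / Re - 1).

(* Under the null hypothesis the increments are centred given the past. *)
Fixpoint mart (y : nat -> R) (n : nat) : R :=
  match n with
  | 0%N => 0
  | k.+1 => mart y k + mart_cross k * pred y k * y k + mart_sqr k * (y k ^+ 2 - sigma2)
  end.

Definition exponent : R := 2^-1 * ln (Re / sigma2) + 2^-1 * (Rte / Re) - 2^-1.

Lemma ln_sqrt (x : R) : 0 < x -> ln (Num.sqrt x) = ln x / 2.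
Proof.
move=> x0; have sx : 0 < Num.sqrt x by rewrite sqrtr_gt0.
have := lnXn 2 sx; rewrite (sqr_sqrtr (ltW x0)) => ->.
by rewrite -mulr_natr; field.
Qed.

Lemma ln_lr_factor i m y : ln (lr_factor sigma2 Pi0 a i m y) =
  - (ln (inn i / Re) + ln (Re / sigma2)) / 2 +
  (y ^+ 2 / (2 * sigma2) - (y - m) ^+ 2 / (2 * inn i)).
Proof.
have R0 := innov_var_gt0 s20 Pi00 a01 i; have Re0 := steady_inn_gt0 s20 Pi00 a01.
have r0 : 0 < Num.sqrt (inn i) by rewrite sqrtr_gt0.
have s0 : 0 < Num.sqrt sigma2 by rewrite sqrtr_gt0.
rewrite /lr_factor [LHS]lnM ?posrE ?expR_gt0 ?divr_gt0//.
rewrite [X in _ + X]expRK; congr (_ + _).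
rewrite !ln_div ?posrE// !ln_sqrt//.
by field.
Qed.

(** A pathwise identity: p X^2 telescopes, and the remaining part of each increment is split into a
    centred part and a drift. *)
Lemma ln_lik_ratio_decomp y n : 2 * (ln (lr y n) + n%:R * exponent) =
  - (mart y n + \sum_(i < n) (drift_pred i * pred y i ^+ 2 + drift_cst i)
     - p * pred y n ^+ 2).
Proof.
elim: n => [|n IH].
  by rewrite big_ord0 /= ln1 expr0n/= !(mul0r, mulr0, addr0, subr0, oppr0).
have l0 := lik_ratio_gt0 s20 Pi00 a01 y n.
have f0 := lr_factor_gt0 s20 Pi00 a01 n (pred y n) (y n).
have R0 := innov_var_gt0 s20 Pi00 a01 n; have Re0 := steady_inn_gt0 s20 Pi00 a01.
rewrite big_ord_recr /= lnM ?posrE// ln_lr_factor -natr1.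
move: IH; set S := \sum_(i < n) _; set L := ln (lr y n); set m := pred y n => IH.
transitivity (2 * (L + n%:R * exponent) + (- (ln (inn n / Re) + ln (Re / sigma2)) +
    (y n ^+ 2 / sigma2 - (y n - m) ^+ 2 / inn n) + 2 * exponent)).
  by field; rewrite !gt_eqF.
rewrite IH /exponent /drift_pred /drift_cst /mart_cross /mart_sqr.
by field; rewrite !gt_eqF.
Qed.

Lemma mart_coef_bound i : mart_cross i ^+ 2 <= (2 * p + 2 / sigma2) ^+ 2 /\
  mart_sqr i ^+ 2 <= (p + 1 / sigma2) ^+ 2.
Proof.
have /andP[a0 a1] := a01.
have R0 := innov_var_gt0 s20 Pi00 a01 i.
have /andP[f0 f1] := pole_bound s20 Pi00 a01 i.
have /andP[g0 g1] := gain_bound s20 Pi00 a01 i.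
have b1 : (inn i)^-1 <= sigma2^-1.
  by rewrite lef_pV2 ?posrE// lerDr (err_var_ge0 s20 Pi00 a01).
have b0 : 0 <= (inn i)^-1 by rewrite invr_ge0 ltW.
have s0 : 0 < sigma2^-1 by rewrite invr_gt0.
have fg : 0 <= pl i * gn i <= 1.
  by rewrite mulr_ge0//= mulr_ile1//; [exact: le_trans f1 a1|exact: le_trans g1 a1].
have g2 : 0 <= gn i ^+ 2 <= 1.
  by rewrite sqr_ge0/= exprn_ile1//; exact: le_trans g1 a1.
have pfg : 0 <= p * (pl i * gn i) <= p.
  have /andP[h0 h1] := fg; by rewrite mulr_ge0//= ler_piMr.
have pg2 : 0 <= p * gn i ^+ 2 <= p.
  have /andP[h0 h1] := g2; by rewrite mulr_ge0//= ler_piMr.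
split; rewrite -ler_sqrt ?sqr_ge0// !sqrtr_sqr.
  rewrite [leRHS]ger0_norm; last by rewrite addr_ge0// ?mulr_ge0 ?divr_ge0// ltW.
  by rewrite /mart_cross ler_norml; apply/andP; split; lra.
rewrite [leRHS]ger0_norm; last by rewrite addr_ge0// divr_ge0// ltW.
by rewrite /mart_sqr ler_norml; apply/andP; split; lra.
Qed.

Lemma measurable_mart d (S : measurableType d) (y : nat -> S -> R) n :
  (forall j, (j < n)%N -> measurable_fun [set: S] (y j)) ->
  measurable_fun [set: S] (fun t => mart (y^~ t) n).
Proof.
elim: n => [|n IH] my /=; first exact: measurable_cst.
have my' j (ji : (j < n)%N) := my j (ltnW ji).
pose M t := mart (y^~ t) n; pose X t := pred (y^~ t) n.
have mM : measurable_fun [set: S] M by exact: IH.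
have mX : measurable_fun [set: S] X := measurable_predictor sigma2 Pi0 a my'.
have myn := my n (ltnSn n).
suff : measurable_fun [set: S] (fun t => M t + mart_cross n * X t * y n t +
  mart_sqr n * (y n t ^+ 2 - sigma2)) by [].
by mfun.
Qed.
End loglikelihood.

Lemma ge0_integral_add d (T : measurableType d) (R : realType)
    (P : {measure set T -> \bar R}) (f g : T -> R) :
  measurable_fun [set: T] f -> measurable_fun [set: T] g ->
  (forall t, 0 <= f t) -> (forall t, 0 <= g t) ->
  (\int[P]_t (f t + g t)%:E = \int[P]_t (f t)%:E + \int[P]_t (g t)%:E)%E.
Proof.
move=> mf mg f0 g0.
have mEf : measurable_fun [set: T] (EFin \o f) by exact/measurable_EFinP.
have mEg : measurable_fun [set: T] (EFin \o g) by exact/measurable_EFinP.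
have f0' t : [set: T] t -> (0 <= (EFin \o f) t)%E by rewrite lee_fin.
have g0' t : [set: T] t -> (0 <= (EFin \o g) t)%E by rewrite lee_fin.
exact: (ge0_integralD P measurableT f0' mEf g0' mEg).
Qed.

Section loglikelihood_law_of_large_numbers.
Context {R : realType} {d : measure_display} {T : measurableType d}.
Variable P : probability T R.
Variables (sigma2 Pi0 a : R).
Hypotheses (s20 : 0 < sigma2) (Pi00 : 0 <= Pi0) (a01 : 0 <= a <= 1).
Variables (s1 : {RV P >-> R}) (u w : nat -> {RV P >-> R}).
Hypotheses (lw : forall i, has_law (w i) (gaussian_law 0 sigma2))
  (ind : mutually_independent (sources s1 u w)).
Let y0 : nat -> T -> R := fun i t => w i t.
Local Notation gam := (@std_gauss R).
Local Notation pred := (predictor sigma2 Pi0 a).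
Local Notation lr := (lik_ratio sigma2 Pi0 a).
Local Notation nv := (null_pred_var sigma2 Pi0 a).

Lemma null_pred_var_bounded : exists2 B, 0 <= B & forall n, nv n <= B.
Proof.
have /cvgP/cvg_seq_bounded[M [_ /(_ (M + 1))]] := null_mse_cvg s20 Pi00 a01.
rewrite ltrDl ltr01 => /(_ isT) h; exists (M + 1).
  by rewrite (le_trans _ (h 0%N I)).
move=> n; have /ler_normlW : `|sigma2 + nv n| <= M + 1 := h n I.
by move: s20; lra.
Qed.

Lemma measurable_noise_predictor n : measurable_fun [set: T] (fun t => pred (y0^~ t) n).
Proof. by apply: measurable_predictor => j _; exact: (measurable_funPT (w j)). Qed.

Lemma measurable_noise_mart p n : measurable_fun [set: T] (fun t => mart sigma2 Pi0 a p (y0^~ t) n).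
Proof. by apply: measurable_mart => j _; exact: (measurable_funPT (w j)). Qed.

(** Given the past, [std_gauss_quartic_le] with a the current martingale value bounds the growth by
    a constant plus a multiple of the squared predictor, whose mean under the null law is
    bounded. *)
Lemma mart_second_moment p : 0 <= p -> exists2 C, 0 <= C & forall n,
  (\int[P]_t ((mart sigma2 Pi0 a p (y0^~ t) n) ^+ 2)%:E <= (C * n%:R)%:E)%E.
Proof.
move=> p0; have [B B0 nvB] := null_pred_var_bounded.
have [Mq [Mq0 quart]] := @std_gauss_quartic_le R.
pose A1 := (2 * p + 2 / sigma2) ^+ 2; pose A2 := (p + 1 / sigma2) ^+ 2.
have A10 : 0 <= A1 by exact: sqr_ge0.
have A20 : 0 <= A2 by exact: sqr_ge0.
have sig0 := ltW s20.
pose C := 2 * A1 * sigma2 * B + Mq * A2 * sigma2 ^+ 2.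
have C0 : 0 <= C.
  by apply: addr_ge0; [do 3 apply: mulr_ge0 => //|apply: mulr_ge0; [exact: mulr_ge0|exact: sqr_ge0]].
exists C => //; elim => [|n IH].
  by rewrite mulr0 /=; under eq_integral do rewrite expr0n/=; rewrite probability_integral_cst.
pose M (t : T) := mart sigma2 Pi0 a p (y0^~ t) n.
pose X (t : T) := pred (y0^~ t) n.
set al := mart_cross sigma2 Pi0 a p n; set be := mart_sqr sigma2 Pi0 a p n.
have [hal hbe] : al ^+ 2 <= A1 /\ be ^+ 2 <= A2 by exact: mart_coef_bound.
pose F (q : past_space s1 u w n n * R) :=
  ((M q.1 + al * X q.1 * q.2 + be * (q.2 ^+ 2 - sigma2)) ^+ 2)%:E.
have mF : measurable_fun [set: past_space s1 u w n n * R] F.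
  have mM : measurable_fun [set: past_space s1 u w n n] (M : past_space s1 u w n n -> R).
    apply: (measurable_mart sigma2 Pi0 a p (S := past_space s1 u w n n) (y := y0)) => j jn.
    exact: measurable_past_noise.
  have mX : measurable_fun [set: past_space s1 u w n n] (X : past_space s1 u w n n -> R).
    exact: measurable_past_predictor.
  by rewrite /F; mfun.
have F0 q : (0 <= F q)%E by rewrite lee_fin sqr_ge0.
have -> : (\int[P]_t ((mart sigma2 Pi0 a p (y0^~ t) n.+1) ^+ 2)%:E = \int[P]_t F (t, w n t))%E by [].
rewrite (integral_next_noise s20 lw ind mF F0).
have mM := @measurable_noise_mart p n; have mX := @measurable_noise_predictor n.
rewrite -/X in mX; rewrite -/M in mM.
have mM2 : measurable_fun [set: T] (fun t => M t ^+ 2) by mfun.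
have mX2 : measurable_fun [set: T] (fun t => X t ^+ 2) by mfun.
pose c1 := Mq * (be * sigma2) ^+ 2; pose c2 := 2 * al ^+ 2 * sigma2.
have c10 : 0 <= c1 by rewrite mulr_ge0 ?sqr_ge0.
have c20 : 0 <= c2 by rewrite mulr_ge0// mulr_ge0 ?sqr_ge0.
apply: (@le_trans _ _ (\int[P]_t (M t ^+ 2 + (c1 + c2 * X t ^+ 2))%:E)%E).
  apply: ge0_le_integral => //.
  - by move=> t _; apply: integral_ge0.
  - apply: (@measurable_std_gauss_integral R _ T (fun q => ((M q.1 +
      al * X q.1 * (Num.sqrt sigma2 * q.2) +
      be * ((Num.sqrt sigma2 * q.2) ^+ 2 - sigma2)) ^+ 2)%:E)).
      by mfun.
    by move=> q; rewrite lee_fin sqr_ge0.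
  - by apply/measurable_EFinP; mfun.
  - move=> t _.
    have := quart (M t) (al * X t * Num.sqrt sigma2) (be * sigma2).
    rewrite [X in (_ + 2 * X + _)%:E](_ : _ = al ^+ 2 * X t ^+ 2 * sigma2); last first.
      by rewrite !exprMn sqr_sqrtr.
    rewrite (_ : M t ^+ 2 + 2 * (al ^+ 2 * X t ^+ 2 * sigma2) + Mq * (be * sigma2) ^+ 2 =
      M t ^+ 2 + (c1 + c2 * X t ^+ 2)); last by rewrite /c1 /c2; ring.
    apply: le_trans; rewrite le_eqVlt; apply/orP; left; apply/eqP.
    apply: eq_integral => z _; rewrite /F /=; congr (_ ^+ 2)%:E.
    by rewrite exprMn sqr_sqrtr//; ring.
have mcX : measurable_fun [set: T] (fun t => c1 + c2 * X t ^+ 2) by mfun.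
have cX0 t : 0 <= c1 + c2 * X t ^+ 2 by rewrite addr_ge0// mulr_ge0// sqr_ge0.
rewrite (ge0_integral_add P mM2 mcX (fun t => sqr_ge0 _) cX0).
rewrite (ge0_integral_add_mul P c10 c20 mX2 (fun t => sqr_ge0 _)).
rewrite [X in (_ + (_ + _ * X))%E](null_second_moment Pi0 a s20 lw ind).
apply: (@le_trans _ _ ((C * n%:R)%:E + (c1 + c2 * nv n)%:E)%E).
  by rewrite EFinD EFinM leeD2r.
rewrite -EFinD lee_fin -natr1 mulrDr mulr1 lerD2l /C addrC lerD//.
  rewrite /c2; apply: ler_pM => //.
  - exact: null_pred_var_ge0.
  - by rewrite ler_wpM2r// ler_wpM2l.
by rewrite /c1 exprMn mulrA ler_wpM2r ?sqr_ge0// ler_wpM2l.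
Qed.

(** Chebyshev's inequality controls the martingale, Markov's inequality the drift and the final
    squared predictor. The mean of the drift is dominated by a sum of terms tending to 0, which
    Cesaro's theorem makes negligible against n. *)
Lemma loglik_lln (eta e : R) : 0 < eta -> 0 < e ->
  \forall n \near \oo, (P [set t | (n%:R * eta <=
    `|ln (lr (y0^~ t) n) + n%:R * exponent sigma2 Pi0 a|)%R] <= e%:E)%E.
Proof.
move=> eta0 e0.
have [p p0 [cvd cvc]] := corrector_exists s20 Pi00 a01.
have [C C0 mC] := mart_second_moment p0.
have [B B0 nvB] := null_pred_var_bounded.
pose dr i := drift_pred sigma2 Pi0 a p i; pose dc i := drift_cst sigma2 Pi0 a p i.
(* A bound on the mean absolute drift at step i. *)
pose v i := `|dr i| * nv i + `|dc i|.
have cv : v n @[n --> \oo] --> 0.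
  rewrite -[X in _ --> X]addr0; apply: cvgD; last first.
    by rewrite -(normr0 R); exact: cvg_norm.
  apply: (@cvg_eq_lim _ _ `|0 : R|); first by rewrite normr0.
  have : `|dr n * nv n| @[n --> \oo] --> `|0 : R| by apply: cvg_norm.
  by under eq_fun do rewrite normrM (ger0_norm (null_pred_var_ge0 _ _ s20 _)).
pose S (t : T) n := \sum_(i < n) (`|dr i| * pred (y0^~ t) i ^+ 2 + `|dc i|).
have S0 t n : 0 <= S t n.
  by apply: sumr_ge0 => i _; rewrite addr_ge0// mulr_ge0// sqr_ge0.
have mX2 n : measurable_fun [set: T] (fun t => pred (y0^~ t) n ^+ 2).
  by apply: measurable_funX; exact: measurable_noise_predictor.
have mS n : measurable_fun [set: T] (S^~ n).
  apply: measurable_sum => i; apply: measurable_funD => //.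
  exact: measurable_funM.
have ES n : (\int[P]_t (S t n)%:E = (\sum_(i < n) v i)%:E)%E.
  elim: n => [|n IH].
    rewrite big_ord0; under eq_integral do rewrite /S big_ord0.
    by rewrite probability_integral_cst.
  under eq_integral do rewrite /S big_ord_recr /=.
  rewrite (ge0_integral_add P (mS n)) //; last 2 first.
  - by apply: measurable_funD => //; exact: measurable_funM.
  - by move=> t; rewrite addr_ge0// mulr_ge0// sqr_ge0.
  rewrite IH big_ord_recr/= EFinD; congr (_ + _)%E.
  under eq_integral do rewrite addrC.
  rewrite (ge0_integral_add_mul P (normr_ge0 _) (normr_ge0 _) (mX2 n) (fun t => sqr_ge0 _)).
  by rewrite (null_second_moment Pi0 a s20 lw ind) /v addrC EFinD EFinM.
(* The final bound for sample size m + 1: its terms come from the martingale, the accumulated drift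
   and the last squared predictor. *)
pose r m := C / eta ^+ 2 * harmonic m + (eta^-1 * arithmetic_mean v m +
   eta^-1 * p * B * harmonic m).
have cr : r m @[m --> \oo] --> 0.
  apply: (@cvg_eq_lim _ _ (C / eta ^+ 2 * 0 + (eta^-1 * 0 + eta^-1 * p * B * 0))).
    by rewrite !mulr0 !addr0.
  by apply: cvgD; [|apply: cvgD]; apply: cvgM; (try exact: cvg_cst); (try exact: cvg_harmonic); exact: cesaro.
have /cvgrPdist_le/(_ _ e0)[N _ hN] := cr.
(* The sample size is n.+1, in accordance with the indexing of [harmonic] and [arithmetic_mean]. *)
exists N.+1 => // -[//|n] /= Nn.
have /hN : (N <= n)%N by [].
rewrite sub0r normrN => /ler_normlW rne.
have n0 : 0 < n.+1%:R :> R by rewrite ltr0n.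
set E := [set t | _].
pose M (t : T) := mart sigma2 Pi0 a p (y0^~ t) n.+1.
pose X (t : T) := pred (y0^~ t) n.+1.
have mM : measurable_fun [set: T] M by exact: measurable_noise_mart.
have mM2 : measurable_fun [set: T] (fun t => M t ^+ 2) by exact: measurable_funX.
have mlr : measurable_fun [set: T] (fun t => lr (y0^~ t) n.+1).
  by apply: measurable_lik_ratio => j _; exact: (measurable_funPT (w j)).
have mE : measurable E.
  pose g t := `|ln (lr (y0^~ t) n.+1) + n.+1%:R * exponent sigma2 Pi0 a|.
  rewrite (_ : E = g @^-1` `[n.+1%:R * eta, +oo[); last first.
    by apply/seteqP; split => t; rewrite /E /= in_itv/= andbT.
  rewrite -[X in measurable X]setTI.
  have mg : measurable_fun [set: T] g.
    apply: measurableT_comp => //; apply: measurable_funD => //.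
    by apply: (measurableT_comp (@measurable_ln R)).
  by apply: mg.
pose k1 := ((n.+1%:R * eta) ^+ 2)^-1; pose k2 := (n.+1%:R * eta)^-1.
have k10 : 0 <= k1 by rewrite invr_ge0 sqr_ge0.
have k20 : 0 <= k2 by rewrite invr_ge0 mulr_ge0// ltW.
(* [H] dominates the indicator of E. On E the martingale and the remaining terms add up to at least
   twice n.+1 * eta, by the factor 2 in the decomposition, so one of the two reaches n.+1 * eta. *)
pose H t := k1 * M t ^+ 2 + (k2 * S t n.+1 + (k2 * p) * X t ^+ 2).
have EH t : E t -> 1 <= H t.
  move=> Et; have Neta : 0 < n.+1%:R * eta by rewrite mulr_gt0.
  have := ln_lik_ratio_decomp p s20 Pi00 a01 (y0^~ t) n.+1.
  rewrite -/(M t) -/(X t); set D := \sum_(i < _) _ => dec.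
  have DS : `|D| <= S t n.+1.
    apply: (le_trans (ler_norm_sum _ _ _)); apply: ler_sum => i _.
    by rewrite (le_trans (ler_normD _ _))// normrM (ger0_norm (sqr_ge0 _)).
  have pX : 0 <= p * X t ^+ 2 by rewrite mulr_ge0// sqr_ge0.
  have Et' : n.+1%:R * eta <= `|ln (lr (y0^~ t) n.+1) + n.+1%:R * exponent sigma2 Pi0 a| by [].
  have b1 : 2 * (n.+1%:R * eta) <= `|M t| + (S t n.+1 + p * X t ^+ 2).
    apply: (@le_trans _ _ `|2 * (ln (lr (y0^~ t) n.+1) + n.+1%:R * exponent sigma2 Pi0 a)|).
      by rewrite normrM ger0_norm// ler_wpM2l.
    rewrite dec normrN; apply: (le_trans (ler_normB _ _)).
    rewrite (ger0_norm pX) addrA lerD2r.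
    by apply: (le_trans (ler_normD _ _)); rewrite lerD2l.
  have [h|h] := leP (n.+1%:R * eta) `|M t|.
    have : 1 <= k1 * M t ^+ 2.
      rewrite /k1 mulrC ler_pdivlMr ?exprn_gt0// mul1r -(real_normK (num_real (M t))).
      by rewrite lerXn2r ?nnegrE// ltW.
    have : 0 <= k2 * S t n.+1 by rewrite mulr_ge0.
    have : 0 <= k2 * p * X t ^+ 2 by rewrite -mulrA mulr_ge0.
    by rewrite /H; lra.
  have : 1 <= k2 * S t n.+1 + k2 * p * X t ^+ 2.
    rewrite -mulrA -mulrDr /k2 mulrC ler_pdivlMr// mul1r.
    by move: h b1; set q := n.+1%:R * eta; lra.
  have : 0 <= k1 * M t ^+ 2 by rewrite mulr_ge0// sqr_ge0.
  by rewrite /H; lra.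
have H0 t : 0 <= H t.
  apply: addr_ge0; first by apply: mulr_ge0 => //; exact: sqr_ge0.
  apply: addr_ge0; first exact: mulr_ge0.
  by apply: mulr_ge0; [exact: mulr_ge0|exact: sqr_ge0].
have mkM : measurable_fun [set: T] (fun t => k1 * M t ^+ 2) by apply: measurable_funM.
have mkS : measurable_fun [set: T] (fun t => k2 * S t n.+1).
  by apply: measurable_funM => //; exact: mS.
have mkX : measurable_fun [set: T] (fun t => k2 * p * X t ^+ 2).
  by apply: measurable_funM => //; exact: mX2.
have mH : measurable_fun [set: T] H.
  exact: (measurable_funD mkM (measurable_funD mkS mkX)).
apply: (@le_trans _ _ (\int[P]_t (H t)%:E)%E).
  rewrite -[leLHS]mul1e -[X in (_ <= X)%E]/(\int[P]_t (H t)%:E)%E.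
  rewrite -(integral_cst P mE).
  rewrite integral_mkcond; apply: ge0_le_integral => //.
  - by move=> t _; rewrite patchE; case: ifP.
  - by apply/(measurable_restrictT _ _).1.
  - exact/measurable_EFinP.
  - move=> t _; rewrite patchE; case: ifPn => [|_]; last by rewrite lee_fin.
    by rewrite inE lee_fin => /EH.
have kS0 t : 0 <= k2 * S t n.+1 by rewrite mulr_ge0.
have kX0 t : 0 <= k2 * p * X t ^+ 2.
  by apply: mulr_ge0; [exact: mulr_ge0|exact: sqr_ge0].
rewrite /H (ge0_integral_add P mkM (measurable_funD mkS mkX)); last 2 first.
- by move=> t; rewrite mulr_ge0// sqr_ge0.
- by move=> t; rewrite addr_ge0.
rewrite (ge0_integral_add P mkS mkX kS0 kX0).
have scal (k : R) (h : T -> R) : 0 <= k -> measurable_fun [set: T] h -> (forall t, 0 <= h t) ->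
    (\int[P]_t (k * h t)%:E = k%:E * \int[P]_t (h t)%:E)%E.
  move=> k0 mh h0; have := ge0_integral_add_mul P (lexx 0) k0 mh h0.
  by under eq_integral do rewrite add0r; rewrite add0e.
rewrite !scal//; try by move=> t; exact: sqr_ge0.
- rewrite ES [X in (_ + (_ + _ * X))%E](null_second_moment Pi0 a s20 lw ind).
  apply: (@le_trans _ _ (k1%:E * (C * n.+1%:R)%:E +
     (k2%:E * (\sum_(i < n.+1) v i)%:E + (k2 * p)%:E * (nv n.+1)%:E))%E).
    by apply: leeD2r; apply: lee_wpmul2l; [rewrite lee_fin|exact: mC].
  rewrite -!EFinM -!EFinD lee_fin (le_trans _ rne)// /r /harmonic /arithmetic_mean /series /= big_mkord.
  apply: lerD.
    rewrite le_eqVlt /k1; apply/orP; left; apply/eqP; field.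
    by rewrite !gt_eqF.
  apply: lerD.
    rewrite le_eqVlt /k2; apply/orP; left; apply/eqP; field.
    by rewrite !gt_eqF.
  apply: (@le_trans _ _ (k2 * p * B)); first by (apply: ler_wpM2l; [exact: mulr_ge0|exact: (nvB n.+1)]).
  rewrite le_eqVlt /k2; apply/orP; left; apply/eqP; field.
  by rewrite !gt_eqF.
- exact: mulr_ge0.
- exact: mX2.
Qed.
End loglikelihood_law_of_large_numbers.

(** * The Neyman-Pearson lemma *)

Section neyman_pearson_lemma.
Context {R : realType} {d d' : measure_display} {T : measurableType d}
  {S : measurableType d'}.
Variables (P : probability T R) (Y0 Y1 : T -> S) (L : S -> R).
Hypotheses (mY0 : measurable_fun [set: T] Y0) (mY1 : measurable_fun [set: T] Y1)
  (mL : measurable_fun [set: S] L) (L0 : forall v, 0 < L v)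
  (dens : forall h : S -> \bar R, measurable_fun [set: S] h ->
    (forall v, 0 <= h v)%E ->
    (\int[P]_t h (Y1 t) = \int[P]_t ((L (Y0 t))%:E * h (Y0 t)))%E).

Definition randomized_test (phi : S -> R) :=
  measurable_fun [set: S] phi /\ forall v, 0 <= phi v <= 1.

Local Notation size phi := (\int[P]_t (phi (Y0 t))%:E)%E.
Local Notation missp phi := (\int[P]_t (1 - phi (Y1 t))%:E)%E.

Section test_integrals.
Variable phi : S -> R.
Hypothesis tphi : randomized_test phi.

Let mphi : measurable_fun [set: S] phi. Proof. by case: tphi. Qed.
Let phi0 v : 0 <= phi v. Proof. by case: tphi => _ /(_ v) /andP[]. Qed.
Let phi1 v : 0 <= 1 - phi v.
Proof. by rewrite subr_ge0; case: tphi => _ /(_ v) /andP[]. Qed.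

Lemma test_measurable0 : measurable_fun [set: T] (fun t => phi (Y0 t)).
Proof. exact: (measurableT_comp mphi mY0). Qed.

Lemma test_measurableC0 : measurable_fun [set: T] (fun t => L (Y0 t) * (1 - phi (Y0 t))).
Proof.
apply: measurable_funM; first exact: (measurableT_comp mL mY0).
by apply: measurable_funB => //; exact: test_measurable0.
Qed.

Lemma miss_density : (missp phi = \int[P]_t (L (Y0 t) * (1 - phi (Y0 t)))%:E)%E.
Proof.
have mh : measurable_fun [set: S] (fun v => (1 - phi v)%:E).
  by apply/measurable_EFinP; exact: measurable_funB.
exact: (dens mh (fun v => phi1 v)).
Qed.

Lemma miss_ge0 : (0 <= missp phi)%E.
Proof. by apply: integral_ge0 => t _; rewrite lee_fin. Qed.

Lemma miss_le1 : (missp phi <= 1)%E.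
Proof.
rewrite -(probability_integral_cst P 1).
apply: ge0_le_integral => //.
- by move=> t _; rewrite lee_fin.
- apply/measurable_EFinP; apply: measurable_funB => //.
  exact: (measurableT_comp mphi mY1).
- by move=> t _; rewrite lee_fin gerBl.
Qed.
End test_integrals.

Lemma integral_scale_ge0 (k : R) (f : T -> R) : 0 <= k ->
  measurable_fun [set: T] f -> (forall t, 0 <= f t) ->
  (\int[P]_t (k * f t)%:E = k%:E * \int[P]_t (f t)%:E)%E.
Proof.
move=> k0 mf f0; have := ge0_integral_add_mul P (lexx 0) k0 mf f0.
by under eq_integral do rewrite add0r; rewrite add0e.
Qed.

Definition threshold_test (tau gamma : R) (v : S) : R :=
  if tau < L v then 1 else if L v == tau then gamma else 0.

Lemma threshold_testE tau gamma v : threshold_test tau gamma v =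
  \1_(L @^-1` `]tau, +oo[) v + gamma * \1_(L @^-1` [set tau]) v.
Proof.
rewrite /threshold_test !indicE.
have -> : (v \in L @^-1` `]tau, +oo[) = (tau < L v).
  by apply/idP/idP; rewrite inE /= in_itv/= andbT.
have -> : (v \in L @^-1` [set tau]) = (L v == tau).
  by apply/idP/eqP; rewrite inE.
case: ltgtP => [|h|h]; rewrite /= ?mulr0 ?addr0 ?mulr1 ?add0r//.
Qed.

Lemma threshold_test_randomized tau gamma : 0 <= gamma <= 1 ->
  randomized_test (threshold_test tau gamma).
Proof.
move=> g01; split=> [|v].
  rewrite (_ : threshold_test _ _ = fun v => \1_(L @^-1` `]tau, +oo[) v +
      gamma * \1_(L @^-1` [set tau]) v); last by apply/funext => v; exact: threshold_testE.
  have mI (A : set R) : measurable A -> measurable_fun [set: S] (\1_(L @^-1` A) : S -> R).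
    by move=> mA; apply: measurable_indic; rewrite -[X in measurable X]setTI; exact: mL.
  by apply: measurable_funD; [exact: mI|apply: measurable_funM => //; exact: mI].
by rewrite /threshold_test; case: ifP => _; rewrite ?ler01 ?lexx//; case: ifP => _; rewrite ?lexx ?ler01.
Qed.

(** The threshold test minimizes the Lagrangian L (1 - phi) + tau phi pointwise. Integrating gives
    the inequality between misses plus tau times sizes, and the exact size of the threshold test
    makes the size terms cancel. *)
Lemma threshold_test_optimal tau gamma alpha psi : 0 <= tau -> 0 <= gamma <= 1 ->
  0 <= alpha ->
  (size (threshold_test tau gamma) = alpha%:E)%E -> randomized_test psi ->
  (size psi <= alpha%:E)%E -> (missp (threshold_test tau gamma) <= missp psi)%E.
Proof.
move=> tau0 g01 al0 sE tpsi spsi.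
have tphi := threshold_test_randomized tau g01; set phi := threshold_test tau gamma in sE tphi *.
have ineq v : L v * (1 - phi v) + tau * phi v <= L v * (1 - psi v) + tau * psi v.
  have /andP[p0 p1] := tpsi.2 v.
  rewrite -subr_ge0.
  have -> : L v * (1 - psi v) + tau * psi v - (L v * (1 - phi v) + tau * phi v) =
    (L v - tau) * (phi v - psi v) by ring.
  rewrite /phi /threshold_test; case: ltgtP => h.
  - by apply: mulr_ge0; rewrite subr_ge0// ltW.
  - by apply: mulr_le0; rewrite subr_le0// ltW.
  - by rewrite h subrr mul0r.
have key (chi : S -> R) : randomized_test chi ->
    (\int[P]_t (L (Y0 t) * (1 - chi (Y0 t)) + tau * chi (Y0 t))%:E =
     missp chi + tau%:E * size chi)%E.
  move=> tchi; have chi01 := tchi.2.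
  rewrite (ge0_integral_add P).
  - rewrite -miss_density// integral_scale_ge0//; first exact: test_measurable0.
    by move=> t; case/andP: (chi01 (Y0 t)).
  - exact: test_measurableC0.
  - by apply: measurable_funM => //; exact: test_measurable0.
  - by move=> t; rewrite mulr_ge0 ?(ltW (L0 _))// subr_ge0; case/andP: (chi01 (Y0 t)).
  - by move=> t; rewrite mulr_ge0//; case/andP: (chi01 (Y0 t)).
have H : (missp phi + tau%:E * alpha%:E <= missp psi + tau%:E * alpha%:E)%E.
  rewrite -[X in (_ + _ * X <= _)%E]sE -key//.
  apply: (@le_trans _ _ (missp psi + tau%:E * size psi)%E); last first.
    by apply: leeD2l; apply: lee_wpmul2l.
  rewrite -key//; apply: ge0_le_integral => //.
  - move=> t _; rewrite lee_fin addr_ge0// mulr_ge0// ?(ltW (L0 _))//.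
      by rewrite subr_ge0; case/andP: (tphi.2 (Y0 t)).
    by case/andP: (tphi.2 (Y0 t)).
  - apply/measurable_EFinP; apply: measurable_funD; first exact: test_measurableC0.
    by apply: measurable_funM => //; exact: test_measurable0.
  - apply/measurable_EFinP; apply: measurable_funD; first exact: test_measurableC0.
    by apply: measurable_funM => //; exact: test_measurable0.
  - by move=> t _; rewrite lee_fin.
by rewrite -EFinM leeD2rE in H.
Qed.

(** The threshold is the (1 - alpha)-quantile of L under the null law, so that P(L > tau) <= alpha
    <= P(L >= tau); randomizing on the atom L = tau makes up the difference. *)
Lemma threshold_exists (alpha : R) : 0 < alpha < 1 -> exists tau gamma,
  [/\ 0 <= tau, 0 <= gamma <= 1 &
    size (threshold_test tau gamma) = alpha%:E].
Proof.
move=> /andP[al0 al1].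
have mLY : measurable_fun [set: T] (fun t => L (Y0 t)) by exact: (measurableT_comp mL mY0).
pose X : {RV P >-> R} := HB.pack (fun t => L (Y0 t)) (isMeasurableFun.Build _ _ _ _ _ mLY).
have mpre (A : set R) : measurable A -> measurable (X @^-1` A).
  by move=> mA; rewrite -[X in measurable X]setTI; have h := mLY; exact: h.
pose E := [set r | ((1 - alpha)%:E <= cdf X r)%E].
have cdf_le0 r : r <= 0 -> cdf X r = 0%E.
  move=> r0; rewrite /cdf /distribution /pushforward (_ : _ @^-1` _ = set0) ?measure0//.
  apply/seteqP; split => t //=; rewrite in_itv/= => h.
  by have := L0 (Y0 t); rewrite ltNge (le_trans h r0).
have Epos r : E r -> 0 < r.
  move=> Er; rewrite ltNge; apply/negP => r0; move: Er.
  by rewrite /E /= (cdf_le0 _ r0) lee_fin subr_le0 leNgt al1.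
have Elb : has_lbound E by exists 0 => r /Epos /ltW.
have Ene : E !=set0.
  apply/set0P/eqP => E0.
  have : (1 <= (1 - alpha)%:E)%E.
    apply: (cvge_to_le (cvg_cdfy1 X)); apply: nearW => r; rewrite leNgt; apply/negP => h.
    by have : E r := ltW h; rewrite E0.
  by rewrite lee_fin; lra.
pose tau := inf E.
have hinf : has_inf E by split.
have tau0 : 0 <= tau by apply: lb_le_inf => // r /Epos /ltW.
have up r : tau < r -> ((1 - alpha)%:E <= cdf X r)%E.
  move=> /(inf_lt Ene) [q Eq qr].
  by apply: (le_trans Eq); apply: cdf_nondecreasing; exact: ltW.
have dn r : r < tau -> (cdf X r < (1 - alpha)%:E)%E.
  move=> tr; rewrite ltNge; apply/negP => Er.
  by have := ge_inf Elb Er; rewrite leNgt tr.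
have Ftau : ((1 - alpha)%:E <= cdf X tau)%E.
  apply: (cvge_to_ge (@cdf_right_continuous _ _ _ P X tau)).
  by near=> r; apply: up; near: r; exact: nbhs_right_gt.
have mlt r : measurable (X @^-1` `]-oo, r[) by exact: mpre.
have mle r : measurable (X @^-1` `]-oo, r]) by exact: mpre.
have meq r : measurable (X @^-1` [set r]) by exact: mpre.
(* The left limit of the distribution function at tau, obtained from levels strictly below tau,
   where it stays under 1 - alpha. *)
have Fminus : (P (X @^-1` `]-oo, tau[) <= (1 - alpha)%:E)%E.
  pose F k := X @^-1` `]-oo, (tau - k.+1%:R^-1)].
  have EF : X @^-1` `]-oo, tau[ = \bigcup_k F k.
    apply/seteqP; split => t /=; rewrite in_itv/=.
      move=> h; have [k hk] := ltr_add_invr h.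
      by exists k => //; rewrite /F /= in_itv/= lerBrDr ltW.
    by move=> [k _]; rewrite /F /= in_itv/= => /le_lt_trans; apply; rewrite gtrBl invr_gt0.
  have ndF : nondecreasing_seq F.
    move=> k l kl; apply/subsetPset => t; rewrite /F /= !in_itv/= => h; apply: (le_trans h).
    by rewrite lerD2l lerN2 lef_pV2 ?posrE// ler_nat ltnS.
  have mUF : measurable (\bigcup_k F k) by rewrite -EF.
  have cvF := nondecreasing_cvg_mu (mu := P) (fun k => mle (tau - k.+1%:R^-1)) mUF ndF.
  rewrite EF; apply: (cvge_to_le cvF).
  by apply: nearW => k; apply/ltW/dn; rewrite gtrBl invr_gt0.
have fin A : measurable A -> P A = (fine (P A))%:E.
  by move=> mA; rewrite fineK// fin_num_measure.
pose p := fine (P (X @^-1` `]-oo, tau[)); pose q := fine (P (X @^-1` [set tau])).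
have q0 : 0 <= q by rewrite fine_ge0.
have Epq : cdf X tau = (p + q)%:E.
  rewrite EFinD -!fin// -measureU//.
    congr (P _); apply/seteqP; split => t /=; rewrite !in_itv/= le_eqVlt.
      by move=> /orP[/eqP|]; [right|left].
    by move=> [->|->]; rewrite ?eqxx ?orbT.
  by apply/seteqP; split => t /= -[]; rewrite in_itv/= => h e; move: h; rewrite e ltxx.
have EA : P (X @^-1` `]tau, +oo[) = (1 - (p + q))%:E.
  rewrite EFinB -Epq -(probability_setC P (mle tau)); congr (P _).
  by apply/seteqP; split => t /=; rewrite !in_itv/= andbT ltNge => /negP.
have pq : 1 - alpha <= p + q by rewrite -lee_fin -Epq.
have pl : p <= 1 - alpha by rewrite -lee_fin -fin.
have mS (A : set R) : measurable A -> measurable (L @^-1` A).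
  by move=> mA; rewrite -[X in measurable X]setTI; exact: mL.
have mind (A : set R) : measurable A -> measurable_fun [set: T] (fun t => \1_(L @^-1` A) (Y0 t) : R).
  by move=> mA; apply: (measurableT_comp _ mY0); exact: measurable_indic (mS _ mA).
have iind (A : set R) : measurable A -> (\int[P]_t (\1_(L @^-1` A) (Y0 t))%:E = P (X @^-1` A))%E.
  move=> mA; rewrite -[X @^-1` A]setIT.
  rewrite -(integral_indic P measurableT (mpre _ mA)).
  by apply: eq_integral => t _; rewrite !indicE.
have sizeE g : 0 <= g ->
    (size (threshold_test tau g) = (1 - (p + q) + g * q)%:E)%E.
  move=> g0; under eq_integral do rewrite threshold_testE.
  have mgt : measurable `]tau, +oo[%classic by [].
  have mt : measurable [set tau] by [].
  have ind0 A t : 0 <= \1_(L @^-1` A) (Y0 t) :> R by rewrite indicE.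
  have mg : measurable_fun [set: T] (fun t => g * \1_(L @^-1` [set tau]) (Y0 t)).
    by apply: measurable_funM => //; exact: mind.
  rewrite (ge0_integral_add P (mind _ mgt) mg (ind0 _)); last by move=> t; rewrite mulr_ge0.
  rewrite (integral_scale_ge0 g0 (mind _ mt) (ind0 _)).
  by rewrite !iind// EA [in LHS]fin//.
have [qz|qn] := eqVneq q 0.
  exists tau, 0; split=> //; first by rewrite lexx ler01.
  by rewrite sizeE//; congr (_%:E); move: pq pl; rewrite qz; lra.
have qp : 0 < q by rewrite lt0r qn.
(* The size missing above tau, namely alpha - P(L > tau), divided by the mass q of the atom. *)
exists tau, ((alpha - (1 - (p + q))) / q).
have g01 : 0 <= (alpha - (1 - (p + q))) / q <= 1.
  apply/andP; split; first by apply: divr_ge0 => //; move: pq; lra.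
  by rewrite ler_pdivrMr// mul1r; move: pl; lra.
split=> //; rewrite sizeE; last by case/andP: g01.
by congr (_%:E); field.
Unshelve. all: by end_near. Qed.

Definition most_powerful (alpha : R) (phi : S -> R) :=
  [/\ randomized_test phi, (size phi <= alpha%:E)%E &
    forall psi, randomized_test psi -> (size psi <= alpha%:E)%E ->
      (missp phi <= missp psi)%E].

Lemma most_powerful_exists alpha : 0 < alpha < 1 -> exists phi, most_powerful alpha phi.
Proof.
move=> al01; have [tau [g [tau0 g01 sE]]] := threshold_exists al01.
have al0 : 0 <= alpha by case/andP: al01 => /ltW.
exists (threshold_test tau g); split.
- exact: threshold_test_randomized.
- by rewrite sE.
- by move=> psi; exact: threshold_test_optimal.
Qed.

(** The competitor is [threshold_test c 0], whose miss probability is the null integral of L over L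
    <= c, hence at most c. *)
Lemma most_powerful_miss_le alpha phi c : 0 <= c -> most_powerful alpha phi ->
  (P [set t | (c < L (Y0 t))%R] <= alpha%:E)%E -> (missp phi <= c%:E)%E.
Proof.
move=> c0 [tphi _ opt] hc.
have z01 : 0 <= (0 : R) <= 1 by rewrite lexx ler01.
have tpsi := threshold_test_randomized c z01; set psi := threshold_test c 0 in tpsi.
have mset : measurable [set t | c < L (Y0 t)].
  have -> : [set t | c < L (Y0 t)] = (fun t => L (Y0 t)) @^-1` `]c, +oo[.
    by apply/seteqP; split => t /=; rewrite in_itv/= andbT.
  by rewrite -[X in measurable X]setTI; exact: (measurableT_comp mL mY0).
apply: (@le_trans _ _ (missp psi)).
  apply: opt => //; apply: le_trans hc.
  rewrite -[X in (_ <= P X)%E]setIT -(integral_indic P measurableT mset) le_eqVlt.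
  apply/orP; left; apply/eqP; apply: eq_integral => t _; congr (_%:E).
  rewrite /psi /threshold_test indicE.
  have -> : (t \in [set t | c < L (Y0 t)]) = (c < L (Y0 t)).
    by apply/idP/idP; rewrite inE.
  by case: ltP => //; rewrite if_same.
rewrite miss_density// -(probability_integral_cst P c%:E).
apply: ge0_le_integral => //.
- move=> t _; rewrite lee_fin mulr_ge0 ?(ltW (L0 _))//.
  by rewrite subr_ge0; case/andP: (tpsi.2 (Y0 t)).
- by apply/measurable_EFinP; exact: test_measurableC0.
- move=> t _; rewrite lee_fin /psi /threshold_test; case: ltP => h.
    by rewrite subrr mulr0.
  by rewrite if_same subr0 mulr1.
Qed.

(** Integrate the pointwise bound c <= L (1 - phi) + c 1(L < c) + c phi under the null law. *)
Lemma miss_ge alpha phi c e : 0 <= c -> randomized_test phi ->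
  (size phi <= alpha%:E)%E -> (P [set t | (L (Y0 t) < c)%R] <= e%:E)%E ->
  ((c * (1 - alpha - e))%:E <= missp phi)%E.
Proof.
move=> c0 tphi sphi hc.
have mset : measurable [set t | L (Y0 t) < c].
  have -> : [set t | L (Y0 t) < c] = (fun t => L (Y0 t)) @^-1` `]-oo, c[.
    by apply/seteqP; split => t /=; rewrite in_itv.
  by rewrite -[X in measurable X]setTI; exact: (measurableT_comp mL mY0).
pose I t : R := \1_[set t | L (Y0 t) < c] t.
have mI : measurable_fun [set: T] I by exact: measurable_indic.
have I0 t : 0 <= I t by rewrite /I indicE; case: (_ \in _).
have mp := test_measurable0 tphi.
have p0 t : 0 <= phi (Y0 t) by case/andP: (tphi.2 (Y0 t)).
have C0 t : 0 <= L (Y0 t) * (1 - phi (Y0 t)).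
  by rewrite mulr_ge0 ?(ltW (L0 _))// subr_ge0; case/andP: (tphi.2 (Y0 t)).
have mC := test_measurableC0 tphi.
have mcI : measurable_fun [set: T] (fun t => c * I t) by exact: measurable_funM.
have mcp : measurable_fun [set: T] (fun t => c * phi (Y0 t)) by exact: measurable_funM.
have cI0 t : 0 <= c * I t by rewrite mulr_ge0.
have cp0 t : 0 <= c * phi (Y0 t) by rewrite mulr_ge0.
have H : (c%:E <= missp phi + (c%:E * P [set t | (L (Y0 t) < c)%R] + c%:E * size phi))%E.
  rewrite miss_density// -[X in (_ + (_ * P X + _))%E]setIT -(integral_indic P measurableT mset).
  rewrite -(integral_scale_ge0 c0 mI I0) -(integral_scale_ge0 c0 mp p0).
  rewrite -(ge0_integral_add P mcI mcp cI0 cp0).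
  have mIp := measurable_funD mcI mcp.
  have Ip0 t : 0 <= c * I t + c * phi (Y0 t) by rewrite addr_ge0.
  rewrite -(ge0_integral_add P mC mIp C0 Ip0).
  apply: (@le_trans _ _ (\int[P]_t c%:E)%E); first by rewrite probability_integral_cst.
  apply: ge0_le_integral => //.
  - by apply/measurable_EFinP; exact: (measurable_funD mC mIp).
  - move=> t _; rewrite lee_fin /= /I indicE.
    case: (boolP (_ \in _)) => h; first by have := C0 t; have := cp0 t; rewrite mulr1; lra.
    have {}h : c <= L (Y0 t) by rewrite leNgt; apply/negP => ?; move/negP: h; apply; rewrite inE.
    have : c * (1 - phi (Y0 t)) <= L (Y0 t) * (1 - phi (Y0 t)).
      by rewrite ler_wpM2r// subr_ge0; case/andP: (tphi.2 (Y0 t)).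
    by rewrite /= mulr0; lra.
have H2 : (c%:E <= missp phi + (c * e + c * alpha)%:E)%E.
  apply: (le_trans H); rewrite EFinD !EFinM; apply: leeD2l.
  have c0E : (0 <= c%:E)%E by rewrite lee_fin.
  exact: (leeD (lee_wpmul2l c0E hc) (lee_wpmul2l c0E sphi)).
have -> : c * (1 - alpha - e) = c - (c * e + c * alpha) by ring.
by rewrite EFinB leeBlDr.
Qed.
End neyman_pearson_lemma.

(** * The spectral integral *)

Section integral_of_periodic_function.
Context {R : realType}.
Implicit Types (h : R -> R) (a b c d : R).
Local Notation mu := (@lebesgue_measure R).
Local Notation Int a b h := (\int[mu]_(x in `[a, b]) h x).

Lemma continuous_itv_integrable h a b : continuous h ->
  mu.-integrable `[a, b] (EFin \o h).
Proof.
move=> ch; apply: continuous_compact_integrable; first exact: segment_compact.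
exact: continuous_subspaceT.
Qed.

Lemma Rintegral_affine h a b c d : 0 < c -> a <= b -> continuous h ->
  c * Int a b (fun x => h (c * x + d)) = Int (c * a + d) (c * b + d) h.
Proof.
move=> c0 ab ch; pose F x := c * x + d.
have cF : continuous F.
  by move=> x; apply: cvgD; [apply: cvgM; [exact: cvg_cst|exact: cvg_id]|exact: cvg_cst].
have dF (x : R) : is_derive x 1 F c.
  rewrite -[c in is_derive _ _ _ c]addr0; apply: is_deriveD.
  by rewrite -[X in is_derive _ _ _ X]mulr1; exact: is_deriveZ.
have F'E : derive1 F = cst c by apply/funext => x; rewrite derive1E derive_val.
have chF : continuous (fun x => h (F x)).
  by move=> x; apply: continuous_comp; [exact: cF|exact: ch].
have E : (\int[mu]_(x in `[F a, F b]) (h x)%:E =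
    \int[mu]_(x in `[a, b]) (((h \o F) * (derive1 F)) x)%:E)%E.
  apply: integration_by_substitution_increasing => //.
  - by move=> x y _ _ xy; rewrite /F ltrD2r ltr_pM2l.
  - by move=> x _; rewrite F'E; exact: cvg_cst.
  - by rewrite F'E; exact: is_cvg_cst.
  - by rewrite F'E; exact: is_cvg_cst.
  - split; first by move=> x _; apply: ex_derive.
      by apply: cvg_at_right_filter; exact: cF.
    by apply: cvg_at_left_filter; exact: cF.
  - exact: continuous_subspaceT.
rewrite -(RintegralZl c); [|by []|exact: continuous_itv_integrable].
rewrite /Rintegral -/(F a) -/(F b) E; congr fine.
by apply: eq_integral => x _; rewrite F'E /= mulrC.
Qed.

Lemma Rintegral_split h a b c : a <= b -> b <= c -> continuous h ->
  Int a c h = Int a b h + Int b c h.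
Proof.
move=> ab bc ch.
have := @Rintegral_itvB _ h (BLeft a) (BRight c) b (continuous_itv_integrable a c ch).
rewrite bnd_simp => /(_ ab); rewrite bnd_simp => /(_ bc).
rewrite Rintegral_itv_obnd_cbnd; first by move=> <-; rewrite addrC subrK.
apply: integrableS (continuous_itv_integrable b c ch) => //.
by apply: subset_itvr; rewrite bnd_simp.
Qed.

Variables (h : R -> R) (L : R).
Hypotheses (L0 : 0 <= L) (ch : continuous h) (hL : forall x, h (x + L *+ 2) = h x).

Lemma Rintegral_period : Int (L *+ 2) (L *+ 4) h = Int 0 (L *+ 2) h.
Proof.
have L2 : 0 <= L *+ 2 by rewrite mulrn_wge0.
have := @Rintegral_affine h 0 (L *+ 2) 1 (L *+ 2) ltr01 L2 ch.
rewrite !mul1r add0r (_ : L *+ 2 + L *+ 2 = L *+ 4); last by rewrite -mulrnDr.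
by move=> <-; apply: eq_Rintegral => x _; rewrite mul1r hL.
Qed.

(** The shifted window [L, 3L] and the period [0, 2L] share [L, 2L]; the remaining pieces differ by
    a full period, 2L. *)
Lemma Rintegral_half_shift : Int 0 (L *+ 2) (fun x => h (x + L)) = Int 0 (L *+ 2) h.
Proof.
have L2 : L <= L *+ 2 by rewrite mulr2n lerDl.
have L3 : L *+ 2 <= L *+ 3 by rewrite [leRHS]mulrS lerDr.
have := @Rintegral_affine h 0 (L *+ 2) 1 L ltr01 (le_trans L0 L2) ch.
rewrite !mul1r add0r (_ : L *+ 2 + L = L *+ 3); last by rewrite -mulrSr.
under eq_Rintegral do rewrite mul1r; move=> ->.
rewrite (Rintegral_split L2 L3 ch) (Rintegral_split L0 L2 ch) addrC; congr (_ + _).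
have := @Rintegral_affine h 0 L 1 (L *+ 2) ltr01 L0 ch.
rewrite !mul1r add0r (_ : L + L *+ 2 = L *+ 3); last by rewrite -mulrS.
by move=> <-; apply: eq_Rintegral => x _; rewrite mul1r hL.
Qed.

(** Doubling the argument runs through two periods at twice the speed. *)
Lemma Rintegral_dilation : Int 0 (L *+ 2) (fun x => h (2 * x)) = Int 0 (L *+ 2) h.
Proof.
have L2 : 0 <= L *+ 2 by rewrite mulrn_wge0.
have L4 : L *+ 2 <= L *+ 4 by rewrite ler_wpMn2l.
have := @Rintegral_affine h 0 (L *+ 2) 2 0 (ltr0Sn _ _) L2 ch.
rewrite mulr0 !addr0 (_ : 2 * (L *+ 2) = L *+ 4); last by rewrite mulr_natl -mulrnA.
rewrite (Rintegral_split L2 L4 ch) Rintegral_period.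
under eq_Rintegral do rewrite addr0.
by rewrite -mulr2n -[in RHS]mulr_natl => /mulfI; apply; rewrite pnatr_eq0.
Qed.
End integral_of_periodic_function.

Lemma geometric_bound_eq0 (R : realType) (x C q : R) : 0 <= q < 1 ->
  (forall k, `|x| <= C * q ^+ k) -> x = 0.
Proof.
move=> /andP[q0 q1] h; apply/eqP; rewrite -normr_le0.
have cv : geometric C q k @[k --> \oo] --> (0 : R) by apply: cvg_geometric; rewrite ger0_norm.
by apply: (cvgr_to_ge cv); apply: nearW => k; exact: h.
Qed.

(** * The logarithm of the distance and the Poisson kernel on the circle *)

Section circle_kernel.
Context {R : realType}.
Implicit Types (r x : R).
Local Notation mu := (@lebesgue_measure R).
Local Notation circ h := (\int[mu]_(x in `[0, pi *+ 2]) h x).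

(** This is |1 - r e^(i x)|^2. *)
Definition circle_sqdist r x : R := 1 - 2 * r * cos x + r ^+ 2.
Local Notation den := circle_sqdist.

Lemma circle_sqdist_ge r x : 0 <= r -> (1 - r) ^+ 2 <= den r x.
Proof.
move=> r0; rewrite /circle_sqdist; have := @cos_le1 R x; set c := cos x => c1.
have : r * c <= r by rewrite ler_piMr.
by rewrite expr2; lra.
Qed.

Lemma circle_sqdist_le r x : 0 <= r -> den r x <= (1 + r) ^+ 2.
Proof.
move=> r0; rewrite /circle_sqdist; have := @cos_geN1 R x; set c := cos x => c1.
have : r * -1 <= r * c by rewrite ler_wpM2l.
by rewrite expr2; lra.
Qed.

Lemma circle_sqdist_gt0 r x : 0 <= r < 1 -> 0 < den r x.
Proof.
move=> /andP[r0 r1]; apply: lt_le_trans (circle_sqdist_ge x r0).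
by rewrite exprn_gt0// subr_gt0.
Qed.

(* Since the sum over antipodal points is constant, averaging over [x] and
   [x + pi] replaces [r] by [r ^+ 2] in both integrals. *)
Lemma circle_sqdistM r x : den r x * den r (x + pi) = den (r ^+ 2) (2 * x).
Proof. by rewrite /circle_sqdist cosDpi [2 * x]mulr_natl cos_mulr2n -[_ *+ 2]mulr_natl; ring. Qed.

Lemma circle_sqdistD r x : den r x + den r (x + pi) = 2 * (1 + r ^+ 2).
Proof. by rewrite /circle_sqdist cosDpi; ring. Qed.

Lemma circle_sqdist_period r x : den r (x + pi *+ 2) = den r x.
Proof. by rewrite /circle_sqdist cosD2pi. Qed.

Lemma continuous_circle_sqdist r : continuous (den r).
Proof.
move=> x; apply: cvgD; last exact: cvg_cst.
apply: cvgB; first exact: cvg_cst.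
by apply: cvgM; [exact: cvg_cst|exact: continuous_cos].
Qed.

Lemma continuous_ln_circle_sqdist r : 0 <= r < 1 -> continuous (fun x => ln (den r x)).
Proof.
move=> r01 x; apply: continuous_comp; first exact: continuous_circle_sqdist.
by apply: continuous_ln; exact: circle_sqdist_gt0.
Qed.

Definition poisson_kernel r x := (1 - r ^+ 2) / den r x.

Lemma continuous_poisson_kernel r : 0 <= r < 1 -> continuous (poisson_kernel r).
Proof.
move=> r01 x; apply: cvgM; first exact: cvg_cst.
apply: cvgV; first by rewrite gt_eqF// circle_sqdist_gt0.
exact: continuous_circle_sqdist.
Qed.

Lemma circle_mass : fine (mu `[0, pi *+ 2]) = pi *+ 2.
Proof.
rewrite lebesgue_measure_itv/= lte_fin.
have p0 : 0 < (pi : R) *+ 2 by rewrite mulrn_wgt0 ?pi_gt0.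
by rewrite p0/= oppr0 addr0.
Qed.

Lemma circle_integral_norm_le h C : continuous h -> (forall x, `|h x| <= C) ->
  `|circ h| <= C * pi *+ 2.
Proof.
move=> ch hC; apply: le_trans (le_normr_Rintegral _ (continuous_itv_integrable _ _ ch)) _ => //.
have -> : C * pi *+ 2 = \int[mu]_(x in `[0, pi *+ 2]) C.
  by rewrite Rintegral_cst// circle_mass -mulrnAr.
apply: le_Rintegral => //.
- by apply: continuous_itv_integrable => x; apply: cvg_norm; exact: ch.
- by apply: continuous_itv_integrable => x; exact: cvg_cst.
Qed.

(** A half-turn preserves the integral of h, and x -> 2 x that of k. *)
Lemma circle_integral_double h k : continuous h -> continuous k ->
  (forall x, h (x + pi *+ 2) = h x) -> (forall x, k (x + pi *+ 2) = k x) ->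
  (forall x, h x + h (x + pi) = k (2 * x)) -> 2 * circ h = circ k.
Proof.
move=> ch ck hp kp hk; have p0 := @pi_ge0 R.
have chp : continuous (fun x => h (x + pi)).
  move=> x; apply: continuous_comp; last exact: ch.
  by apply: cvgD; [exact: cvg_id|exact: cvg_cst].
rewrite -(Rintegral_dilation p0 ck kp) mulr_natl mulr2n.
rewrite -[X in _ + X](Rintegral_half_shift p0 ch hp) -RintegralD//.
- by apply: eq_Rintegral => x _; exact: hk.
- exact: continuous_itv_integrable.
- exact: continuous_itv_integrable.
Qed.

Let sqr01 r : 0 <= r < 1 -> 0 <= r ^+ 2 < 1.
Proof. by move=> /andP[r0 r1]; rewrite sqr_ge0/= expr_lt1. Qed.

Lemma ln_circle_sqdist_double r : 0 <= r < 1 ->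
  2 * circ (fun x => ln (den r x)) = circ (fun x => ln (den (r ^+ 2) x)).
Proof.
move=> r01; apply: circle_integral_double.
- exact: continuous_ln_circle_sqdist.
- exact/continuous_ln_circle_sqdist/sqr01.
- by move=> x; rewrite circle_sqdist_period.
- by move=> x; rewrite circle_sqdist_period.
- by move=> x; rewrite -circle_sqdistM lnM// posrE circle_sqdist_gt0.
Qed.

(** Replacing q by q^2 doubles the integral, while the integrals stay uniformly bounded for q <= r;
    iterating backwards bounds the integral by C 2^-k for every k. The induction ranges over all q
    <= r because it moves to q^2. *)
Lemma integral_ln_circle_sqdist r : 0 <= r < 1 -> circ (fun x => ln (den r x)) = 0.
Proof.
move=> r01; have /andP[r0 r1] := r01.
(* For q <= r < 1 the squared distance lies between (1 - r)^2 and 4. *)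
pose C := `|ln ((1 - r) ^+ 2)| + ln 4.
suff H k : forall q, 0 <= q <= r ->
    `|circ (fun x => ln (den q x))| <= C * pi *+ 2 * 2^-1 ^+ k.
  apply: (@geometric_bound_eq0 _ _ (C * pi *+ 2) 2^-1).
    by rewrite invr_ge0 ler0n/= invf_lt1// ltr1n.
  by move=> k; apply: H; rewrite r0 lexx.
elim: k => [|k IH] q /andP[q0 qr]; have q01 : 0 <= q < 1 by rewrite q0 (le_lt_trans qr).
  rewrite expr0 mulr1; apply: circle_integral_norm_le; first exact: continuous_ln_circle_sqdist.
  have [ha hb] : 0 < (1 - r) ^+ 2 /\ (1 - r) ^+ 2 <= (1 - q) ^+ 2.
    have /andP[_ q1] := q01.
    split; first by rewrite exprn_gt0// subr_gt0.
    by rewrite lerXn2r ?nnegrE; lra.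
  move=> x; have dx := circle_sqdist_gt0 x q01.
  have lo : ln ((1 - r) ^+ 2) <= ln (den q x).
    by rewrite ler_ln ?posrE//; apply: le_trans hb (circle_sqdist_ge x q0).
  have hi : ln (den q x) <= ln 4.
    rewrite ler_ln ?posrE//; apply: le_trans (circle_sqdist_le x q0) _.
    have q1 : q <= 1 by case/andP: q01 => _ /ltW.
    by have := mulr_ge0 q0 q0; have := mulr_ge0 q0 (_ : 0 <= 1 - q); rewrite subr_ge0 expr2 => /(_ q1); lra.
  have l4 : 0 <= ln (4 : R) by rewrite ln_ge0// ler1n.
  rewrite ler_norml /C; apply/andP; split.
    by rewrite lerNl; have := ler_norm (- ln ((1 - r) ^+ 2)); rewrite normrN; lra.
  by have := normr_ge0 (ln ((1 - r) ^+ 2)); lra.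
have -> : circ (fun x => ln (den q x)) = 2^-1 * circ (fun x => ln (den (q ^+ 2) x)).
  by rewrite -ln_circle_sqdist_double// mulKf// pnatr_eq0.
rewrite normrM ger0_norm ?invr_ge0// (exprS _ k) mulrCA ler_wpM2l ?invr_ge0//.
apply: IH; rewrite sqr_ge0/= expr2 (le_trans _ qr)// ler_piMr//.
by case/andP: q01 => _ /ltW.
Qed.

Lemma poisson_kernel_double r : 0 <= r < 1 ->
  circ (poisson_kernel r) = circ (poisson_kernel (r ^+ 2)).
Proof.
move=> r01; have r201 := sqr01 r01.
have ck2 := continuous_poisson_kernel r201.
have ck22 : continuous (fun x => 2 * poisson_kernel (r ^+ 2) x).
  by move=> x; apply: cvgM; [exact: cvg_cst|exact: ck2].
have : 2 * circ (poisson_kernel r) = circ (fun x => 2 * poisson_kernel (r ^+ 2) x).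
  apply: circle_integral_double => //.
  - exact: continuous_poisson_kernel.
  - by move=> x; rewrite /poisson_kernel circle_sqdist_period.
  - by move=> x; rewrite /poisson_kernel circle_sqdist_period.
  - move=> x; rewrite /poisson_kernel -circle_sqdistM.
    have d1 := circle_sqdist_gt0 x r01; have d2 := circle_sqdist_gt0 (x + pi) r01.
    have := circle_sqdistD r x; move: d1 d2; set u := den r x; set v := den r _ => d1 d2 uv.
    (* The constant sum u + v = 2 (1 + r^2) completes 1 - r^2 to 2 (1 - r^4), the numerator of twice
       the kernel at r^2. *)
    transitivity ((1 - r ^+ 2) * (u + v) / (u * v)); last by rewrite uv; field; rewrite !gt_eqF.
    by field; rewrite !gt_eqF.
rewrite (RintegralZl 2 _ (continuous_itv_integrable 0 (pi *+ 2) ck2))//.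
by move=> /mulfI; apply; rewrite pnatr_eq0.
Qed.

(** Here q -> q^2 preserves the integral instead of doubling it, so the decay has to come from the
    kernel: it differs from 1 by O(q), and each squaring gains a factor r because q^2 <= r q. *)
Lemma integral_poisson_kernel r : 0 <= r < 1 -> circ (poisson_kernel r) = pi *+ 2.
Proof.
move=> r01; have /andP[r0 r1] := r01; apply/eqP; rewrite -subr_eq0; apply/eqP.
(* The kernel minus 1 is 2 q (cos x - q) / |1 - q e^(i x)|^2, at most 4 q / (1 - r)^2 in absolute
   value; the rest is the length of the circle. *)
pose C := 4 / (1 - r) ^+ 2 * pi *+ 2.
have C0 : 0 <= C by rewrite mulrn_wge0// mulr_ge0 ?pi_ge0// divr_ge0// sqr_ge0.
suff H k : forall q, 0 <= q <= r -> `|circ (poisson_kernel q) - pi *+ 2| <= C * r ^+ k * q.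
  apply: (@geometric_bound_eq0 _ _ (C * r) r) => // k.
  by rewrite mulrAC; apply: H; rewrite r0 lexx.
elim: k => [|k IH] q /andP[q0 qr]; have q01 : 0 <= q < 1 by rewrite q0 (le_lt_trans qr).
  have cp := continuous_poisson_kernel q01.
  have -> : circ (poisson_kernel q) - pi *+ 2 = circ (fun x => poisson_kernel q x - 1).
    rewrite RintegralB//; [|exact: continuous_itv_integrable|]; last first.
      by apply: continuous_itv_integrable => x; exact: cvg_cst.
    by rewrite Rintegral_cst// circle_mass mul1r.
  have -> : C * r ^+ 0 * q = (4 / (1 - r) ^+ 2 * q) * pi *+ 2.
    by rewrite /C expr0; move: (pi : R) => p; ring.
  apply: circle_integral_norm_le.
    by move=> x; apply: cvgB; [exact: cp|exact: cvg_cst].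
  move=> x; have dx := circle_sqdist_gt0 x q01.
  have -> : poisson_kernel q x - 1 = (2 * q * (cos x - q)) / den q x.
    by move: dx; rewrite /poisson_kernel /circle_sqdist => dx; field; rewrite gt_eqF.
  have ha : 0 < (1 - r) ^+ 2 by rewrite exprn_gt0// subr_gt0.
  have hb : (1 - r) ^+ 2 <= den q x.
    apply: le_trans (circle_sqdist_ge x q0).
    by have /andP[_ q1] := q01; rewrite lerXn2r ?nnegrE; lra.
  rewrite normrM normfV (ger0_norm (ltW dx)).
  rewrite ler_pdivrMr// (_ : 4 / _ * q * _ = 4 * q * (den q x / (1 - r) ^+ 2)); last by ring.
  have cq : `|cos x - q| <= 2.
    have := @cos_le1 R x; have := @cos_geN1 R x; have /andP[_ q1] := q01.
    by rewrite ler_norml; lra.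
  apply: (@le_trans _ _ (4 * q)).
    rewrite normrM ger0_norm ?mulr_ge0//.
    by have := ler_wpM2l q0 cq; lra.
  by rewrite ler_peMr ?mulr_ge0// ler_pdivlMr// mul1r.
rewrite poisson_kernel_double//; apply: (le_trans (IH _ _)).
  rewrite sqr_ge0/= expr2 (le_trans _ qr)// ler_piMr//.
  by case/andP: q01 => _ /ltW.
have -> : C * r ^+ k.+1 * q = C * r ^+ k * (r * q) by rewrite exprSr; ring.
by rewrite expr2 ler_wpM2l ?mulr_ge0 ?exprn_ge0// ler_wpM2r.
Qed.
End circle_kernel.

(** * Spectral factorization and the integral formula *)

Section spectral_exponent.
Context {R : realType}.
Variables (sigma2 Pi0 a : R).
Hypotheses (s20 : 0 < sigma2) (Pi00 : 0 <= Pi0) (a01 : 0 <= a < 1).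
Local Notation mu := (@lebesgue_measure R).
Local Notation Pe := (steady_err sigma2 Pi0 a).
Local Notation Re := (Pe + sigma2).
Local Notation Q := (Pi0 * (1 - a ^+ 2)).
Local Notation f := (a * sigma2 / Re).
Local Notation S1 x := (sigma2 + Pi0 * (1 - a ^+ 2) / (1 - 2 * a * cos x + a ^+ 2)).

Let a01' : 0 <= a <= 1. Proof. by case/andP: a01 => -> /ltW. Qed.
Let R0 : 0 < Re. Proof. exact: steady_inn_gt0. Qed.
Let f01 : 0 <= f < 1.
Proof.
have /andP[a0 a1] := a01; have p0 := steady_err_ge0 s20 Pi00 a01'.
rewrite divr_ge0 ?mulr_ge0 ?(ltW s20) ?(ltW R0)//= ltr_pdivrMr// mul1r.
apply: (@lt_le_trans _ _ (1 * sigma2)); first by rewrite ltr_pM2r.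
by rewrite mul1r lerDr.
Qed.

(** After clearing denominators, the coefficients of cos x match because sigma2 a = Re f, and the
    constant terms match by the Riccati fixed-point equation. *)
Lemma spectral_factorization x :
  S1 x = Re * circle_sqdist f x / circle_sqdist a x.
Proof.
have da := circle_sqdist_gt0 x a01.
have : sigma2 * circle_sqdist a x + Q = Re * circle_sqdist f x.
  have fE := riccati_fixpoint s20 Pi00 a01'.
  rewrite /circle_sqdist; move: fE R0; set p := Pe; set c := cos x => fE Rp.
  have -> : Q = p - a ^+ 2 * p * sigma2 / (p + sigma2) by move: fE; lra.
  by field; rewrite gt_eqF.
rewrite -/(circle_sqdist a x); move: da; set u := circle_sqdist a x; set v := circle_sqdist _ x.
by move=> u0 <-; field; rewrite gt_eqF.
Qed.

(** The factorization splits the logarithm, and sigma2 / S1 = 1 - Q / (Re |1 - f e^(i x)|^2) makes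
    the second term a multiple of the Poisson kernel up to a constant. *)
Lemma spectral_integrandE x :
  2^-1 * ln (S1 x / sigma2) + sigma2 / (2 * S1 x) - 2^-1 =
  2^-1 * ln (Re / sigma2) + (2^-1 * ln (circle_sqdist f x) +
   (- 2^-1 * ln (circle_sqdist a x) + - (Q / (2 * Re * (1 - f ^+ 2))) * poisson_kernel f x)).
Proof.
have da := circle_sqdist_gt0 x a01; have df := circle_sqdist_gt0 x f01.
have SE := spectral_factorization x.
have S1p : 0 < S1 x by rewrite SE divr_gt0// mulr_gt0.
have Q1 : sigma2 = S1 x - Q / circle_sqdist a x by rewrite /circle_sqdist addrK.
have f2 : 0 < 1 - f ^+ 2 by case/andP: f01 => f0 f1; rewrite subr_gt0 expr_lt1.
have -> : sigma2 / (2 * S1 x) = 2^-1 - Q / (2 * Re * circle_sqdist f x).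
  rewrite [X in X / _]Q1 SE; move: da df R0; set u := circle_sqdist a x; set v := circle_sqdist _ x; set r := Re.
  by move=> u0 v0 r0; field; rewrite !gt_eqF.
have -> : ln (S1 x / sigma2) = ln (Re / sigma2) + ln (circle_sqdist f x) - ln (circle_sqdist a x).
  have rs : 0 < Re / sigma2 by rewrite divr_gt0.
  have -> : S1 x / sigma2 = Re / sigma2 * circle_sqdist f x / circle_sqdist a x.
    by rewrite SE -!mulrA; congr (_ * _); rewrite [RHS]mulrC -mulrA.
  by rewrite (ln_div (mulr_gt0 rs df) da) (lnM rs df).
rewrite /poisson_kernel.
move: f2 df R0; set g := 1 - f ^+ 2; set v := circle_sqdist _ x; set r := Re => g0 v0 r0.
by field; rewrite !gt_eqF.
Qed.

(** The two logarithms integrate to 0 and the kernel has mean 1, so the claim reduces to the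
    algebraic identity Rte = Re - Q / (1 - f^2). *)
Lemma spectral_exponent :
  2^-1 * ln (Re / sigma2) + 2^-1 * (steady_null_var sigma2 Pi0 a / Re) - 2^-1 =
  (2 * pi)^-1 * \int[mu]_(x in `[0, 2 * pi])
     (2^-1 * ln (S1 x / sigma2) + sigma2 / (2 * S1 x) - 2^-1).
Proof.
have pi0 := @pi_gt0 R.
rewrite (mulr_natl pi 2); under eq_Rintegral do rewrite spectral_integrandE.
have clf := continuous_ln_circle_sqdist f01; have cla := continuous_ln_circle_sqdist a01.
have cpf := continuous_poisson_kernel f01.
have cZ (k : R) (h : R -> R) : continuous h -> continuous (fun x => k * h x).
  by move=> ch x; apply: cvgM; [exact: cvg_cst|exact: ch].
have cD (g h : R -> R) : continuous g -> continuous h -> continuous (fun x => g x + h x).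
  by move=> cg ch x; apply: cvgD; [exact: cg|exact: ch].
have iD (g h : R -> R) : continuous g -> continuous h ->
    \int[mu]_(x in `[0, pi *+ 2]) (g x + h x) =
    \int[mu]_(x in `[0, pi *+ 2]) g x + \int[mu]_(x in `[0, pi *+ 2]) h x.
  by move=> cg ch; apply: RintegralD => //; exact: continuous_itv_integrable.
have iZ (k : R) (h : R -> R) : continuous h ->
    \int[mu]_(x in `[0, pi *+ 2]) (k * h x) = k * \int[mu]_(x in `[0, pi *+ 2]) h x.
  by move=> ch; apply: RintegralZl => //; exact: continuous_itv_integrable.
have c1 := cZ 2^-1 _ clf; have c2 := cZ (- 2^-1) _ cla.
have c3 := cZ (- (Q / (2 * Re * (1 - f ^+ 2)))) _ cpf.
have c23 := cD _ _ c2 c3; have c0 : continuous (fun _ : R => 2^-1 * ln (Re / sigma2)).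
  by move=> x; exact: cvg_cst.
rewrite (iD _ _ c0 (cD _ _ c1 c23)) (iD _ _ c1 c23) (iD _ _ c2 c3).
rewrite (iZ _ _ clf) (iZ _ _ cla) (iZ _ _ cpf).
rewrite !integral_ln_circle_sqdist// integral_poisson_kernel// Rintegral_cst// circle_mass.
rewrite stable_null_var//; last by case/andP: a01.
have f2 : 0 < 1 - f ^+ 2 by case/andP: f01 => f0 f1; rewrite subr_gt0 expr_lt1.
have QE : Q = Pe - a ^+ 2 * Pe * sigma2 / Re.
  by have := riccati_fixpoint s20 Pi00 a01'; lra.
rewrite QE; move: f2 R0; move: (pi : R) pi0 => p p0.
set r := Re; set l := ln _ => f2 r0.
have Per : Pe = r - sigma2 by rewrite /r addrK.
have r2 : r ^+ 2 - (a * sigma2) ^+ 2 = r ^+ 2 * (1 - (a * sigma2 / r) ^+ 2).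
  by field; rewrite gt_eqF.
rewrite Per; field.
by rewrite r2 !gt_eqF// mulr_gt0// exprn_gt0.
Qed.
End spectral_exponent.

(** A constant factor c0 in the lower bound changes the exponent only by ln c0 / n. *)
Lemma exponent_squeeze (R : realType) (m : nat -> R) (K c0 : R) : 0 < c0 ->
  (forall eta, 0 < eta -> \forall n \near \oo, m n <= expR (- (n%:R * (K - eta)))) ->
  (forall eta, 0 < eta -> \forall n \near \oo, expR (- (n%:R * (K + eta))) * c0 <= m n) ->
  - (n%:R^-1 * ln (m n)) @[n --> \oo] --> K.
Proof.
move=> c00 hu hl; apply/cvgrPdist_le => e e0.
have he : 0 < e / 2 by rewrite divr_gt0.
(* From this n on, |ln c0| / n is at most e / 2. *)
have hc : \forall n \near \oo, `|ln c0| / (e / 2) <= n%:R by exact: nbhs_infty_ger.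
near=> n.
have n0 : 0 < n%:R :> R by rewrite ltr0n; near: n; exact: nbhs_infty_gt.
have U : m n <= expR (- (n%:R * (K - e / 2))) by near: n; exact: hu.
have B : expR (- (n%:R * (K + e / 2))) * c0 <= m n by near: n; exact: hl.
have C : `|ln c0| / (e / 2) <= n%:R by near: n; exact: hc.
have lb0 : 0 < expR (- (n%:R * (K + e / 2))) * c0 by rewrite mulr_gt0// expR_gt0.
have m0 : 0 < m n := lt_le_trans lb0 B.
have U' : ln (m n) <= - (n%:R * (K - e / 2)) by rewrite -[leRHS]expRK ler_ln ?posrE ?expR_gt0.
have B' : - (n%:R * (K + e / 2)) + ln c0 <= ln (m n).
  by rewrite -[X in X + _]expRK -lnM ?posrE ?expR_gt0// ler_ln ?posrE.
have C' : `|ln c0| <= n%:R * (e / 2) by rewrite -ler_pdivrMr.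
have := ler_norm (- ln c0); rewrite normrN => C''.
have -> : K - - (n%:R^-1 * ln (m n)) = (n%:R * K + ln (m n)) / n%:R by field; rewrite gt_eqF.
rewrite normrM normfV (ger0_norm (ltW n0)) ler_pdivrMr// ler_norml.
move: U' B' C' C''; set N := n%:R; set l := ln (m n); set lc := ln c0 => U' B' C' C''.
by apply/andP; split; lra.
Unshelve. all: by end_near. Qed.

(** * The miss exponent *)

Section miss_exponent.
Context {R : realType} {d : measure_display} {T : measurableType d}.
Variable P : probability T R.
Variables (sigma2 Pi0 a : R).
Hypotheses (s20 : 0 < sigma2) (Pi00 : 0 <= Pi0) (a01 : 0 <= a <= 1).
Variables (s1 : {RV P >-> R}) (u w : nat -> {RV P >-> R}).
Hypotheses (ls1 : has_law s1 (gaussian_law 0 Pi0))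
  (lu : forall i, has_law (u i) (gaussian_law 0 (Pi0 * (1 - a ^+ 2))))
  (lw : forall i, has_law (w i) (gaussian_law 0 sigma2))
  (ind : mutually_independent (sources s1 u w)).
Let s : nat -> T -> R := gauss_markov a s1 (fun x => u x).
Let y0 : nat -> T -> R := fun i t => w i t.
Let y1 : nat -> T -> R := fun i t => s i t + w i t.
Local Notation K := (exponent sigma2 Pi0 a).

Lemma neyman_pearson_most_powerful alpha n (phi : n.-tuple R -> R) :
  neyman_pearson P y0 y1 alpha phi <->
  most_powerful P (past y0 n) (past y1 n) alpha phi.
Proof. by rewrite /neyman_pearson /false_alarm /miss unlock. Qed.

Definition tuple_lik_ratio n (v : n.-tuple R) := lik_ratio sigma2 Pi0 a (nth 0 v) n.
Local Notation L := (@tuple_lik_ratio _).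

Lemma measurable_tuple_lik_ratio n :
  measurable_fun [set: n.-tuple R] (@tuple_lik_ratio n).
Proof.
apply: (@measurable_lik_ratio _ sigma2 Pi0 a _ _ (fun j (v : n.-tuple R) => v`_j)) => j jn.
exact: measurable_nth_tuple.
Qed.

Lemma tuple_lik_ratio_gt0 n (v : n.-tuple R) : 0 < tuple_lik_ratio v.
Proof. exact: lik_ratio_gt0. Qed.

Lemma tuple_lik_ratio_density n (h : n.-tuple R -> \bar R) :
  measurable_fun [set: n.-tuple R] h -> (forall v, 0 <= h v)%E ->
  (\int[P]_t h (past y1 n t) =
   \int[P]_t ((tuple_lik_ratio (past y0 n t))%:E * h (past y0 n t)))%E.
Proof.
move=> mh h0; apply: (etrans (obs_density s20 Pi00 a01 ls1 lu lw ind mh h0)).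
by apply: eq_integral => t _; rewrite /tuple_lik_ratio lik_ratio_past.
Qed.

Let mp0 n : measurable_fun [set: T] (past y0 n). Proof. exact: measurable_past0. Qed.
Let mp1 n : measurable_fun [set: T] (past y1 n). Proof. exact: measurable_past1. Qed.

Lemma measurable_null_lik_ratio n :
  measurable_fun [set: T] (fun t => tuple_lik_ratio (past y0 n t)).
Proof. exact: (measurableT_comp (@measurable_tuple_lik_ratio n) (@mp0 n)). Qed.

Lemma neyman_pearson_exists alpha n : 0 < alpha < 1 ->
  exists phi : n.-tuple R -> R, neyman_pearson P y0 y1 alpha phi.
Proof.
move=> al01; have [phi hphi] := most_powerful_exists (@mp0 n) (@measurable_tuple_lik_ratio n)
  (@tuple_lik_ratio_gt0 n) (@tuple_lik_ratio_density n) al01.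
by exists phi; apply/neyman_pearson_most_powerful.
Qed.

Let Lt n t := tuple_lik_ratio (past y0 n t).
Let Dev (eta : R) n := [set t | n%:R * eta <= `|ln (Lt n t) + n%:R * K|].

Let Dev_small eta e : 0 < eta -> 0 < e -> \forall n \near \oo, (P (Dev eta n) <= e%:E)%E.
Proof.
move=> eta0 e0; have := loglik_lln s20 Pi00 a01 lw ind eta0 e0; apply: filterS => n.
rewrite (_ : Dev eta n = [set t | n%:R * eta <= `|ln (lik_ratio sigma2 Pi0 a (y0^~ t) n) + n%:R * K|])//.
by apply/seteqP; split => t; rewrite /Dev /Lt /tuple_lik_ratio /= lik_ratio_past.
Qed.

Let measurable_superlevel (g : T -> R) (c : R) : measurable_fun [set: T] g ->
  measurable [set t | c <= g t].
Proof.
move=> mg; rewrite (_ : [set t | _] = g @^-1` `[c, +oo[).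
  by rewrite -[X in measurable X]setTI; apply: mg.
by apply/seteqP; split => t /=; rewrite in_itv/= andbT.
Qed.

Let measurable_Dev eta n : measurable (Dev eta n).
Proof.
apply: measurable_superlevel; apply: measurableT_comp => //; apply: measurable_funD => //.
by apply: (measurableT_comp (@measurable_ln R)); exact: measurable_null_lik_ratio.
Qed.

Lemma lik_ratio_large eta e : 0 < eta -> 0 < e ->
  \forall n \near \oo, (P [set t | (expR (- (n%:R * (K - eta))) < Lt n t)%R] <= e%:E)%E.
Proof.
move=> eta0 e0; have := Dev_small eta0 e0; apply: filterS => n; apply: le_trans.
set c := expR _; have mc : measurable [set t | c < Lt n t].
  rewrite (_ : [set t | _] = ~` [set t | - c <= - Lt n t]).
    apply: measurableC; apply: measurable_superlevel; apply: measurable_funN.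
    exact: measurable_null_lik_ratio.
  by apply/seteqP; split => t /=; rewrite lerN2 ltNge => /negP.
apply: le_measure; rewrite ?inE; [exact: mc|exact: measurable_Dev|].
move=> t /= h; rewrite /Dev /=.
have Lp : 0 < Lt n t by exact: tuple_lik_ratio_gt0.
have : - (n%:R * (K - eta)) < ln (Lt n t) by rewrite -[ltLHS]expRK ltr_ln ?posrE ?expR_gt0.
have := ler_norm (ln (Lt n t) + n%:R * K).
set N := n%:R; set l := ln _; lra.
Qed.

Lemma lik_ratio_small eta e : 0 < eta -> 0 < e ->
  \forall n \near \oo, (P [set t | (Lt n t < expR (- (n%:R * (K + eta))))%R] <= e%:E)%E.
Proof.
move=> eta0 e0; have := Dev_small eta0 e0; apply: filterS => n; apply: le_trans.
set c := expR _; have mc : measurable [set t | Lt n t < c].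
  rewrite (_ : [set t | _] = ~` [set t | c <= Lt n t]).
    apply: measurableC; apply: measurable_superlevel.
    exact: measurable_null_lik_ratio.
  by apply/seteqP; split => t /=; rewrite ltNge => /negP.
apply: le_measure; rewrite ?inE; [exact: mc|exact: measurable_Dev|].
move=> t /= h; rewrite /Dev /=.
have Lp : 0 < Lt n t by exact: tuple_lik_ratio_gt0.
have : ln (Lt n t) < - (n%:R * (K + eta)) by rewrite -[ltRHS]expRK ltr_ln ?posrE ?expR_gt0.
have := ler_norm (- (ln (Lt n t) + n%:R * K)); rewrite normrN.
set N := n%:R; set l := ln _; lra.
Qed.

Lemma miss_exponent alpha (phi : forall n : nat, n.-tuple R -> R) : 0 < alpha < 1 ->
  (forall n, neyman_pearson P y0 y1 alpha (phi n)) ->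
  - (n%:R^-1 * ln (fine (miss P y1 (phi n)))) @[n --> \oo] --> K.
Proof.
move=> /andP[al0 al1] hphi.
have mphi n := (neyman_pearson_most_powerful alpha (phi n)).1 (hphi n).
have missE n : miss P y1 (phi n) = (\int[P]_t (1 - phi n (past y1 n t))%:E)%E.
  by rewrite /miss unlock.
have fin n : (fine (miss P y1 (phi n)))%:E = miss P y1 (phi n).
  rewrite fineK// ge0_fin_numE ?missE.
    by rewrite (le_lt_trans (miss_le1 P (@mp1 n) _)) ?ltry//; case: (mphi n).
  by apply: miss_ge0; case: (mphi n).
(* The same number serves as the exceptional null probability e and as the factor 1 - alpha - e left
   in the lower bound. The upper bound takes e = alpha instead, so the level enters only through
   factors independent of n. *)
have c00 : 0 < (1 - alpha) / 2 by rewrite divr_gt0// subr_gt0.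
apply: (exponent_squeeze c00) => eta eta0.
- have := lik_ratio_large eta0 al0; apply: filterS => n hn.
  rewrite -lee_fin fin missE.
  exact: (most_powerful_miss_le (@mp0 n) (@measurable_tuple_lik_ratio n)
    (@tuple_lik_ratio_gt0 n) (@tuple_lik_ratio_density n) (expR_ge0 _) (mphi n) hn).
- have := lik_ratio_small eta0 c00; apply: filterS => n hn.
  rewrite -lee_fin fin missE; have [tphi sphi _] := mphi n.
  have := miss_ge (@mp0 n) (@measurable_tuple_lik_ratio n)
    (@tuple_lik_ratio_gt0 n) (@tuple_lik_ratio_density n) (expR_ge0 _) tphi sphi hn.
  by rewrite (_ : 1 - alpha - (1 - alpha) / 2 = (1 - alpha) / 2)//; field.
Qed.
End miss_exponent.

Theorem theorem1 (R : realType) (d : measure_display) (T : measurableType d)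
  (P : probability T R) (sigma2 Pi0 a : R)
  (s1 : {RV P >-> R}) (u w : nat -> {RV P >-> R}) :
  let Q := Pi0 * (1 - a ^+ 2) in
  0 < sigma2 -> 0 <= Pi0 -> 0 <= a <= 1 ->
  has_law s1 (gaussian_law 0 Pi0) ->
  (forall i, has_law (u i) (gaussian_law 0 Q)) ->
  (forall i, has_law (w i) (gaussian_law 0 sigma2)) ->
  mutually_independent (sources s1 u w) ->
  let s : nat -> T -> R := gauss_markov a s1 u in
  let y0 : nat -> T -> R := fun i t => w i t in
  let y1 : nat -> T -> R := fun i t => s i t + w i t in
  let Perr := 2^-1 * Num.sqrt ((sigma2 * (1 - a ^+ 2) - Q) ^+ 2
                                + 4 * sigma2 * Q)
              - 2^-1 * sigma2 * (1 - a ^+ 2) + Q / 2 in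
  let Re := Perr + sigma2 in
  let Rte := sigma2 *
      (1 + (if a == 1 then 0
            else a ^+ 2 * Perr ^+ 2 /
                 (Perr ^+ 2 + 2 * sigma2 * Perr
                  + (1 - a ^+ 2) * sigma2 ^+ 2))) in
  let K := 2^-1 * ln (Re / sigma2) + 2^-1 * (Rte / Re) - 2^-1 in
  let S0 : R -> R := fun=> sigma2 in
  let S1 : R -> R := fun omega =>
      sigma2 + Pi0 * (1 - a ^+ 2) / (1 - 2 * a * cos omega + a ^+ 2) in
  [/\ (* the Neyman-Pearson detectors exist, and their miss exponent is K *)
      forall alpha : R, 0 < alpha < 1 ->
        (forall n : nat, exists phi : n.-tuple R -> R,
           neyman_pearson P y0 y1 alpha phi) /\
        (forall phi : forall n : nat, n.-tuple R -> R,
           (forall n, neyman_pearson P y0 y1 alpha (phi n)) ->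
           - (n%:R^-1 * ln (fine (miss P y1 (phi n)))) @[n --> \oo] --> K),
      (* one-step prediction of y under H1, and its innovation variances *)
      (forall i : nat, exists c : 'I_i -> R,
         is_cond_exp P (y1 i) (past y1 i)
           (fun v => \sum_(j < i) c j * tnth v j)) /\
      (forall yhat : forall i : nat, i.-tuple R -> R,
         (forall i, is_cond_exp P (y1 i) (past y1 i) (yhat i)) ->
         ('E_P[fun t => ((y1 i t - yhat i (past y1 i t)) ^+ 2)%R]
            @[i --> \oo] --> Re%:E)%E /\
         ('E_P[fun t => ((y0 i t - yhat i (past y0 i t)) ^+ 2)%R]
            @[i --> \oo] --> Rte%:E)%E),
      (* one-step prediction of s under H1, and its error variance *)
      (forall i : nat, exists g : i.-tuple R -> R,
         is_cond_exp P (s i) (past y1 i) g) /\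
      (forall shat : forall i : nat, i.-tuple R -> R,
         (forall i, is_cond_exp P (s i) (past y1 i) (shat i)) ->
         ('E_P[fun t => ((s i t - shat i (past y1 i t)) ^+ 2)%R]
            @[i --> \oo] --> Perr%:E)%E)
    & a < 1 ->
        K = (2 * pi)^-1 *
            \int[lebesgue_measure]_(omega in `[0, 2 * pi])
              (2^-1 * ln (S1 omega / S0 omega)
               + S0 omega / (2 * S1 omega) - 2^-1)].

Proof.
move=> Q s20 Pi00 a01 ls1 lu lw ind s y0 y1 Perr Re Rte K S0 S1; split.
- move=> alpha al01; split; first by move=> n; exact: (neyman_pearson_exists s20 Pi00 a01 ls1 lu lw ind n al01).
  move=> phi hphi; exact: (miss_exponent s20 Pi00 a01 ls1 lu lw ind al01 hphi).
- split.
    move=> i; have [c hc] := tuple_predictor_linear sigma2 Pi0 a i; exists c.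
    have := obs_cond_exp s20 Pi00 a01 ls1 lu lw ind i.
    by rewrite (_ : tuple_predictor _ _ _ (n:=i) = fun v => \sum_(j < i) c j * tnth v j)//; exact/funext.
  move=> yhat hy; split.
    under eq_fun do rewrite (obs_mse s20 Pi00 a01 ls1 lu lw ind (hy _)).
    by apply: cvg_EFin; [exact: nearW|exact: innov_var_cvg].
  under eq_fun do rewrite (null_mse s20 Pi00 a01 ls1 lu lw ind (hy _)).
  by apply: cvg_EFin; [exact: nearW|exact: null_mse_cvg].
- split; first by move=> i; eexists; exact: (state_cond_exp s20 Pi00 a01 ls1 lu lw ind i).
  move=> shat hs; under eq_fun do rewrite (state_mse s20 Pi00 a01 ls1 lu lw ind (hs _)).
  by apply: cvg_EFin; [exact: nearW|exact: err_var_cvg].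
- move=> a1; apply: spectral_exponent => //.
  by case/andP: a01 => -> _.
Qed.
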